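(* Let $K$ be a field with $\mathrm{char}\,K\ne 2$. Let $G=\mathsf{G}_a \times \mathsf{G}_m$ and let $x,y\in\mathrm{Lie}(G)$ be non-zero elements spanning $\mathrm{Lie}(\mathsf{G}_a)$ and $\mathrm{Lie}(\mathsf{G}_m)$, respectively. Given $\alpha,\beta\in K$, let $\mathbb{G}=G_{1,\alpha x+\beta y}$ be the algebraic supergroup corresponding to the Harish-Chandra pair $(G,V)$ which consists of $G$, a one-dimensional trivial right $G$-module $V=Kv$, and the bracket determined by $[v,v]=2(\alpha x+\beta y)$. Regard $\mathsf{G}_a=\mathsf{G}_a\times 1$ as a central closed super-subgroup of $\mathbb{G}$, so that $\mathbb{G}/\mathsf{G}_a\simeq(\mathsf{G}_m)_{1,\beta y}$, the algebraic supergroup corresponding to the Harish-Chandra pair $(\mathsf{G}_m,Kv)$ with $Kv$ trivial and $[v,v]=2\beta y$. Then: (1) The quotient morphism $\mathbb{G} \to \mathbb{G}/\mathsf{G}_a$ splits if and only if $\alpha=0$. (2) The following are equivalent: $\mathbb{G}_u = \mathsf{G}_a$; $(\mathsf{G}_m)_{1,\beta y}$ is super-diagonalizable; $\beta\ne 0$.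
   Context: ''Super'' means $\mathbb{Z}_2$-graded. An algebraic supergroup $\mathbb{G}$ over $K$ is a group-valued functor on super-commutative superalgebras represented by a finitely generated super-commutative Hopf superalgebra $K[\mathbb{G}]$; algebraic groups (group schemes) $G$ are regarded as algebraic supergroups $R\mapsto G(R_0)$. $\mathbb{G}_{ev}$ is the algebraic group represented by $K[\mathbb{G}]/(K[\mathbb{G}]_1)$, a closed super-subgroup of $\mathbb{G}$. For a normal closed super-subgroup $\mathbb{N}$, $\mathbb{G}/\mathbb{N}$ is represented by the unique Hopf super-subalgebra $B\subset K[\mathbb{G}]$ with $K[\mathbb{G}]/B^+K[\mathbb{G}]=K[\mathbb{N}]$, $B^+=\mathrm{Ker}\,\varepsilon_B$. $\mathsf{G}_a,\mathsf{G}_m$ are the additive and multiplicative groups. A quotient morphism splits if it has a section that is a morphism of supergroups. A supergroup is unipotent if its only simple supermodules are the trivial one-dimensional ones (in either parity). The unipotent radical $\mathbb{G}_u$ is the largest unipotent normal closed super-subgroup of $\mathbb{G}$. $\mathbb{G}$ is super-diagonalizable if $\mathbb{G}_{ev}$ is diagonalizable and $\mathbb{G}_u=1$. A Harish-Chandra pair is a pair $(G,V)$ of an algebraic group $G$ and a finite-dimensional right $G$-module $V$, with a $G$-equivariant (for the right adjoint action on $\mathrm{Lie}(G)$) bilinear map (bracket) $[\ ,\ ]:V\times V\to\mathrm{Lie}(G)$ such that $[v,v']=[v',v]$ and $v\triangleleft[v,v]=0$ for all $v,v'\in V$, where $\triangleleft$ is the induced right $\mathrm{Lie}(G)$-action on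 $V$. A morphism $(\phi,\psi):(G_1,V_1)\to(G_2,V_2)$ is a morphism $\phi:G_1\to G_2$ of algebraic groups and a $G_1$-equivariant linear map $\psi:V_1\to V_2$ with $[\psi(v),\psi(v')]=\mathrm{Lie}(\phi)([v,v'])$. Known: $\mathbb{G}\mapsto(\mathbb{G}_{ev},\mathrm{Lie}(\mathbb{G})_1)$, with bracket restricted from the Lie superalgebra $\mathrm{Lie}(\mathbb{G})$ and the right adjoint action of $\mathbb{G}_{ev}$, is a category equivalence from algebraic supergroups to Harish-Chandra pairs; ''corresponding to'' refers to this equivalence. Explicitly, $K[\mathbb{G}]$ for $\mathbb{G}=G_{1,w}$ ($w=\alpha x+\beta y$) is $K[G]\otimes\wedge(z)$ with $z$ an odd primitive and $\Delta(b)=\Delta_{K[G]}(b)+\langle w,b_{(2)}\rangle\Delta_{K[G]}(b_{(1)})(z\otimes z)$ for $b\in K[G]$, where $\langle\ ,\ \rangle:\mathrm{Lie}(G)\times K[G]\to K$ is the canonical pairing; similarly for $(\mathsf{G}_m)_{1,\beta y}$. *)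

(* Defs.v *)
From HB Require Import structures.
From mathcomp Require Import all_boot all_algebra.
From mathcomp Require Import finmap boolp monalg zify.

Set Implicit Arguments.
Unset Strict Implicit.
Unset Printing Implicit Defensive.

Import GRing.Theory.
Local Open Scope ring_scope.

(* Commutative monoid algebras K[M], over monalg's finitely supported
   functions; monalg's own product does not allow monoids with invertible
   elements. *)

HB.lock Definition linext (K : fieldType) (M : choiceType) (V : lmodType K)
  (f : M -> V) (x : {malg K[M]}) : V := \sum_(k <- msupp x) x@_k *: f k.

Section LinearExtension.
Variables (K : fieldType) (M : choiceType) (V : lmodType K).
Local Notation linext := (@linext K M V).

Lemma linextE f x : linext f x = \sum_(k <- msupp x) x@_k *: f k.
Proof. by rewrite linext.unlock. Qed.

Lemma linextEw (f : M -> V) (d : {fset M}) x :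
  (msupp x `<=` d)%fset -> linext f x = \sum_(k <- d) x@_k *: f k.
Proof.
move=> le; rewrite linext.unlock; apply: big_fset_incl => // k _ /mcoeff_outdom ->.
by rewrite scale0r.
Qed.

Lemma linext_linear f : linear (linext f).
Proof.
move=> k x y.
set d := (msupp x `|` msupp y)%fset.
have ledx : (msupp x `<=` d)%fset by exact: fsubsetUl.
have ledy : (msupp y `<=` d)%fset by exact: fsubsetUr.
have led : (msupp (k *: x + y) `<=` d)%fset.
  apply: (fsubset_trans (msuppD_le _ _)); apply: fsetSU; exact: msuppZ_le.
rewrite (linextEw f led) (linextEw f ledx) (linextEw f ledy) scaler_sumr.
rewrite -big_split /=.
by apply: eq_bigr => m _; rewrite mcoeffD mcoeffZ scalerDl scalerA.
Qed.

HB.instance Definition _ f :=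
  GRing.isLinear.Build K {malg K[M]} V *:%R (linext f) (linext_linear f).

Lemma linextU f k : linext f << k >> = f k.
Proof. by rewrite linext.unlock msuppU oner_eq0 big_seq_fset1 mcoeffUU scale1r. Qed.

Lemma malg_linear_ext (f g : {malg K[M]} -> V) : linear f -> linear g ->
  (forall k, f << k >> = g << k >>) -> f =1 g.
Proof.
move=> lf lg fg x.
pose F := GRing.isLinear.Build K {malg K[M]} V *:%R f lf.
pose Gm := GRing.isLinear.Build K {malg K[M]} V *:%R g lg.
pose f' : {linear {malg K[M]} -> V} := HB.pack f F.
pose g' : {linear {malg K[M]} -> V} := HB.pack g Gm.
rewrite -[f x]/(f' x) -[g x]/(g' x) (monalgE x) !linear_sum.
apply: eq_bigr => k _.
have -> : << x@_k *g k >> = x@_k *: << k >> :> {malg K[M]}.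
  by apply/malgP => m; rewrite mcoeffZ !mcoeffU mulrnAr mulr1.
by rewrite !linearZ /= fg.
Qed.

End LinearExtension.

Definition monoid_alg (K : fieldType) (M : nmodType) : Type := {malg K[M]}.

(* locked, to keep unification from comparing distinct monomials *)
HB.lock Definition mon (K : fieldType) (M : nmodType) (m : M) :
  monoid_alg K M := << m >>.

Section MonoidAlgebra.
Variables (K : fieldType) (M : nmodType).
Local Notation A := (monoid_alg K M).

HB.instance Definition _ := GRing.Lmodule.on A.

Local Notation mon := (@mon K M).

Definition monmul (x y : A) : A :=
  linext (fun m => linext (fun n => mon (m + n)) y : A) x.

Lemma monmul_linl y : linear (monmul^~ y).
Proof. exact: linext_linear. Qed.

Lemma monmul_linr x : linear (monmul x).
Proof.
move=> k y z; rewrite /monmul [LHS]linextE ![linext _ x]linextE.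
rewrite scaler_sumr -big_split /=; apply: eq_bigr => m _.
by rewrite linext_linear scalerDr !scalerA mulrC.
Qed.

Lemma monmulE m n : monmul (mon m) (mon n) = mon (m + n).
Proof. by rewrite /monmul mon.unlock !linextU. Qed.

Lemma monalg_ext (V : lmodType K) (f g : A -> V) : linear f -> linear g ->
  (forall m, f (mon m) = g (mon m)) -> f =1 g.
Proof. by rewrite mon.unlock; exact: malg_linear_ext. Qed.

Lemma monmulC : commutative monmul.
Proof.
move=> x y; move: x; apply: monalg_ext; [exact: monmul_linl|exact: monmul_linr|].
move=> m; move: y; apply: monalg_ext; [exact: monmul_linr|exact: monmul_linl|].
by move=> n; rewrite !monmulE addrC.
Qed.

Lemma monmulA : associative monmul.
Proof.
move=> x y z; move: x; apply: monalg_ext.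
- exact: monmul_linl.
- by move=> k u v; rewrite !monmul_linl.
move=> m; move: y; apply: monalg_ext.
- by move=> k u v; rewrite monmul_linl monmul_linr.
- by move=> k u v; rewrite monmul_linr monmul_linl.
move=> n; move: z; apply: monalg_ext.
- by move=> k u v; rewrite !monmul_linr.
- by move=> k u v; rewrite !monmul_linr.
by move=> l; rewrite !monmulE addrA.
Qed.

Lemma monmul1 : left_id (mon 0) monmul.
Proof.
apply: monalg_ext => [|k x y|m]; [exact: monmul_linr | by [] |].
by rewrite monmulE add0r.
Qed.

Lemma monmulDl : left_distributive monmul +%R.
Proof. by move=> x y z; rewrite -[x]scale1r monmul_linl !scale1r. Qed.

Lemma mon1_neq0 : mon 0 != 0.
Proof.
rewrite mon.unlock.
by apply/eqP => /malgP /(_ 0) /eqP; rewrite mcoeffUU mcoeff0 oner_eq0.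
Qed.

HB.instance Definition _ := GRing.Zmodule_isComNzRing.Build A
  monmulA monmulC monmul1 monmulDl mon1_neq0.

Lemma mon_scaleAl (k : K) (x y : A) : k *: (x * y) = (k *: x) * y.
Proof.
rewrite -[RHS]/(monmul _ _) -[k *: x]addr0 monmul_linl.
by rewrite [X in _ + X](_ : _ = 0) ?addr0 // -[LHS]/(0 * y) mul0r.
Qed.

HB.instance Definition _ := GRing.Lmodule_isLalgebra.Build K A mon_scaleAl.
HB.instance Definition _ := GRing.Lalgebra_isComAlgebra.Build K A.

Lemma monM m n : mon m * mon n = mon (m + n). Proof. exact: monmulE. Qed.
Lemma mon0 : mon 0 = 1 :> A. Proof. by []. Qed.

Lemma mcoeff_mon m n : (mon m : {malg K[M]})@_n = (m == n)%:R.
Proof. by rewrite mon.unlock; exact: mcoeffU. Qed.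

Lemma monalg_sum (a : A) : a = \sum_(k <- msupp a) a@_k *: mon k.
Proof.
rewrite mon.unlock [LHS]monalgE; apply: eq_bigr => k _; apply/malgP => m.
by rewrite mcoeffZ !mcoeffU mulrnAr mulr1.
Qed.

Lemma linext_mon (V : lmodType K) (f : M -> V) m : linext f (mon m) = f m.
Proof. by rewrite mon.unlock; exact: linextU. Qed.

End MonoidAlgebra.

(* Superspaces: a Z/2-grading is given by the projection onto the odd part. *)

Record grading (K : fieldType) (V : lmodType K) := Grading {
  odd_part :> V -> V;
  odd_part_linear : linear odd_part;
  odd_partK : forall v, odd_part (odd_part v) = odd_part v
}.

(* [homog gr i v]: v is homogeneous of parity i (false = even, true = odd) *)
Definition homog (K : fieldType) (V : lmodType K) (gr : grading V)
  (i : bool) (v : V) : Prop := gr v = if i then v else 0.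

Record superspace (K : fieldType) := Superspace {
  ss_car :> lmodType K;
  ss_gr : grading ss_car
}.

(* Super-commutative superalgebras. The axiom [sa_sqr] follows from [sa_comm]
   when char K <> 2; it belongs to the usual definition in general. An algType
   is nonzero; the omitted zero superalgebra carries no information, every
   represented functor being a point on it. *)
Record superalg (K : fieldType) := Superalg {
  sa_car :> algType K;
  sa_gr : grading sa_car;
  sa_one : homog sa_gr false 1;
  sa_mul : forall i j a b, homog sa_gr i a -> homog sa_gr j b ->
    homog sa_gr (i (+) j) (a * b);
  sa_comm : forall i j a b, homog sa_gr i a -> homog sa_gr j b ->
    b * a = (-1) ^+ (i && j) * (a * b);
  sa_sqr : forall a, homog sa_gr true a -> a * a = 0
}.

Definition even_superalg (K : fieldType) (A : superalg K) : Prop :=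
  forall a : A, homog (sa_gr A) false a.

Section SuperalgTheory.
Variables (K : fieldType) (R : superalg K).
Implicit Types a b c : R.

Lemma homog_linear i k a b : homog (sa_gr R) i a -> homog (sa_gr R) i b ->
  homog (sa_gr R) i (k *: a + b).
Proof.
rewrite /homog => ha hb; rewrite odd_part_linear ha hb.
by case: i {ha hb}; rewrite // scaler0 addr0.
Qed.

Lemma homog0 i : homog (sa_gr R) i 0.
Proof.
have := odd_part_linear (sa_gr R) (-1) 0 0.
by rewrite scaleN1r oppr0 addr0 scaleN1r addNr /homog => ->; case: i.
Qed.

Lemma homogD i a b : homog (sa_gr R) i a -> homog (sa_gr R) i b ->
  homog (sa_gr R) i (a + b).
Proof. by rewrite -[a in a + b]scale1r; exact: homog_linear. Qed.

Lemma homogZ i k a : homog (sa_gr R) i a -> homog (sa_gr R) i (k *: a).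
Proof. by move=> ha; rewrite -[k *: a]addr0; apply/homog_linear/homog0. Qed.

Lemma homogN i a : homog (sa_gr R) i a -> homog (sa_gr R) i (- a).
Proof. by rewrite -scaleN1r; exact: homogZ. Qed.

Lemma homogM_even a b : homog (sa_gr R) false a -> homog (sa_gr R) false b ->
  homog (sa_gr R) false (a * b).
Proof. by move=> ha hb; exact: (sa_mul ha hb). Qed.

Lemma homogM_odd a b : homog (sa_gr R) true a -> homog (sa_gr R) true b ->
  homog (sa_gr R) false (a * b).
Proof. by move=> ha hb; exact: (sa_mul ha hb). Qed.

Lemma homogX_even n a : homog (sa_gr R) false a ->
  homog (sa_gr R) false (a ^+ n).
Proof.
move=> ha; elim: n => [|n IHn]; first exact: sa_one.
by rewrite exprS; apply: homogM_even.
Qed.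

Lemma even_oddE a : exists b c,
  [/\ homog (sa_gr R) false b, homog (sa_gr R) true c & a = b + c].
Proof.
exists (a - sa_gr R a), (sa_gr R a); split; last by rewrite subrK.
  rewrite /homog addrC -scaleN1r odd_part_linear odd_partK.
  by rewrite scaleN1r addNr.
by rewrite /homog odd_partK.
Qed.

Lemma even_central a b : homog (sa_gr R) false a -> a * b = b * a.
Proof.
have [c [d [hc hd ->]]] := even_oddE b => ha.
rewrite mulrDl mulrDr (sa_comm ha hc) (sa_comm ha hd) /=.
by rewrite expr0 !mul1r.
Qed.

Lemma odd_anticomm a b : homog (sa_gr R) true a -> homog (sa_gr R) true b ->
  b * a = - (a * b).
Proof. by move=> ha hb; rewrite (sa_comm ha hb) /= expr1 mulN1r. Qed.

End SuperalgTheory.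

Definition is_shom (K : fieldType) (A B : superalg K) (f : A -> B) : Prop :=
  [/\ linear f, f 1 = 1, {morph f : a b / a * b} &
      forall a, f (sa_gr A a) = sa_gr B (f a)].

Record shom (K : fieldType) (A B : superalg K) := SHom {
  shom_fun :> A -> B;
  shomP : is_shom shom_fun
}.

Section SHomTheory.
Variables (K : fieldType).
Implicit Types A B C D : superalg K.

HB.instance Definition _ A B (f : shom A B) :=
  GRing.isLinear.Build K A B *:%R (shom_fun f)
    (let: And4 h _ _ _ := shomP f in h).

HB.instance Definition _ A B (f : shom A B) :=
  GRing.isMonoidMorphism.Build A B (shom_fun f)
    (let: And4 _ h1 h2 _ := shomP f in (h1, h2)).

Lemma shom_ext A B (f g : shom A B) : f =1 g -> f = g.
Proof.
case: f g => [f hf] [g hg] /= /funext fg; rewrite -{}fg in hg *.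
by congr SHom; exact: Prop_irrelevance.
Qed.

Lemma shom_odd A B (f : shom A B) a : f (sa_gr A a) = sa_gr B (f a).
Proof. by case: (shomP f). Qed.

Lemma shom_homog A B (f : shom A B) i a :
  homog (sa_gr A) i a -> homog (sa_gr B) i (f a).
Proof.
by rewrite /homog -shom_odd => ->; case: i; rewrite ?linear0.
Qed.

Lemma shom_comp_subproof A B C (f : shom B C) (g : shom A B) :
  is_shom (f \o g).
Proof.
split=> [k a b|||a] /=.
- by rewrite !linearP.
- by rewrite !rmorph1.
- by move=> a b /=; rewrite !rmorphM.
by rewrite !shom_odd.
Qed.

Definition shom_comp A B C (f : shom B C) (g : shom A B) : shom A C :=
  SHom (shom_comp_subproof f g).

Lemma shom_id_subproof A : is_shom (@id A). Proof. by split. Qed.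
Definition shom_id A : shom A A := SHom (shom_id_subproof A).

End SHomTheory.

Arguments shom_id {K} A.

Section EvenAlgebra.
Variables (K : fieldType) (A : comAlgType K).

Lemma zero_part_linear : linear (fun _ : A => 0 : A).
Proof. by move=> k a b; rewrite scaler0 addr0. Qed.

Definition zero_grading : grading A :=
  @Grading K A _ zero_part_linear (fun _ => erefl).

Lemma zero_grading_odd (a : A) : homog zero_grading true a -> a = 0.
Proof. by move=> /esym. Qed.

Lemma evenalg_mul i j (a b : A) : homog zero_grading i a ->
  homog zero_grading j b -> homog zero_grading (i (+) j) (a * b).
Proof.
case: i => [/zero_grading_odd ->|_].
  by move=> _; rewrite mul0r /homog; case: j.
by case: j => [/zero_grading_odd ->|_] //; rewrite mulr0.
Qed.

Lemma evenalg_comm i j (a b : A) : homog zero_grading i a ->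
  homog zero_grading j b -> b * a = (-1) ^+ (i && j) * (a * b).
Proof.
case: i => [/zero_grading_odd ->|_]; first by rewrite !(mulr0, mul0r).
by rewrite /= expr0 mul1r mulrC.
Qed.

Lemma evenalg_sqr (a : A) : homog zero_grading true a -> a * a = 0.
Proof. by move=> /zero_grading_odd ->; rewrite mul0r. Qed.

Definition evenalg : superalg K :=
  @Superalg K A zero_grading erefl evenalg_mul evenalg_comm evenalg_sqr.

End EvenAlgebra.

Definition base_superalg (K : fieldType) : superalg K := evenalg K^o.

(* The superalgebra A (x) /\(z), with z odd: (b, c) stands for b + c z *)

Definition extalg (K : fieldType) (A : comAlgType K) : Type := (A * A)%type.

Section ExtAlgebra.
Variables (K : fieldType) (A : comAlgType K).
Local Notation E := (extalg A).

HB.instance Definition _ := GRing.Lmodule.on E.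

Definition ext_mul (u v : E) : E := (u.1 * v.1, u.1 * v.2 + u.2 * v.1).
Definition ext_one : E := (1, 0).

Lemma ext_eq (u v : E) : u.1 = v.1 -> u.2 = v.2 -> u = v.
Proof. by case: u v => [? ?] [? ?] /= -> ->. Qed.

Lemma ext_mulA : associative ext_mul.
Proof.
move=> u v w; apply: ext_eq => /=; first by rewrite mulrA.
by rewrite mulrDr mulrDl !mulrA addrA.
Qed.

Lemma ext_mul1 : left_id ext_one ext_mul.
Proof. by move=> u; apply: ext_eq; rewrite /= !mul1r // mul0r addr0. Qed.

Lemma ext_mulr1 : right_id ext_one ext_mul.
Proof. by move=> u; apply: ext_eq; rewrite /= !mulr1 // mulr0 add0r. Qed.

Lemma ext_mulDl : left_distributive ext_mul +%R.
Proof.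
move=> u v w; apply: ext_eq; rewrite /= !mulrDl //.
by rewrite -!addrA; congr (_ + _); rewrite addrCA.
Qed.

Lemma ext_mulDr : right_distributive ext_mul +%R.
Proof.
move=> u v w; apply: ext_eq; rewrite /= !mulrDr //.
by rewrite -!addrA; congr (_ + _); rewrite addrCA.
Qed.

Lemma ext_one_neq0 : ext_one != 0.
Proof. by apply/eqP => -[/eqP]; rewrite oner_eq0. Qed.

HB.instance Definition _ := GRing.Zmodule_isNzRing.Build E
  ext_mulA ext_mul1 ext_mulr1 ext_mulDl ext_mulDr ext_one_neq0.

Lemma ext_scaleAl (k : K) (u v : E) : k *: (u * v : E) = (k *: u : E) * v :> E.
Proof.
apply: ext_eq; first exact: scalerAl.
rewrite -[LHS]/(k *: (u.1 * v.2 + u.2 * v.1)).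
rewrite scalerDr (scalerAl k u.1) (scalerAl k u.2).
reflexivity.
Qed.

HB.instance Definition _ := GRing.Lmodule_isLalgebra.Build K E ext_scaleAl.

Lemma ext_scaleAr (k : K) (u v : E) : k *: (u * v : E) = u * (k *: v : E) :> E.
Proof.
apply: ext_eq; first exact: scalerAr.
rewrite -[LHS]/(k *: (u.1 * v.2 + u.2 * v.1)).
rewrite scalerDr (scalerAr k u.1) (scalerAr k u.2).
reflexivity.
Qed.

HB.instance Definition _ := GRing.Lalgebra_isAlgebra.Build K E ext_scaleAr.

Definition ext_odd (u : E) : E := (0, u.2).

Lemma ext_odd_linear : linear ext_odd.
Proof. by move=> k u v; apply: ext_eq; rewrite //= scaler0 addr0. Qed.

Definition ext_grading : grading E :=
  @Grading K E ext_odd ext_odd_linear (fun _ => erefl).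

Lemma ext_homogP i (u : E) :
  homog ext_grading i u <-> if i then u.1 = 0 else u.2 = 0.
Proof.
case: u => [a b]; case: i; split=> /=.
- by case.
- by move->.
- by case.
- by move=> ->.
Qed.

Lemma ext_homog_mul i j (u v : E) : homog ext_grading i u ->
  homog ext_grading j v -> homog ext_grading (i (+) j) (u * v).
Proof.
move=> /ext_homogP hu /ext_homogP hv; apply/ext_homogP.
case: i j hu hv => [] [] /= hu hv;
  by rewrite ?hu ?hv ?(mulr0, mul0r, addr0).
Qed.

Lemma ext_comm i j (u v : E) : homog ext_grading i u ->
  homog ext_grading j v -> v * u = (-1) ^+ (i && j) * (u * v).
Proof.
move=> /ext_homogP hu /ext_homogP hv.
case: i j hu hv => [] [] /= hu hv; rewrite ?expr0 ?mul1r ?expr1 ?mulN1r;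
  apply: ext_eq; rewrite /= ?hu ?hv ?(mulr0, mul0r, addr0, add0r, oppr0) //;
  by rewrite mulrC.
Qed.

Lemma ext_sqr (u : E) : homog ext_grading true u -> u * u = 0.
Proof.
move=> /ext_homogP /= hu.
by apply: ext_eq; rewrite /= ?hu ?(mulr0, mul0r, addr0).
Qed.

Definition ext_superalg : superalg K :=
  @Superalg K E ext_grading erefl ext_homog_mul ext_comm ext_sqr.

Definition ext_z : ext_superalg := (0, 1) : E.
Definition ext_in (a : A) : ext_superalg := (a, 0) : E.

End ExtAlgebra.

(* Algebraic supergroups: group-valued functors R |-> Hom(A, R) on
   super-commutative superalgebras, represented by a finitely generated
   super-commutative superalgebra A (which is then a Hopf superalgebra, by
   Yoneda). The coordinate superalgebra K[G] is the coercion [coord]. *)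

Definition fin_generated (K : fieldType) (A : algType K) : Prop :=
  exists s : seq A, forall P : A -> Prop,
    P 1 -> (forall k a b, P a -> P b -> P (k *: a + b)) ->
    (forall a b, P a -> P b -> P (a * b)) -> (forall a, a \in s -> P a) ->
    forall a, P a.

Record supergroup (K : fieldType) := Supergroup {
  coord :> superalg K;
  coord_fin : fin_generated coord;
  gmul : forall R : superalg K, shom coord R -> shom coord R -> shom coord R;
  gone : forall R : superalg K, shom coord R;
  ginv : forall R : superalg K, shom coord R -> shom coord R;
  gmulA : forall R, associative (@gmul R);
  gmul1 : forall R, left_id (gone R) (@gmul R);
  gmulV : forall R, left_inverse (gone R) (@ginv R) (@gmul R);
  gmul_nat : forall (R S : superalg K) (f : shom R S) (g h : shom coord R),
    shom_comp f (gmul g h) = gmul (shom_comp f g) (shom_comp f h)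
}.

Definition counit (K : fieldType) (G : supergroup K) : G -> K :=
  gone G (base_superalg K).

(* Morphisms G -> H, given by their comorphism K[H] -> K[G] *)
Record sghom (K : fieldType) (G H : supergroup K) := SGHom {
  comor : shom H G;
  comor_mul : forall (R : superalg K) (g h : shom G R),
    shom_comp (gmul g h) comor = gmul (shom_comp g comor) (shom_comp h comor)
}.

Definition on_points (K : fieldType) (G H : supergroup K) (f : sghom G H)
  (R : superalg K) (g : shom G R) : shom H R := shom_comp g (comor f).

(* f is an isomorphism onto a closed super-subgroup *)
Definition closed_embedding (K : fieldType) (N G : supergroup K)
  (i : sghom N G) : Prop := forall b : N, exists a : G, comor i a = b.

Definition normal_image (K : fieldType) (N G : supergroup K)
  (i : sghom N G) : Prop :=
  forall (R : superalg K) (g : shom G R) (n : shom N R),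
    exists n' : shom N R, gmul (gmul g (on_points i n)) (ginv g) = on_points i n'.

Definition central_image (K : fieldType) (N G : supergroup K)
  (i : sghom N G) : Prop :=
  forall (R : superalg K) (g : shom G R) (n : shom N R),
    gmul g (on_points i n) = gmul (on_points i n) g.

Definition in_ideal (A : nzRingType) (S : A -> Prop) (a : A) : Prop :=
  exists2 s : seq (A * A), (forall p, p \in s -> S p.2) &
    a = \sum_(p <- s) p.1 * p.2.

(* q identifies K[Q] with the Hopf super-subalgebra B of K[G] such that
   K[G] / K[G] B^+ = K[N], i.e. q is the quotient morphism G -> G / N *)
Definition is_quotient (K : fieldType) (N G Q : supergroup K)
  (i : sghom N G) (q : sghom G Q) : Prop :=
  injective (comor q) /\
  forall a : G, comor i a = 0 <->
    in_ideal (fun c : G => exists2 b : Q, counit b = 0 & c = comor q b) a.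

Definition splits (K : fieldType) (G Q : supergroup K) (q : sghom G Q) : Prop :=
  exists s : sghom Q G, forall (R : superalg K) (g : shom Q R),
    on_points q (on_points s g) = g.

(* i : E -> G identifies E with G_ev, represented by K[G] / (K[G]_1) *)
Definition is_ev (K : fieldType) (E G : supergroup K) (i : sghom E G) : Prop :=
  closed_embedding i /\
  forall a : G, comor i a = 0 <-> in_ideal (homog (sa_gr G) true) a.

(* Tensors, as formal sums of pure tensors modulo the universal property *)
Definition tensor_eq (K : fieldType) (V W : lmodType K) (s t : seq (V * W)) :
  Prop :=
  forall (X : lmodType K) (b : V -> W -> X),
    (forall v, linear (b v)) -> (forall w, linear (b^~ w)) ->
    \sum_(p <- s) b p.1 p.2 = \sum_(p <- t) b p.1 p.2.

(* Supermodules over G, i.e. right K[G]-super-comodules v |-> sum p.1 (x) p.2.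
   Coassociativity (coact (x) id) coact = (id (x) Delta) coact is stated on
   points, i.e. as (g h) v = g (h v) in V (x) R for all g, h in G(R). *)
Record supermodule (K : fieldType) (G : supergroup K) := Supermodule {
  sm_car :> superspace K;
  coact : sm_car -> seq (sm_car * G);
  coact_linear : forall k u v, tensor_eq (coact (k *: u + v))
    ([seq (k *: p.1, p.2) | p <- coact u] ++ coact v);
  coact_counit : forall v, \sum_(p <- coact v) counit p.2 *: p.1 = v;
  coact_mul : forall (R : superalg K) (g h : shom G R) v,
    @tensor_eq K sm_car R
      [seq (p.1, gmul g h p.2) | p <- coact v]
      [seq (q.1, g q.2 * h p.2) | p <- coact v, q <- coact p.1];
  coact_even : forall i v, homog (ss_gr sm_car) i v ->
    exists2 s, tensor_eq (coact v) s &
      forall p, p \in s -> exists j,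
        homog (ss_gr sm_car) j p.1 /\ homog (sa_gr G) (i (+) j) p.2
}.

Definition subsupermodule (K : fieldType) (G : supergroup K)
  (V : supermodule G) (W : V -> Prop) : Prop :=
  [/\ W 0, forall k u v, W u -> W v -> W (k *: u + v),
      forall v, W v -> W (ss_gr V v) &
      forall v, W v -> exists2 s, tensor_eq (coact v) s &
        forall p, p \in s -> W p.1].

Definition simple_supermodule (K : fieldType) (G : supergroup K)
  (V : supermodule G) : Prop :=
  (exists v : V, v <> 0) /\
  forall W : V -> Prop, subsupermodule W ->
    (forall v, W v -> v = 0) \/ (forall v, W v).

Definition trivial_line (K : fieldType) (G : supergroup K)
  (V : supermodule G) : Prop :=
  (exists2 v : V, v <> 0 & forall u : V, exists k : K, u = k *: v) /\
  forall u : V, tensor_eq (coact u) [:: (u, 1)].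

Definition unipotent (K : fieldType) (G : supergroup K) : Prop :=
  forall V : supermodule G, simple_supermodule V -> trivial_line V.

(* i : N -> G identifies N with the unipotent radical G_u *)
Definition is_unipotent_radical (K : fieldType) (N G : supergroup K)
  (i : sghom N G) : Prop :=
  [/\ closed_embedding i, normal_image i, unipotent N &
      forall (M : supergroup K) (j : sghom M G),
        closed_embedding j -> normal_image j -> unipotent M ->
        exists k : sghom M N, forall (R : superalg K) (m : shom M R),
          on_points i (on_points k m) = on_points j m].

Definition grouplike (K : fieldType) (G : supergroup K) (c : G) : Prop :=
  counit c = 1 /\
  forall (R : superalg K) (g h : shom G R), gmul g h c = g c * h c.

(* an algebraic group whose coordinate algebra is spanned by characters *)
Definition diagonalizable (K : fieldType) (G : supergroup K) : Prop :=
  even_superalg G /\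
  forall a : G, exists2 s : seq (K * G), (forall p, p \in s -> grouplike p.2) &
    a = \sum_(p <- s) p.1 *: p.2.

(* Lie superalgebra of G: the counit-derivations K[G] -> K *)

Definition is_lie (K : fieldType) (G : supergroup K) (d : G -> K) : Prop :=
  (forall k a b, d (k *: a + b) = k * d a + d b) /\
  forall a b, d (a * b) = d a * counit b + counit a * d b.

Definition is_lie_odd (K : fieldType) (G : supergroup K) (d : G -> K) : Prop :=
  is_lie d /\ forall a, homog (sa_gr G) false a -> d a = 0.

Definition lie_map (K : fieldType) (G H : supergroup K) (f : sghom G H)
  (d : G -> K) : H -> K := fun a => d (comor f a).

(* Delta a = sum p.1 (x) p.2, characterized on points *)
Definition comul_eq (K : fieldType) (G : supergroup K) (a : G)
  (s : seq (G * G)) : Prop :=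
  forall (R : superalg K) (g h : shom G R),
    gmul g h a = \sum_(p <- s) g p.1 * h p.2.

(* (Delta (x) id) Delta a = sum p.1.1 (x) p.1.2 (x) p.2 *)
Definition comul2_eq (K : fieldType) (G : supergroup K) (a : G)
  (s : seq (G * G * G)) : Prop :=
  forall (R : superalg K) (g h k : shom G R),
    gmul (gmul g h) k a = \sum_(p <- s) g p.1.1 * h p.1.2 * k p.2.

Section MonoidPoints.
Variables (K : fieldType) (M : nmodType) (R : superalg K).
Local Notation A := (monoid_alg K M).

Record char_pt := CharPt {
  cp_fun :> M -> R;
  cp0 : cp_fun 0 = 1;
  cpD : forall m n, cp_fun (m + n) = cp_fun m * cp_fun n;
  cp_even : forall m, homog (sa_gr R) false (cp_fun m)
}.

Lemma cp_lin (x : char_pt) : linear (linext x : A -> R).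
Proof. exact: linext_linear. Qed.

Lemma cp_mon (x : char_pt) m : linext x (mon K m) = x m.
Proof. exact: linext_mon. Qed.

Lemma cp_one (x : char_pt) : linext x (1 : A) = 1.
Proof. by rewrite -mon0 cp_mon cp0. Qed.

Lemma cp_mul (x : char_pt) (a b : A) :
  linext x (a * b) = linext x a * linext x b.
Proof.
move: a; apply: monalg_ext.
- by move=> k u v; rewrite mulrDl -scalerAl cp_lin.
- by move=> k u v; rewrite cp_lin mulrDl -scalerAl.
move=> m; move: b; apply: monalg_ext.
- by move=> k u v; rewrite mulrDr -scalerAr cp_lin.
- by move=> k u v; rewrite cp_lin mulrDr -scalerAr.
by move=> n; rewrite monM !cp_mon cpD.
Qed.

Lemma cp_hom (x : char_pt) (a : A) : homog (sa_gr R) false (linext x a).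
Proof.
move: a; apply: (@monalg_ext K M R).
- by move=> k u v; rewrite cp_lin odd_part_linear.
- by move=> k u v; rewrite scaler0 addr0.
by move=> m; rewrite cp_mon; exact: cp_even.
Qed.

Lemma mon_pt_subproof (x : char_pt) :
  is_shom (A := evenalg A) (B := R) (linext x : A -> R).
Proof.
split; [exact: cp_lin | exact: cp_one | exact: cp_mul | move=> a].
rewrite [RHS]cp_hom; exact: (linear0 (linext x)).
Qed.

Definition mon_pt (x : char_pt) : shom (evenalg A) R :=
  SHom (mon_pt_subproof x).

Lemma mon_ptE x m : mon_pt x (mon K m) = x m.
Proof. exact: cp_mon. Qed.

Lemma mon_pt_ext (g h : shom (evenalg A) R) :
  (forall m, g (mon K m) = h (mon K m)) -> g = h.
Proof.
move=> gh; apply: shom_ext; apply: (@monalg_ext K M R) => //.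
- by move=> k u v; exact: (linearP g).
- by move=> k u v; exact: (linearP h).
Qed.

Definition ext_fun (x : char_pt) (z : R) (u : extalg A) : R :=
  linext x u.1 + linext x u.2 * z.

Lemma ext_pt_subproof (x : char_pt) (z : R) : homog (sa_gr R) true z ->
  is_shom (A := ext_superalg A) (B := R) (ext_fun x z).
Proof.
move=> hz; split.
- move=> k u v; rewrite /ext_fun !cp_lin mulrDl -scalerAl scalerDr.
  by rewrite -!addrA; congr (_ + _); rewrite addrCA.
- by rewrite /ext_fun cp_one (linear0 (linext x)) mul0r addr0.
- move=> u v; rewrite /ext_fun /=.
  have -> : linext x (u.1 * v.1) = linext x u.1 * linext x v.1.
    exact: cp_mul.
  have -> : linext x (u.1 * v.2 + u.2 * v.1) =
      linext x u.1 * linext x v.2 + linext x u.2 * linext x v.1.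
    by rewrite (linearD (linext x)); congr (_ + _); exact: cp_mul.
  rewrite mulrDl mulrDr !mulrDl -!addrA; congr (_ + _).
  rewrite [RHS]addrCA mulrA; congr (_ + _).
  rewrite -!mulrA (even_central z (cp_hom _ v.1)).
  rewrite (mulrA z) -(even_central z (cp_hom _ v.2)) -mulrA (sa_sqr hz).
  by rewrite !mulr0 addr0.
- move=> u; rewrite /ext_fun /= (linear0 (linext x)) add0r.
  rewrite -[X in sa_gr R X]addrC -[linext x u.2 * z]scale1r odd_part_linear.
  by rewrite [X in _ + X]cp_hom addr0 (sa_mul (cp_hom x u.2) hz).
Qed.

Definition ext_pt (x : char_pt) z (hz : homog (sa_gr R) true z) :
  shom (ext_superalg A) R := SHom (ext_pt_subproof x hz).

Lemma ext_ptE x z (hz : homog (sa_gr R) true z) m :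
  ext_pt x hz (ext_in (mon K m)) = x m.
Proof.
rewrite [LHS]/(ext_fun _ _ _) /ext_fun /= cp_mon.
by rewrite (linear0 (linext x)) mul0r addr0.
Qed.

Lemma ext_pt_z x z (hz : homog (sa_gr R) true z) : ext_pt x hz (ext_z A) = z.
Proof.
rewrite [LHS]/(ext_fun _ _ _) /ext_fun /= cp_one.
by rewrite (linear0 (linext x)) mul1r add0r.
Qed.

Lemma ext_decomp (u : ext_superalg A) :
  u = ext_in u.1 + ext_in u.2 * ext_z A.
Proof.
apply: ext_eq => /=; first by rewrite mulr0 addr0.
by rewrite mulr1 mul0r addr0 add0r.
Qed.

Lemma ext_in_linear : linear (@ext_in K A).
Proof. by move=> k a b; apply: ext_eq => //=; rewrite scaler0 addr0. Qed.

Lemma ext_inM (a b : A) : ext_in (a * b) = ext_in a * ext_in b.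
Proof. by apply: ext_eq => //=; rewrite mulr0 mul0r addr0. Qed.

Lemma ext_in1 : ext_in (1 : A) = 1. Proof. by []. Qed.

Lemma ext_pt_ext (g h : shom (ext_superalg A) R) :
  (forall m, g (ext_in (mon K m)) = h (ext_in (mon K m))) ->
  g (ext_z A) = h (ext_z A) -> g = h.
Proof.
move=> gh ghz; apply: shom_ext => u.
have gh1 : forall a : A, g (ext_in a) = h (ext_in a).
  apply: (@monalg_ext K M R) => //.
  - by move=> k v w; rewrite ext_in_linear linearP.
  - by move=> k v w; rewrite ext_in_linear linearP.
rewrite (ext_decomp u).
have E (f : shom (ext_superalg A) R) : f (ext_in u.1 + ext_in u.2 * ext_z A) =
    f (ext_in u.1) + f (ext_in u.2) * f (ext_z A) by rewrite rmorphD rmorphM.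
by rewrite !E ghz; congr (_ + _ * _); exact: gh1.
Qed.

End MonoidPoints.

Section IntExp.
Variables (K : fieldType) (R : superalg K).

Definition int_exp (t s : R) (n : int) : R :=
  match n with Posz k => t ^+ k | Negz k => s ^+ k.+1 end.

Lemma int_exp_even t s n : homog (sa_gr R) false t ->
  homog (sa_gr R) false s -> homog (sa_gr R) false (int_exp t s n).
Proof. by move=> ht hs; case: n => k /=; exact: homogX_even. Qed.

Lemma int_expS t s n : t * s = 1 -> homog (sa_gr R) false t ->
  int_exp t s (n + 1) = int_exp t s n * t.
Proof.
move=> ts ht; have st : s * t = 1 by rewrite -(even_central s ht).
case: n => [k|[|k]].
- by rewrite -PoszD addn1 /= exprSr.
- by rewrite /= expr0 expr1 st.
have -> : Negz k.+1 + 1 = Negz k by rewrite !NegzE; lia.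
by rewrite /= [in RHS]exprSr -mulrA st mulr1.
Qed.

Lemma int_expD t s m n : t * s = 1 -> homog (sa_gr R) false t ->
  int_exp t s (m + n) = int_exp t s m * int_exp t s n.
Proof.
move=> ts ht; have st : s * t = 1 by rewrite -(even_central s ht).
elim/int_ind: n => [|n IHn|n IHn].
- by rewrite addr0 /= expr0 mulr1.
- have -> : m + n.+1%:Z = m + n%:Z + 1 by lia.
  have -> : n.+1%:Z = n%:Z + 1 by lia.
  by rewrite !int_expS // IHn mulrA.
have E k : int_exp t s (k - 1) = int_exp t s k * s.
  by rewrite -[k in RHS](subrK 1) int_expS // -mulrA ts mulr1.
have -> : - n.+1%:Z = - n%:Z - 1 by lia.
by rewrite addrA !E IHn mulrA.
Qed.

Lemma int_char_uniq (x y : char_pt int R) : x 1 = y 1 -> forall n, x n = y n.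
Proof.
move=> xy.
have inv (u : char_pt int R) : u 1 * u (-1) = 1 by rewrite -cpD subrr cp0.
have xyN : x (-1) = y (-1).
  rewrite -[LHS]mulr1 -(inv y) mulrA -xy.
  by rewrite -(even_central _ (cp_even x 1)) inv mul1r.
elim/int_ind => [|n IHn|n IHn]; first by rewrite !cp0.
  by rewrite intS !cpD IHn xy.
have -> : - n.+1%:Z = - n%:Z - 1 by lia.
by rewrite !cpD IHn xyN.
Qed.

Lemma nat_char_uniq (x y : char_pt nat R) : x 1%N = y 1%N -> forall n, x n = y n.
Proof.
move=> xy; elim => [|n IHn]; first by rewrite !cp0.
have -> : n.+1 = (n : nat) + (1%N : nat) by rewrite [RHS]addn1.
by rewrite !cpD IHn xy.
Qed.

End IntExp.

Section Chars.
Variables (K : fieldType) (R : superalg K).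
Implicit Types a t s : R.

Lemma nat_char_even a (ha : homog (sa_gr R) false a) (n : nat) :
  homog (sa_gr R) false (a ^+ n).
Proof. exact: homogX_even. Qed.

Definition nat_char a (ha : homog (sa_gr R) false a) : char_pt nat R :=
  CharPt (expr0 a) (exprD a) (nat_char_even ha).

Lemma int_char_subproof t s (ht : homog (sa_gr R) false t) (ts : t * s = 1) m n :
  int_exp t s (m + n) = int_exp t s m * int_exp t s n.
Proof. exact: int_expD. Qed.

Definition int_char t s (ht : homog (sa_gr R) false t)
  (hs : homog (sa_gr R) false s) (ts : t * s = 1) : char_pt int R :=
  CharPt (cp_fun := int_exp t s) (expr0 t) (int_char_subproof ht ts)
    (fun n => int_exp_even n ht hs).

Lemma pair_char0 (x : char_pt nat R) (y : char_pt int R) : x 0%N * y 0 = 1.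
Proof. by rewrite (cp0 x) (cp0 y) mulr1. Qed.

Lemma pair_charD (x : char_pt nat R) (y : char_pt int R) (m n : nat * int) :
  x (m + n).1 * y (m + n).2 = (x m.1 * y m.2) * (x n.1 * y n.2).
Proof.
rewrite !cpD -!mulrA; congr (_ * _).
by rewrite !mulrA (even_central _ (cp_even y m.2)).
Qed.

Lemma pair_char_even (x : char_pt nat R) (y : char_pt int R) (m : nat * int) :
  homog (sa_gr R) false (x m.1 * y m.2).
Proof. by apply: homogM_even; apply: cp_even. Qed.

Definition pair_char (x : char_pt nat R) (y : char_pt int R) :
  char_pt (nat * int)%type R :=
  CharPt (cp_fun := fun m => x m.1 * y m.2)
    (pair_char0 x y) (pair_charD x y) (pair_char_even x y).

Lemma pair_char_uniq (x y : char_pt (nat * int)%type R) :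
  x (1%N, 0) = y (1%N, 0) -> x (0%N, 1) = y (0%N, 1) -> forall m, x m = y m.
Proof.
move=> xy1 xy2.
pose fstc (u : char_pt (nat * int)%type R) := @CharPt K nat R
  (fun n => u (n, 0)) (cp0 u) (fun m n => cpD u (m, 0) (n, 0))
  (fun n => cp_even u _).
pose sndc (u : char_pt (nat * int)%type R) := @CharPt K int R
  (fun n => u (0%N, n)) (cp0 u) (fun m n => cpD u (0%N, m) (0%N, n))
  (fun n => cp_even u _).
move=> [m n].
have -> : (m, n) = (m, 0) + (0%N, n) by congr pair; rewrite /= ?add0r ?addr0.
rewrite !cpD.
congr (_ * _).
  exact: (@nat_char_uniq _ _ (fstc x) (fstc y) xy1 m).
exact: (@int_char_uniq _ _ (sndc x) (sndc y) xy2 n).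
Qed.

Definition mon_char (M : nmodType) (g : shom (evenalg (monoid_alg K M)) R) :
  char_pt M R.
Proof.
refine (@CharPt K M R (fun m => g (mon K m)) _ _ _).
- by rewrite mon0 rmorph1.
- by move=> m n; rewrite -monM; exact: (rmorphM g).
- by move=> m; exact: (@shom_homog _ (evenalg _) _ g false).
Defined.

Definition ext_char (M : nmodType) (g : shom (ext_superalg (monoid_alg K M)) R) :
  char_pt M R.
Proof.
refine (@CharPt K M R (fun m => g (ext_in (mon K m))) _ _ _).
- by rewrite mon0 ext_in1 rmorph1.
- by move=> m n; rewrite -monM ext_inM; exact: (rmorphM g).
- by move=> m; exact: (@shom_homog _ (ext_superalg _) _ g false).
Defined.

End Chars.

Section FinGen.
Variables (K : fieldType) (M : nmodType).
Local Notation A := (monoid_alg K M).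

Lemma span_mon (B : algType K) (f : A -> B) (P : B -> Prop) : linear f ->
  P 1 -> (forall k a b, P a -> P b -> P (k *: a + b)) ->
  (forall m, P (f (mon K m))) -> forall a, P (f a).
Proof.
move=> fl P1 Pl Pm a.
have P0 : P 0 by rewrite -(addNr (1 : B)) -scaleN1r; exact: Pl.
have f0 : f 0 = 0.
  by have := fl (-1) 0 0; rewrite scaleN1r oppr0 addr0 scaleN1r addNr.
rewrite (monalg_sum a); elim: (enum_fset _) => [|k s IHs].
  by rewrite big_nil f0.
by rewrite big_cons fl; exact: Pl.
Qed.

Lemma fin_gen_even (s : seq A) :
  (forall P : A -> Prop, P 1 -> (forall a b, P a -> P b -> P (a * b)) ->
     (forall a, a \in s -> P a) -> forall m, P (mon K m)) ->
  fin_generated (evenalg A).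
Proof.
move=> H; exists s => P P1 Pl PM Ps a.
exact: (@span_mon A id P _ P1 Pl (H P P1 PM Ps)).
Qed.

Lemma fin_gen_ext (s : seq A) :
  (forall P : A -> Prop, P 1 -> (forall a b, P a -> P b -> P (a * b)) ->
     (forall a, a \in s -> P a) -> forall m, P (mon K m)) ->
  fin_generated (ext_superalg A).
Proof.
move=> H; exists (ext_z A :: [seq ext_in a | a <- s]) => P P1 Pl PM Ps a.
have Pin (b : A) : P (ext_in b).
  apply: (@span_mon (ext_superalg A) (@ext_in K A) P (@ext_in_linear K M)) => //.
  apply: (H (fun b => P (ext_in b))) => // [b' c Pb Pc|b' hb].
    by rewrite ext_inM; exact: PM.
  by apply: Ps; rewrite inE map_f ?orbT.
rewrite (ext_decomp a) -[ext_in a.1]scale1r; apply: Pl; first exact: Pin.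
by apply: PM; [exact: Pin | apply: Ps; rewrite inE eqxx].
Qed.

End FinGen.

Section FinGenMonoids.
Variable K : fieldType.

Lemma nat_gen (P : monoid_alg K nat -> Prop) : P 1 ->
  (forall a b, P a -> P b -> P (a * b)) ->
  (forall a, a \in [:: mon K 1%N] -> P a) -> forall m : nat, P (mon K m).
Proof.
move=> P1 PM Ps; elim => [|n IHn]; first exact: P1.
have -> : n.+1 = (n : nat) + (1%N : nat) by rewrite [RHS]addn1.
rewrite -monM; apply: PM; first exact: IHn.
by apply: Ps; exact: mem_head.
Qed.

Lemma int_gen (P : monoid_alg K int -> Prop) : P 1 ->
  (forall a b, P a -> P b -> P (a * b)) ->
  (forall a, a \in [:: mon K 1; mon K (-1)] -> P a) ->
  forall m : int, P (mon K m).
Proof.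
move=> P1 PM Ps; elim/int_ind => [|n IHn|n IHn]; first exact: P1.
  have -> : n.+1%:Z = n%:Z + 1 by lia.
  rewrite -monM; apply: PM; first exact: IHn.
  by apply: Ps; exact: mem_head.
have -> : - n.+1%:Z = - n%:Z - 1 by lia.
rewrite -monM; apply: PM; first exact: IHn.
by apply: Ps; rewrite inE; apply/orP; right; exact: mem_head.
Qed.

Lemma pair_gen (P : monoid_alg K (nat * int)%type -> Prop) : P 1 ->
  (forall a b, P a -> P b -> P (a * b)) ->
  (forall a, a \in [:: mon K (1%N, 0); mon K (0%N, 1); mon K (0%N, -1)] -> P a) ->
  forall m : (nat * int)%type, P (mon K m).
Proof.
move=> P1 PM Ps [m n].
have -> : (m, n) = (m, 0) + (0%N, n) by congr pair; rewrite /= ?add0r ?addr0.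
rewrite -monM; apply: (PM).
  elim: m => [|m IHm]; first exact: P1.
  have -> : (m.+1, 0) = (m, 0) + (1%N, 0) :> (nat * int)%type.
    by congr pair; rewrite [RHS]addn1.
  rewrite -monM; apply: PM; first exact: IHm.
  by apply: Ps; exact: mem_head.
elim/int_ind: n => [|n IHn|n IHn]; first exact: P1.
  have -> : (0%N, n.+1%:Z) = (0%N, n%:Z) + (0%N, 1) :> (nat * int)%type.
    by congr pair; rewrite /=; lia.
  rewrite -monM; apply: PM; first exact: IHn.
  by apply: Ps; rewrite inE; apply/orP; right; exact: mem_head.
have -> : (0%N, - n.+1%:Z) = (0%N, - n%:Z) + (0%N, -1) :> (nat * int)%type.
  by congr pair; rewrite /=; lia.
rewrite -monM; apply: PM; first exact: IHn.
by apply: Ps; do 2 (rewrite inE; apply/orP; right); exact: mem_head.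
Qed.

End FinGenMonoids.

Section UnitFactor.
Variables (K : fieldType) (R : superalg K) (d : K).
Implicit Types t s x y w : R.

Definition ufactor x y : R := 1 + d *: (x * y).

Lemma ufactor_even x y : homog (sa_gr R) true x -> homog (sa_gr R) true y ->
  homog (sa_gr R) false (ufactor x y).
Proof.
by move=> hx hy; apply: homogD (sa_one R) _; apply/homogZ/homogM_odd.
Qed.

Lemma odd_xyx x y : homog (sa_gr R) true x -> homog (sa_gr R) true y ->
  x * y * x = 0.
Proof.
by move=> hx hy; rewrite (odd_anticomm hy hx) mulNr -mulrA (sa_sqr hx) mulr0 oppr0.
Qed.

Lemma ufactorNl x y : ufactor (- x) y = 1 - d *: (x * y).
Proof. by rewrite /ufactor mulNr scalerN. Qed.

Lemma ufactorV x y : homog (sa_gr R) true x -> homog (sa_gr R) true y ->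
  ufactor x y * ufactor (- x) y = 1.
Proof.
move=> hx hy; rewrite ufactorNl /ufactor mulrBr mulr1 mulrDl mul1r.
rewrite -scalerAl -scalerAr !mulrA (odd_xyx hx hy) mul0r !scaler0 addr0.
by rewrite addrK.
Qed.

Lemma ufactor0 x : ufactor x 0 = 1.
Proof. by rewrite /ufactor mulr0 scaler0 addr0. Qed.

Lemma ufactor0l x : ufactor 0 x = 1.
Proof. by rewrite /ufactor mul0r scaler0 addr0. Qed.

Lemma ufactorNN x : homog (sa_gr R) true x -> ufactor (- x) x = 1.
Proof. by move=> hx; rewrite /ufactor mulNr (sa_sqr hx) oppr0 scaler0 addr0. Qed.

Lemma ufactor_cocycle x y w : homog (sa_gr R) true x ->
  homog (sa_gr R) true y -> homog (sa_gr R) true w ->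
  ufactor x y * ufactor (x + y) w = ufactor y w * ufactor x (y + w).
Proof.
move=> hx hy hw.
have Z1 : x * y * ((x + y) * w) = 0.
  rewrite mulrDl mulrDr !mulrA (odd_xyx hx hy) mul0r add0r.
  by rewrite -(mulrA x) (sa_sqr hy) mulr0 mul0r.
have Z2 : y * w * (x * (y + w)) = 0.
  rewrite mulrDr mulrDr -[y * w * (x * w)]mulrA [w * (x * w)]mulrA.
  rewrite (odd_xyx hw hx) mulr0 addr0.
  rewrite (even_central (x * y) (homogM_odd hy hw)) -mulrA (mulrA y).
  by rewrite (sa_sqr hy) mul0r mulr0.
rewrite /ufactor !mulrDl !mulrDr !mul1r !mulr1.
rewrite -!scalerAl -!scalerAr -mulrDl -mulrDr Z1 Z2 !scaler0 !addr0.
rewrite (mulrDl x y w) (mulrDr x y w) !scalerDr -!addrA; congr (_ + _).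
by rewrite addrA [RHS]addrC.
Qed.

End UnitFactor.

(* Coordinates T (of G_a) and t, t^-1 (of G_m), on G_a, G_m and, with suffix 2,
   on G_a x G_m *)

Notation coT := (mon _ 1%N).
Notation cot := (mon _ (1 : int)).
Notation cotV := (mon _ (-1 : int)).
Notation coT2 := (mon _ ((1%N, 0) : nat * int)).
Notation cot2 := (mon _ ((0%N, 1) : nat * int)).
Notation cotV2 := (mon _ ((0%N, -1) : nat * int)).

Section Points.
Variables (K : fieldType) (R : superalg K).
Implicit Types a t s z : R.
Local Notation ev x := (homog (sa_gr R) false x).
Local Notation od x := (homog (sa_gr R) true x).
Local Notation Aa := (evenalg (monoid_alg K nat)).
Local Notation Am := (evenalg (monoid_alg K int)).
Local Notation Aam := (evenalg (monoid_alg K (nat * int)%type)).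
Local Notation Em := (ext_superalg (monoid_alg K int)).
Local Notation Eam := (ext_superalg (monoid_alg K (nat * int)%type)).

Lemma even_evenalg (M : nmodType) (g : shom (evenalg (monoid_alg K M)) R) (b : monoid_alg K M) :
  ev (g b).
Proof. by apply: (@shom_homog _ _ _ g false). Qed.

Lemma even_ext_in (M : nmodType) (g : shom (ext_superalg (monoid_alg K M)) R)
  (a : monoid_alg K M) : ev (g (ext_in a)).
Proof. by apply: (@shom_homog _ _ _ g false). Qed.

Lemma odd_ext_z (M : nmodType) (g : shom (ext_superalg (monoid_alg K M)) R) :
  od (g (ext_z (monoid_alg K M))).
Proof. by apply: (@shom_homog _ _ _ g true). Qed.

Definition a_pt a (ha : ev a) : shom Aa R := mon_pt (nat_char ha).
Definition m_pt t s (ht : ev t) (hs : ev s) (ts : t * s = 1) : shom Am R :=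
  mon_pt (int_char ht hs ts).
Definition am_pt a t s (ha : ev a) (ht : ev t) (hs : ev s) (ts : t * s = 1) :
  shom Aam R := mon_pt (pair_char (nat_char ha) (int_char ht hs ts)).
Definition mz_pt t s z (ht : ev t) (hs : ev s) (hz : od z) (ts : t * s = 1) :
  shom Em R := ext_pt (int_char ht hs ts) hz.
Definition amz_pt a t s z (ha : ev a) (ht : ev t) (hs : ev s) (hz : od z)
  (ts : t * s = 1) : shom Eam R :=
  ext_pt (pair_char (nat_char ha) (int_char ht hs ts)) hz.

Lemma a_ptE a (ha : ev a) : a_pt ha coT = a.
Proof. exact: etrans (mon_ptE _ _) (expr1 _). Qed.

Lemma m_ptE t s (ht : ev t) (hs : ev s) (ts : t * s = 1) :
  (m_pt ht hs ts cot = t) * (m_pt ht hs ts cotV = s).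
Proof. by split; rewrite /m_pt mon_ptE. Qed.

Lemma am_ptE a t s (ha : ev a) (ht : ev t) (hs : ev s) (ts : t * s = 1) :
  (am_pt ha ht hs ts coT2 = a) * (am_pt ha ht hs ts cot2 = t) *
  (am_pt ha ht hs ts cotV2 = s).
Proof.
by split; [split|]; rewrite /am_pt mon_ptE /= ?expr0 ?expr1 ?mul1r ?mulr1.
Qed.

Lemma mz_ptE t s z (ht : ev t) (hs : ev s) (hz : od z) (ts : t * s = 1) :
  (mz_pt ht hs hz ts (ext_in cot) = t) *
  (mz_pt ht hs hz ts (ext_in cotV) = s) *
  (mz_pt ht hs hz ts (ext_z _) = z).
Proof.
by split; [split|]; rewrite /mz_pt ?ext_pt_z ?ext_ptE.
Qed.

Lemma amz_ptE a t s z (ha : ev a) (ht : ev t) (hs : ev s) (hz : od z)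
  (ts : t * s = 1) :
  (amz_pt ha ht hs hz ts (ext_in coT2) = a) *
  (amz_pt ha ht hs hz ts (ext_in cot2) = t) *
  (amz_pt ha ht hs hz ts (ext_in cotV2) = s) *
  (amz_pt ha ht hs hz ts (ext_z _) = z).
Proof.
by split; [split; [split|]|]; rewrite /amz_pt ?ext_pt_z ?ext_ptE //= ?expr0 ?expr1 ?mul1r ?mulr1.
Qed.

Lemma a_pt_ext (g h : shom Aa R) : g coT = h coT -> g = h.
Proof.
move=> gh; apply: mon_pt_ext.
exact: (@nat_char_uniq _ _ (mon_char g) (mon_char h) gh).
Qed.

Lemma m_pt_ext (g h : shom Am R) : g cot = h cot -> g = h.
Proof.
move=> gh; apply: mon_pt_ext.
exact: (@int_char_uniq _ _ (mon_char g) (mon_char h) gh).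
Qed.

Lemma am_pt_ext (g h : shom Aam R) : g coT2 = h coT2 -> g cot2 = h cot2 -> g = h.
Proof.
move=> gh1 gh2; apply: mon_pt_ext.
exact: (@pair_char_uniq _ _ (mon_char g) (mon_char h) gh1 gh2).
Qed.

Lemma mz_pt_ext (g h : shom Em R) : g (ext_in cot) = h (ext_in cot) ->
  g (ext_z _) = h (ext_z _) -> g = h.
Proof.
move=> gh ghz; apply: ext_pt_ext; last exact: ghz.
exact: (@int_char_uniq _ _ (ext_char g) (ext_char h) gh).
Qed.

Lemma amz_pt_ext (g h : shom Eam R) : g (ext_in coT2) = h (ext_in coT2) ->
  g (ext_in cot2) = h (ext_in cot2) -> g (ext_z _) = h (ext_z _) -> g = h.
Proof.
move=> gh1 gh2 ghz; apply: ext_pt_ext; last exact: ghz.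
exact: (@pair_char_uniq _ _ (ext_char g) (ext_char h) gh1 gh2).
Qed.

Lemma m_ptV (g : shom Am R) : g cot * g cotV = 1.
Proof. by rewrite -rmorphM monM -(rmorph1 g). Qed.

Lemma am_ptV (g : shom Aam R) : g cot2 * g cotV2 = 1.
Proof. by rewrite -rmorphM monM -(rmorph1 g). Qed.

Lemma mz_ptV (g : shom Em R) : g (ext_in cot) * g (ext_in cotV) = 1.
Proof. by rewrite -rmorphM -ext_inM monM -(rmorph1 g). Qed.

Lemma amz_ptV (g : shom Eam R) : g (ext_in cot2) * g (ext_in cotV2) = 1.
Proof. by rewrite -rmorphM -ext_inM monM -(rmorph1 g). Qed.

End Points.

Section Groups.
Variable K : fieldType.
Local Notation ev R x := (homog (sa_gr R) false x).
Local Notation od R x := (homog (sa_gr R) true x).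
Implicit Types R S : superalg K.

Lemma shom_compE (A B C : superalg K) (f : shom B C) (g : shom A B) a :
  shom_comp f g a = f (g a).
Proof. by []. Qed.

Lemma ev1 R : ev R 1. Proof. exact: sa_one. Qed.
Lemma ev0 R : ev R 0. Proof. exact: homog0. Qed.
Lemma od0 R : od R 0. Proof. exact: homog0. Qed.

Lemma mul_unit R (t s t' s' : R) : t * s = 1 -> t' * s' = 1 ->
  ev R t' -> ev R s -> t * t' * (s * s') = 1.
Proof.
move=> ts ts' ht' hs.
by rewrite -mulrA (mulrA t') (even_central s ht') -mulrA ts' mulr1.
Qed.

Lemma triv_fin : fin_generated (base_superalg K).
Proof.
exists [::] => P P1 Pl _ _ a.
have -> : a = a *: (1 : K^o) + ((-1) *: (1 : K^o) + 1).
  by rewrite scaleN1r addNr addr0 /GRing.scale /= mulr1.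
by apply: (Pl) => //; apply: Pl.
Qed.

Lemma triv_pt_subproof R :
  is_shom (A := base_superalg K) (B := R) (fun k => k%:A).
Proof.
split.
- by move=> k a b; rewrite scalerDl scalerA.
- by rewrite scale1r.
- by move=> a b; rewrite -scalerAl mul1r scalerA.
- move=> a; rewrite /= scale0r.
  by have : ev R (a *: 1) by [apply: homogZ; exact: sa_one]; move=> ->.
Qed.

Definition triv_pt R : shom (base_superalg K) R := SHom (triv_pt_subproof R).

Lemma triv_uniq R (g h : shom (base_superalg K) R) : g = h.
Proof.
apply: shom_ext => a; rewrite -[a]mulr1.
by rewrite -[a * 1]/(a *: (1 : base_superalg K)) !linearZ /= !rmorph1.
Qed.

Definition triv_grp : supergroup K :=
  @Supergroup K (base_superalg K) triv_fin (fun R _ _ => triv_pt R) triv_pt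
    (fun R _ => triv_pt R)
    (fun R g h k => triv_uniq _ _) (fun R g => triv_uniq _ _)
    (fun R g => triv_uniq _ _) (fun R S f g h => triv_uniq _ _).

Local Notation Aa := (evenalg (monoid_alg K nat)).

Definition Ga_mul R (g h : shom Aa R) : shom Aa R :=
  a_pt (homogD (even_evenalg g coT) (even_evenalg h coT)).
Definition Ga_one R : shom Aa R := a_pt (ev0 R).
Definition Ga_inv R (g : shom Aa R) : shom Aa R :=
  a_pt (homogN (even_evenalg g coT)).

Lemma Ga_mulE R (g h : shom Aa R) : Ga_mul g h coT = g coT + h coT.
Proof. exact: a_ptE. Qed.
Lemma Ga_oneE R : Ga_one R coT = 0.
Proof. exact: a_ptE. Qed.
Lemma Ga_invE R (g : shom Aa R) : Ga_inv g coT = - g coT.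
Proof. exact: a_ptE. Qed.

Lemma Ga_mulA R : associative (@Ga_mul R).
Proof. by move=> g h k; apply: a_pt_ext; rewrite !Ga_mulE addrA. Qed.
Lemma Ga_mul1 R : left_id (Ga_one R) (@Ga_mul R).
Proof. by move=> g; apply: a_pt_ext; rewrite Ga_mulE Ga_oneE add0r. Qed.
Lemma Ga_mulV R : left_inverse (Ga_one R) (@Ga_inv R) (@Ga_mul R).
Proof. by move=> g; apply: a_pt_ext; rewrite Ga_mulE Ga_invE Ga_oneE addNr. Qed.
Lemma Ga_nat R S (f : shom R S) (g h : shom Aa R) :
  shom_comp f (Ga_mul g h) = Ga_mul (shom_comp f g) (shom_comp f h).
Proof. by apply: a_pt_ext; rewrite !(shom_compE, Ga_mulE) rmorphD. Qed.

Definition Ga : supergroup K :=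
  @Supergroup K Aa (fin_gen_even (@nat_gen K)) Ga_mul Ga_one Ga_inv
    Ga_mulA Ga_mul1 Ga_mulV Ga_nat.

Local Notation Am := (evenalg (monoid_alg K int)).

Definition Gm_mul R (g h : shom Am R) : shom Am R :=
  m_pt (homogM_even (even_evenalg g cot) (even_evenalg h cot))
    (homogM_even (even_evenalg g cotV) (even_evenalg h cotV))
    (mul_unit (m_ptV g) (m_ptV h) (even_evenalg h cot) (even_evenalg g cotV)).
Definition Gm_one R : shom Am R := m_pt (ev1 R) (ev1 R) (mulr1 1).
Lemma Gm_VV R (g : shom Am R) : g cotV * g cot = 1.
Proof. by rewrite -(m_ptV g) (even_central _ (even_evenalg g cot)). Qed.
Definition Gm_inv R (g : shom Am R) : shom Am R :=
  m_pt (even_evenalg g cotV) (even_evenalg g cot) (Gm_VV g).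

Lemma Gm_mulE R (g h : shom Am R) : Gm_mul g h cot = g cot * h cot.
Proof. by rewrite m_ptE. Qed.

Lemma Gm_oneE R : Gm_one R cot = 1.
Proof. by rewrite m_ptE. Qed.
Lemma Gm_invE R (g : shom Am R) : Gm_inv g cot = g cotV.
Proof. by rewrite m_ptE. Qed.

Lemma Gm_mulA R : associative (@Gm_mul R).
Proof. by move=> g h k; apply: m_pt_ext; rewrite !Gm_mulE mulrA. Qed.
Lemma Gm_mul1 R : left_id (Gm_one R) (@Gm_mul R).
Proof.
by move=> g; apply: m_pt_ext; rewrite Gm_mulE Gm_oneE mul1r.
Qed.
Lemma Gm_mulV R : left_inverse (Gm_one R) (@Gm_inv R) (@Gm_mul R).
Proof.
by move=> g; apply: m_pt_ext; rewrite Gm_mulE Gm_invE Gm_oneE Gm_VV.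
Qed.
Lemma Gm_nat R S (f : shom R S) (g h : shom Am R) :
  shom_comp f (Gm_mul g h) = Gm_mul (shom_comp f g) (shom_comp f h).
Proof. by apply: m_pt_ext; rewrite !(shom_compE, Gm_mulE) rmorphM. Qed.

Definition Gm : supergroup K :=
  @Supergroup K Am (fin_gen_even (@int_gen K)) Gm_mul Gm_one Gm_inv
    Gm_mulA Gm_mul1 Gm_mulV Gm_nat.

Local Notation Aam := (evenalg (monoid_alg K (nat * int)%type)).

Definition GaGm_mul R (g h : shom Aam R) : shom Aam R :=
  am_pt (homogD (even_evenalg g coT2) (even_evenalg h coT2))
    (homogM_even (even_evenalg g cot2) (even_evenalg h cot2))
    (homogM_even (even_evenalg g cotV2) (even_evenalg h cotV2))
    (mul_unit (am_ptV g) (am_ptV h) (even_evenalg h cot2)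
       (even_evenalg g cotV2)).
Definition GaGm_one R : shom Aam R :=
  am_pt (ev0 R) (ev1 R) (ev1 R) (mulr1 1).
Lemma GaGm_VV R (g : shom Aam R) : g cotV2 * g cot2 = 1.
Proof. by rewrite -(am_ptV g) (even_central _ (even_evenalg g cot2)). Qed.
Definition GaGm_inv R (g : shom Aam R) : shom Aam R :=
  am_pt (homogN (even_evenalg g coT2)) (even_evenalg g cotV2)
    (even_evenalg g cot2) (GaGm_VV g).

Lemma GaGm_mulE R (g h : shom Aam R) :
  (GaGm_mul g h coT2 = g coT2 + h coT2) *
  (GaGm_mul g h cot2 = g cot2 * h cot2).
Proof. by rewrite !am_ptE. Qed.
Lemma GaGm_oneE R : (GaGm_one R coT2 = 0) * (GaGm_one R cot2 = 1).
Proof. by rewrite !am_ptE. Qed.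
Lemma GaGm_invE R (g : shom Aam R) :
  (GaGm_inv g coT2 = - g coT2) * (GaGm_inv g cot2 = g cotV2).
Proof. by rewrite !am_ptE. Qed.

Lemma GaGm_mulA R : associative (@GaGm_mul R).
Proof.
by move=> g h k; apply: am_pt_ext; rewrite !GaGm_mulE ?addrA ?mulrA.
Qed.
Lemma GaGm_mul1 R : left_id (GaGm_one R) (@GaGm_mul R).
Proof.
by move=> g; apply: am_pt_ext; rewrite !GaGm_mulE !GaGm_oneE ?add0r ?mul1r.
Qed.
Lemma GaGm_mulV R : left_inverse (GaGm_one R) (@GaGm_inv R) (@GaGm_mul R).
Proof.
move=> g; apply: am_pt_ext; rewrite !GaGm_mulE !GaGm_oneE !GaGm_invE.
  exact: addNr.
exact: GaGm_VV.
Qed.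
Lemma GaGm_nat R S (f : shom R S) (g h : shom Aam R) :
  shom_comp f (GaGm_mul g h) = GaGm_mul (shom_comp f g) (shom_comp f h).
Proof.
by apply: am_pt_ext; rewrite !(shom_compE, GaGm_mulE) ?rmorphD ?rmorphM.
Qed.

Definition GaGm : supergroup K :=
  @Supergroup K Aam (fin_gen_even (@pair_gen K)) GaGm_mul GaGm_one GaGm_inv
    GaGm_mulA GaGm_mul1 GaGm_mulV GaGm_nat.

Section Super.
Variables c d : K.

Local Notation Em := (ext_superalg (monoid_alg K int)).

Lemma unit_d R (t s z z' : R) : t * s = 1 -> ev R s -> od R z -> od R z' ->
  t * ufactor d z z' * (s * ufactor d (- z) z') = 1.
Proof.
move=> ts hs hz hz'; apply: (mul_unit ts) => //.
  exact: ufactorV.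
exact: ufactor_even.
Qed.

(* (t, z) (t', z') = (t t' (1 + d z z'), z + z') *)
Definition Gms_mul R (g h : shom Em R) : shom Em R :=
  let hg := even_ext_in g in let hh := even_ext_in h in
  let zg := odd_ext_z g in let zh := odd_ext_z h in
  mz_pt (homogM_even (homogM_even (hg cot) (hh cot)) (ufactor_even d zg zh))
    (homogM_even (homogM_even (hg cotV) (hh cotV))
       (ufactor_even d (homogN zg) zh))
    (homogD zg zh)
    (unit_d (mul_unit (mz_ptV g) (mz_ptV h) (hh cot) (hg cotV))
       (homogM_even (hg cotV) (hh cotV)) zg zh).
Definition Gms_one R : shom Em R := mz_pt (ev1 R) (ev1 R) (od0 R) (mulr1 1).
Lemma Gms_VV R (g : shom Em R) : g (ext_in cotV) * g (ext_in cot) = 1.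
Proof. by rewrite -(mz_ptV g) (even_central _ (even_ext_in g cot)). Qed.
Definition Gms_inv R (g : shom Em R) : shom Em R :=
  mz_pt (even_ext_in g cotV) (even_ext_in g cot) (homogN (odd_ext_z g))
    (Gms_VV g).

Lemma Gms_mulE R (g h : shom Em R) :
  (Gms_mul g h (ext_in cot) =
    g (ext_in cot) * h (ext_in cot) * ufactor d (g (ext_z _)) (h (ext_z _))) *
  (Gms_mul g h (ext_z _) = g (ext_z _) + h (ext_z _)).
Proof. by rewrite !mz_ptE. Qed.
Lemma Gms_oneE R :
  (Gms_one R (ext_in cot) = 1) * (Gms_one R (ext_z _) = 0).
Proof. by rewrite !mz_ptE. Qed.
Lemma Gms_invE R (g : shom Em R) :
  (Gms_inv g (ext_in cot) = g (ext_in cotV)) *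
  (Gms_inv g (ext_z _) = - g (ext_z _)).
Proof. by rewrite !mz_ptE. Qed.

Lemma assoc_d R (t1 t2 t3 z1 z2 z3 : R) : ev R t3 ->
  od R z1 -> od R z2 -> od R z3 ->
  t1 * (t2 * t3 * ufactor d z2 z3) * ufactor d z1 (z2 + z3) =
  t1 * t2 * ufactor d z1 z2 * t3 * ufactor d (z1 + z2) z3.
Proof.
move=> h3 o1 o2 o3; rewrite -!mulrA; congr (_ * (_ * _)).
rewrite -ufactor_cocycle // !mulrA; congr (_ * _).
exact: even_central.
Qed.

Lemma Gms_mulA R : associative (@Gms_mul R).
Proof.
move=> g h k; apply: mz_pt_ext; rewrite !Gms_mulE ?addrA //.
by apply: assoc_d; [exact: even_ext_in | exact: odd_ext_z ..].
Qed.
Lemma Gms_mul1 R : left_id (Gms_one R) (@Gms_mul R).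
Proof.
move=> g; apply: mz_pt_ext; rewrite !Gms_mulE !Gms_oneE ?add0r //.
by rewrite ufactor0l mulr1 mul1r.
Qed.
Lemma Gms_mulV R : left_inverse (Gms_one R) (@Gms_inv R) (@Gms_mul R).
Proof.
move=> g; apply: mz_pt_ext; rewrite !Gms_mulE !Gms_oneE !Gms_invE ?addNr //.
by rewrite ufactorNN ?mulr1; [exact: Gms_VV | exact: odd_ext_z].
Qed.

Lemma ufactor_morph R S (f : shom R S) (x y : R) :
  f (ufactor d x y) = ufactor d (f x) (f y).
Proof. by rewrite /ufactor addrC linearP rmorph1 rmorphM addrC. Qed.

Lemma Gms_nat R S (f : shom R S) (g h : shom Em R) :
  shom_comp f (Gms_mul g h) = Gms_mul (shom_comp f g) (shom_comp f h).
Proof.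
apply: mz_pt_ext; rewrite !(shom_compE, Gms_mulE) ?rmorphD //.
by rewrite !rmorphM -ufactor_morph.
Qed.

Definition Gm_super : supergroup K :=
  @Supergroup K Em (fin_gen_ext (@int_gen K)) Gms_mul Gms_one Gms_inv
    Gms_mulA Gms_mul1 Gms_mulV Gms_nat.

Local Notation Eam := (ext_superalg (monoid_alg K (nat * int)%type)).

Lemma ev_c R (a b x y : R) : ev R a -> ev R b -> od R x -> od R y ->
  ev R (a + b + c *: (x * y)).
Proof.
by move=> ha hb hx hy; apply: homogD (homogD ha hb) _; apply/homogZ/homogM_odd.
Qed.

(* (a, t, z) (a', t', z') = (a + a' + c z z', t t' (1 + d z z'), z + z') *)
Definition GaGms_mul R (g h : shom Eam R) : shom Eam R :=
  let hg := even_ext_in g in let hh := even_ext_in h in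
  let zg := odd_ext_z g in let zh := odd_ext_z h in
  amz_pt (ev_c (hg coT2) (hh coT2) zg zh)
    (homogM_even (homogM_even (hg cot2) (hh cot2)) (ufactor_even d zg zh))
    (homogM_even (homogM_even (hg cotV2) (hh cotV2))
       (ufactor_even d (homogN zg) zh))
    (homogD zg zh)
    (unit_d (mul_unit (amz_ptV g) (amz_ptV h) (hh cot2) (hg cotV2))
       (homogM_even (hg cotV2) (hh cotV2)) zg zh).
Definition GaGms_one R : shom Eam R :=
  amz_pt (ev0 R) (ev1 R) (ev1 R) (od0 R) (mulr1 1).
Lemma GaGms_VV R (g : shom Eam R) : g (ext_in cotV2) * g (ext_in cot2) = 1.
Proof. by rewrite -(amz_ptV g) (even_central _ (even_ext_in g cot2)). Qed.
Definition GaGms_inv R (g : shom Eam R) : shom Eam R :=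
  amz_pt (homogN (even_ext_in g coT2)) (even_ext_in g cotV2)
    (even_ext_in g cot2) (homogN (odd_ext_z g)) (GaGms_VV g).

Lemma GaGms_mulE R (g h : shom Eam R) :
  (GaGms_mul g h (ext_in coT2) =
    g (ext_in coT2) + h (ext_in coT2) + c *: (g (ext_z _) * h (ext_z _))) *
  (GaGms_mul g h (ext_in cot2) =
    g (ext_in cot2) * h (ext_in cot2) * ufactor d (g (ext_z _)) (h (ext_z _))) *
  (GaGms_mul g h (ext_z _) = g (ext_z _) + h (ext_z _)).
Proof. by rewrite !amz_ptE. Qed.
Lemma GaGms_oneE R :
  (GaGms_one R (ext_in coT2) = 0) * (GaGms_one R (ext_in cot2) = 1) *
  (GaGms_one R (ext_z _) = 0).
Proof. by rewrite !amz_ptE. Qed.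
Lemma GaGms_invE R (g : shom Eam R) :
  (GaGms_inv g (ext_in coT2) = - g (ext_in coT2)) *
  (GaGms_inv g (ext_in cot2) = g (ext_in cotV2)) *
  (GaGms_inv g (ext_z _) = - g (ext_z _)).
Proof. by rewrite !amz_ptE. Qed.

Lemma GaGms_mulA R : associative (@GaGms_mul R).
Proof.
move=> g h k; apply: amz_pt_ext; rewrite !GaGms_mulE.
- rewrite mulrDl mulrDr !scalerDr -!addrA; congr (_ + (_ + _)).
  by rewrite [RHS]addrCA; congr (_ + _); rewrite addrC -addrA.
- by apply: assoc_d; [exact: even_ext_in | exact: odd_ext_z ..].
exact: addrA.
Qed.
Lemma GaGms_mul1 R : left_id (GaGms_one R) (@GaGms_mul R).
Proof.
move=> g; apply: amz_pt_ext; rewrite GaGms_mulE GaGms_oneE.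
- by rewrite GaGms_oneE mul0r scaler0 addr0 add0r.
- by rewrite GaGms_oneE ufactor0l mulr1 mul1r.
exact: add0r.
Qed.
Lemma GaGms_mulV R : left_inverse (GaGms_one R) (@GaGms_inv R) (@GaGms_mul R).
Proof.
move=> g; apply: amz_pt_ext; rewrite GaGms_mulE GaGms_oneE !GaGms_invE.
- by rewrite addNr add0r mulNr (sa_sqr (odd_ext_z g)) oppr0 scaler0.
- by rewrite ufactorNN ?mulr1; [exact: GaGms_VV | exact: odd_ext_z].
exact: addNr.
Qed.
Lemma GaGms_nat R S (f : shom R S) (g h : shom Eam R) :
  shom_comp f (GaGms_mul g h) = GaGms_mul (shom_comp f g) (shom_comp f h).
Proof.
apply: amz_pt_ext; rewrite !(shom_compE, GaGms_mulE).
- by rewrite addrC linearP rmorphD rmorphM addrC.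
- by rewrite !rmorphM -ufactor_morph.
exact: rmorphD.
Qed.

Definition GaGm_super : supergroup K :=
  @Supergroup K Eam (fin_gen_ext (@pair_gen K)) GaGms_mul GaGms_one GaGms_inv
    GaGms_mulA GaGms_mul1 GaGms_mulV GaGms_nat.

End Super.
End Groups.
Section Morphisms.
Variable K : fieldType.

Lemma gone_nat (G : supergroup K) (R S : superalg K) (f : shom R S) :
  shom_comp f (gone G R) = gone G S.
Proof.
set e := shom_comp f _.
have ee : gmul e e = e by rewrite -gmul_nat gmul1.
by rewrite -[e](gmul1 (s := G)) -(gmulV e) -gmulA ee.
Qed.

Lemma triv_incl_mul (G : supergroup K) (R : superalg K)
  (g h : shom (triv_grp K) R) :
  shom_comp (gmul g h) (gone G (base_superalg K)) =
  gmul (shom_comp g (gone G (base_superalg K)))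
       (shom_comp h (gone G (base_superalg K))).
Proof. by rewrite !gone_nat gmul1. Qed.

Definition triv_incl (G : supergroup K) : sghom (triv_grp K) G :=
  @SGHom K (triv_grp K) G (gone G (base_superalg K)) (@triv_incl_mul G).

Definition Ga_GaGm_comor : shom (GaGm K) (Ga K) :=
  am_pt (R := Ga K) (erefl : homog (sa_gr (Ga K)) false coT) (ev1 (Ga K)) (ev1 (Ga K)) (mulr1 1).

Lemma Ga_GaGm_mul (R : superalg K) (g h : shom (Ga K) R) :
  shom_comp (gmul g h) Ga_GaGm_comor =
  gmul (s := GaGm K) (shom_comp g Ga_GaGm_comor) (shom_comp h Ga_GaGm_comor).
Proof.
apply: am_pt_ext; rewrite GaGm_mulE !shom_compE am_ptE.
  exact: Ga_mulE.
by rewrite !rmorph1 mulr1.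
Qed.

Definition Ga_GaGm : sghom (Ga K) (GaGm K) := SGHom Ga_GaGm_mul.

Definition Gm_GaGm_comor : shom (GaGm K) (Gm K) :=
  am_pt (R := Gm K) (ev0 (Gm K)) (erefl : homog (sa_gr (Gm K)) false cot)
    (erefl : homog (sa_gr (Gm K)) false cotV) (m_ptV (shom_id (Gm K))).

Lemma Gm_GaGm_mul (R : superalg K) (g h : shom (Gm K) R) :
  shom_comp (gmul g h) Gm_GaGm_comor =
  gmul (s := GaGm K) (shom_comp g Gm_GaGm_comor) (shom_comp h Gm_GaGm_comor).
Proof.
apply: am_pt_ext; rewrite GaGm_mulE !shom_compE am_ptE.
  by rewrite !rmorph0 addr0.
exact: Gm_mulE.
Qed.

Definition Gm_GaGm : sghom (Gm K) (GaGm K) := SGHom Gm_GaGm_mul.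

Section Super.
Variables c d : K.
Local Notation GG := (GaGm_super c d).
Local Notation HH := (Gm_super d).

Definition Ga_GaGm_super_comor : shom GG (Ga K) :=
  amz_pt (R := Ga K) (erefl : homog (sa_gr (Ga K)) false coT)
    (ev1 (Ga K)) (ev1 (Ga K)) (od0 (Ga K)) (mulr1 1).

Lemma Ga_GaGm_super_mul (R : superalg K) (g h : shom (Ga K) R) :
  shom_comp (gmul g h) Ga_GaGm_super_comor =
  gmul (s := GG) (shom_comp g Ga_GaGm_super_comor)
    (shom_comp h Ga_GaGm_super_comor).
Proof.
apply: amz_pt_ext; rewrite GaGms_mulE !shom_compE !amz_ptE.
- by rewrite !rmorph0 mulr0 scaler0 addr0; exact: Ga_mulE.
- by rewrite !rmorph1 !rmorph0 ufactor0 !mulr1.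
by rewrite !rmorph0 addr0.
Qed.

Definition Ga_GaGm_super : sghom (Ga K) GG := SGHom Ga_GaGm_super_mul.

Definition GaGm_GaGm_super_comor : shom GG (GaGm K) :=
  amz_pt (R := GaGm K) (erefl : homog (sa_gr (GaGm K)) false coT2)
    (erefl : homog (sa_gr (GaGm K)) false cot2)
    (erefl : homog (sa_gr (GaGm K)) false cotV2)
    (od0 (GaGm K)) (am_ptV (shom_id (GaGm K))).

Lemma GaGm_GaGm_super_mul (R : superalg K) (g h : shom (GaGm K) R) :
  shom_comp (gmul g h) GaGm_GaGm_super_comor =
  gmul (s := GG) (shom_comp g GaGm_GaGm_super_comor)
    (shom_comp h GaGm_GaGm_super_comor).
Proof.
apply: amz_pt_ext; rewrite GaGms_mulE !shom_compE !amz_ptE.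
- by rewrite !rmorph0 mulr0 scaler0 addr0; apply: (GaGm_mulE g h).1.
- by rewrite !rmorph0 ufactor0 mulr1; apply: (GaGm_mulE g h).2.
by rewrite !rmorph0 addr0.
Qed.

Definition GaGm_GaGm_super : sghom (GaGm K) GG := SGHom GaGm_GaGm_super_mul.

Definition Gm_Gm_super_comor : shom HH (Gm K) :=
  mz_pt (R := Gm K) (erefl : homog (sa_gr (Gm K)) false cot)
    (erefl : homog (sa_gr (Gm K)) false cotV)
    (od0 (Gm K)) (m_ptV (shom_id (Gm K))).

Lemma Gm_Gm_super_mul (R : superalg K) (g h : shom (Gm K) R) :
  shom_comp (gmul g h) Gm_Gm_super_comor =
  gmul (s := HH) (shom_comp g Gm_Gm_super_comor) (shom_comp h Gm_Gm_super_comor).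
Proof.
apply: mz_pt_ext; rewrite Gms_mulE !shom_compE !mz_ptE.
- by rewrite !rmorph0 ufactor0 mulr1; exact: Gm_mulE.
by rewrite !rmorph0 addr0.
Qed.

Definition Gm_Gm_super : sghom (Gm K) HH := SGHom Gm_Gm_super_mul.

Definition GaGm_Gm_super_comor : shom HH GG :=
  mz_pt (R := GG) (even_ext_in (shom_id GG) cot2) (even_ext_in (shom_id GG) cotV2)
    (odd_ext_z (shom_id GG)) (amz_ptV (shom_id GG)).

Lemma GaGm_Gm_super_mul (R : superalg K) (g h : shom GG R) :
  shom_comp (gmul g h) GaGm_Gm_super_comor =
  gmul (s := HH) (shom_comp g GaGm_Gm_super_comor)
    (shom_comp h GaGm_Gm_super_comor).
Proof.
apply: mz_pt_ext; rewrite Gms_mulE !shom_compE !mz_ptE.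
- exact: (GaGms_mulE c d g h).1.2.
exact: (GaGms_mulE c d g h).2.
Qed.

Definition GaGm_Gm_super : sghom GG HH := SGHom GaGm_Gm_super_mul.

End Super.
End Morphisms.

Definition super_diagonalizable (K : fieldType) (G : supergroup K) : Prop :=
  (exists (E : supergroup K) (i : sghom E G), is_ev i /\ diagonalizable E) /\
  is_unipotent_radical (triv_incl G).

Definition lie_spanned_by (K : fieldType) (G : supergroup K) (x : G -> K) :
  Prop :=
  [/\ is_lie x, exists a, x a <> 0 &
      forall d, is_lie d -> exists k : K, forall a, d a = k * x a].

(* the value at a of the superbracket [v, v'] = v v' + v' v of two odd elements,
   the product being the convolution (v v')(a) = sum v(a_(1)) v'(a_(2)) *)
Definition odd_bracket_eq (K : fieldType) (G : supergroup K) (v v' : G -> K)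
  (a : G) (k : K) : Prop :=
  exists2 s, comul_eq a s & k = \sum_(p <- s) (v p.1 * v' p.2 + v' p.1 * v p.2).

(* the right adjoint action of G_ev, through i, fixes v: for g in G(R),
   v <| g = sum g^-1(a_(1)) v(a_(2)) g(a_(3)) *)
Definition ad_fixed (K : fieldType) (E G : supergroup K) (i : sghom E G)
  (v : G -> K) : Prop :=
  forall a : G, exists2 s, comul2_eq a s &
    forall (R : superalg K) (g : shom E R),
      \sum_(p <- s) ginv (on_points i g) p.1.1 * (v p.1.2)%:A *
                    on_points i g p.2 = (v a)%:A :> R.

(* The Harish-Chandra pair (GG_ev, Lie(GG)_1) of GG is isomorphic, through i,
   to (G, K v) with v fixed by G and [v, v] = u in Lie(G). *)
Definition hc_pair_trivial_line (K : fieldType) (G GG : supergroup K)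
  (i : sghom G GG) (u : G -> K) : Prop :=
  [/\ even_superalg G, is_ev i & exists v : GG -> K,
    [/\ is_lie_odd v, exists a, v a <> 0,
        forall v', is_lie_odd v' -> exists k : K, forall a, v' a = k * v a,
        ad_fixed i v &
        forall a, odd_bracket_eq v v a (lie_map i u a)]].

(* G_{1,w} for G = G_a x G_m and w = alpha x + beta y. On K[G] (x) /\(z) with
   K[G] = K[T, t, t^-1], the coproduct
     b |-> Delta(b) + <w, b_(2)> Delta(b_(1)) (z (x) z)
   sends T to T (x) 1 + 1 (x) T + <w, T> z (x) z and
   t to (t (x) t) (1 + <w, t> z (x) z), where <w, T> = alpha <x, T> and
   <w, t> = beta <y, t>. *)
Definition GaGm_1 (K : fieldType) (x : Ga K -> K) (y : Gm K -> K)
  (alpha beta : K) : supergroup K :=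
  GaGm_super (alpha * x coT) (beta * y cot).

Definition Gm_1 (K : fieldType) (y : Gm K -> K) (beta : K) : supergroup K :=
  Gm_super (beta * y cot).

Definition lie_w (K : fieldType) (x : Ga K -> K) (y : Gm K -> K)
  (alpha beta : K) : GaGm K -> K :=
  fun a => alpha * lie_map (Ga_GaGm K) x a + beta * lie_map (Gm_GaGm K) y a.

Section Structure.
Variables (K : fieldType) (x : Ga K -> K) (y : Gm K -> K) (alpha beta : K).

Definition ev_incl : sghom (GaGm K) (GaGm_1 x y alpha beta) :=
  GaGm_GaGm_super _ _.
Definition Gm_ev_incl : sghom (Gm K) (Gm_1 y beta) := Gm_Gm_super _.
Definition Ga_incl : sghom (Ga K) (GaGm_1 x y alpha beta) :=
  Ga_GaGm_super _ _.
Definition quot_map : sghom (GaGm_1 x y alpha beta) (Gm_1 y beta) :=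
  GaGm_Gm_super _ _.

End Structure.

(* Main.v *)
(* Write c = <w, T> = alpha <x, T> and d = <w, t> = beta <y, t>, so that
   (a, t, z) (a', t', z') = (a + a' + c z z', t t' (1 + d z z'), z + z') on points.
   Harish-Chandra pairs: both the adjoint action and the bracket are read off
   products of the points 1 + v e, for odd parameters e.
   Splitting: a section is an even f in K[t, 1/t] with
   f(g h) = f(g) + f(h) + c z z'; restricting to z = z' = 0 gives f = 0, and then
   c = 0.
   Radicals: if d <> 0, a morphism from a unipotent M to (G_m)_{1, beta y} is
   trivial, since the (1|1)-dimensional Clifford module with v^2 = d remains simple
   over M unless z restricts to 0, and then t is grouplike on M; hence unipotent
   subgroups of G_{1,w} lie in G_a. If d = 0, the odd line and the subgroup t = 1 are
   normal and unipotent, and too large. Unipotency is proved by exhibiting, in any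
   supermodule, the top coefficient of the coaction on a vector as a fixed vector. *)
Require Import Defs.
From HB Require Import structures.
From mathcomp Require Import all_boot all_algebra.
From mathcomp Require Import boolp monalg finmap.

Set Implicit Arguments.
Unset Strict Implicit.
Unset Printing Implicit Defensive.

Import GRing.Theory.
Local Open Scope ring_scope.

(** A supergroup is given only through its points, so tensors and tangent vectors have to be handled
    through points. An odd v in Lie(G) needs an odd parameter: adjoining an odd e with e e = 0 makes
    eps + v e an algebra morphism, and since e anticommutes with odd elements, products over R[e]
    carry the grading involution. With two parameters, the convolution square v v is the coefficient
    of e1 e2, which is where the term c z z' of the group law shows up; the 2 in [v, v] is v v + v
    v. In the other direction, the bracket and the adjoint action ask for Delta a as a finite
    tensor, and its existence is proved by induction over generators.

    For unipotency the obstacle is the twist c (z (x) z) in Delta T. Giving T weight 2 and z weight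
    1 makes it homogeneous, so Delta is triangular in the basis 1, z, T, T z, T^2, ... Only the
    group with coordinates T and z is treated this way; G_a, the odd line and the trivial group
    inherit unipotency as quotients of it at c = 0. *)

(** * Adjoining an odd parameter *)

(* locked, so that distributivity does not unfold it *)
HB.lock Definition parity (K : fieldType) (R : superalg K) (a : R) : R :=
  a - sa_gr R a - sa_gr R a.

Arguments parity {K R} a.

Section Parity.
Variables (K : fieldType) (R : superalg K).
Implicit Types a b : R.

Lemma odd_partZD k a b : sa_gr R (k *: a + b) = k *: sa_gr R a + sa_gr R b.
Proof. exact: odd_part_linear. Qed.

Lemma parityE a : parity a = a - sa_gr R a - sa_gr R a.
Proof. by rewrite parity.unlock. Qed.

Lemma parity_linear : linear (@parity K R).
Proof.
move=> k a b; rewrite !parityE odd_partZD !scalerBr !opprD.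
by rewrite [RHS]addrACA (addrACA (k *: a)).
Qed.

HB.instance Definition _ :=
  GRing.isLinear.Build K R R *:%R (@parity K R) parity_linear.

Lemma parityD a b : parity (a + b) = parity a + parity b.
Proof. exact: linearD. Qed.

Lemma parity_even a : homog (sa_gr R) false a -> parity a = a.
Proof. by rewrite parityE => ->; rewrite !subr0. Qed.

Lemma parity_odd a : homog (sa_gr R) true a -> parity a = - a.
Proof. by rewrite parityE => ->; rewrite subrr sub0r. Qed.

Lemma parity1 : parity (1 : R) = 1.
Proof. exact/parity_even/sa_one. Qed.

Lemma parityM a b : parity (a * b) = parity a * parity b.
Proof.
have [a0 [a1 [ha0 ha1 ->]]] := even_oddE a.
have [b0 [b1 [hb0 hb1 ->]]] := even_oddE b.
rewrite (parityD a0) (parityD b0) (parity_even ha0) (parity_even hb0).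
rewrite (parity_odd ha1) (parity_odd hb1) !(mulrDl, mulrDr).
rewrite mulrNN mulNr mulrN (parityD (_ + _)) !parityD.
rewrite (parity_even (sa_mul ha0 hb0)) (parity_even (sa_mul ha1 hb1)).
by rewrite (parity_odd (sa_mul ha0 hb1)) (parity_odd (sa_mul ha1 hb0)).
Qed.

Lemma parity_homog i a : homog (sa_gr R) i a -> homog (sa_gr R) i (parity a).
Proof.
case: i => ha; last by rewrite parity_even.
by rewrite parity_odd //; exact: homogN.
Qed.

Lemma odd_commE a b : homog (sa_gr R) true b -> a * b = b * parity a.
Proof.
have [a0 [a1 [ha0 ha1 ->]]] := even_oddE a => hb.
rewrite parityD (parity_even ha0) (parity_odd ha1) mulrDl mulrDr.
by rewrite (even_central b ha0) (odd_anticomm hb ha1) mulrN.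
Qed.

End Parity.

(* R (x) /\(e) with e odd: (a, b) stands for a + b e *)
Definition sext (K : fieldType) (R : superalg K) : Type := (R * R)%type.

Section OddExtension.
Variables (K : fieldType) (R : superalg K).
Local Notation S := (sext R).

HB.instance Definition _ := GRing.Lmodule.on S.

(** Moving e to the right past a applies the grading involution, e a = ([parity] a) e, and e e = 0;
    this is (a + b e)(a' + b' e) expanded. *)
Definition sext_mul (u v : S) : S :=
  (u.1 * v.1, u.1 * v.2 + u.2 * parity v.1).

Lemma sext_eq (u v : S) : u.1 = v.1 -> u.2 = v.2 -> u = v.
Proof. by case: u v => [? ?] [? ?] /= -> ->. Qed.

Lemma sext_mulA : associative sext_mul.
Proof.
move=> u v w; apply: sext_eq; rewrite /= ?mulrA //.
by rewrite parityM mulrDr mulrDl !mulrA addrA.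
Qed.

Lemma sext_mul1 : left_id ((1, 0) : S) sext_mul.
Proof. by move=> u; apply: sext_eq; rewrite /= !mul1r // mul0r addr0. Qed.

Lemma sext_mulr1 : right_id ((1, 0) : S) sext_mul.
Proof.
by move=> u; apply: sext_eq; rewrite /= ?mulr1 // parity1 mulr0 mulr1 add0r.
Qed.

Lemma sext_mulDl : left_distributive sext_mul +%R.
Proof. by move=> u v w; apply: sext_eq; rewrite /= !mulrDl // addrACA. Qed.

Lemma sext_mulDr : right_distributive sext_mul +%R.
Proof.
by move=> u v w; apply: sext_eq; rewrite /= ?parityD !mulrDr // addrACA.
Qed.

Lemma sext_one_neq0 : ((1, 0) : S) != 0.
Proof. by apply/eqP => -[/eqP]; rewrite oner_eq0. Qed.

HB.instance Definition _ := GRing.Zmodule_isNzRing.Build S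
  sext_mulA sext_mul1 sext_mulr1 sext_mulDl sext_mulDr sext_one_neq0.

Lemma sext_scaleAl (k : K) (u v : S) : k *: (u * v : S) = (k *: u : S) * v :> S.
Proof.
apply: sext_eq; first exact: scalerAl.
rewrite -[LHS]/(k *: (u.1 * v.2 + u.2 * parity v.1)).
by rewrite scalerDr (scalerAl k u.1) (scalerAl k u.2).
Qed.

HB.instance Definition _ := GRing.Lmodule_isLalgebra.Build K S sext_scaleAl.

Lemma sext_scaleAr (k : K) (u v : S) : k *: (u * v : S) = u * (k *: v : S) :> S.
Proof.
apply: sext_eq; first exact: scalerAr.
rewrite -[LHS]/(k *: (u.1 * v.2 + u.2 * parity v.1)).
rewrite -[RHS]/(u.1 * (k *: v.2) + u.2 * parity (k *: v.1)).
by rewrite linearZ scalerDr (scalerAr k u.1) (scalerAr k u.2).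
Qed.

HB.instance Definition _ := GRing.Lalgebra_isAlgebra.Build K S sext_scaleAr.

(** The element b e is odd exactly when b is even, so its odd part is the even part of b, times
    e. *)
Definition sext_odd (u : S) : S := (sa_gr R u.1, u.2 - sa_gr R u.2).

Lemma sext_odd_linear : linear sext_odd.
Proof.
move=> k u v; apply: sext_eq; rewrite /= odd_partZD //.
by rewrite scalerBr opprD addrACA.
Qed.

Lemma sext_oddK u : sext_odd (sext_odd u) = sext_odd u.
Proof.
apply: sext_eq; rewrite /= ?odd_partK // [X in _ - X](_ : _ = 0) ?subr0 //.
by rewrite addrC -scaleN1r odd_partZD odd_partK scaleN1r addNr.
Qed.

Definition sext_grading : grading S := Grading sext_odd_linear sext_oddK.

Lemma sext_homogP i (u : S) : homog sext_grading i u <->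
  homog (sa_gr R) i u.1 /\ homog (sa_gr R) (~~ i) u.2.
Proof.
case: u => [a b]; rewrite /homog; case: i => /=; split.
- by case=> ? /eqP; rewrite -subr_eq0 addrAC subrr sub0r oppr_eq0 => /eqP.
- by case=> h1 h2; apply: sext_eq; rewrite /= ?h1 ?h2 ?subr0.
- by case=> ? /eqP; rewrite subr_eq0 => /eqP <-.
- by case=> h1 h2; apply: sext_eq; rewrite /= ?h1 ?h2 ?subrr.
Qed.

Lemma sext_homog_mul i j (u v : S) : homog sext_grading i u ->
  homog sext_grading j v -> homog sext_grading (i (+) j) (u * v).
Proof.
move=> /sext_homogP[u1 u2] /sext_homogP[v1 v2]; apply/sext_homogP.
split; first exact: sa_mul.
apply: homogD.
  by rewrite -addbN; exact: sa_mul.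
by rewrite -addNb; apply: sa_mul => //; exact: parity_homog.
Qed.

Lemma sext_comm i j (u v : S) : homog sext_grading i u ->
  homog sext_grading j v -> v * u = (-1) ^+ (i && j) * (u * v).
Proof.
move=> /sext_homogP[u1 u2] /sext_homogP[v1 v2].
have E1 := sa_comm u1 v1; have E2 := sa_comm u1 v2; have E3 := sa_comm u2 v1.
case: i j u1 u2 v1 v2 E1 E2 E3 => [] [] /= u1 u2 v1 v2;
  rewrite ?expr0 ?expr1 ?mulN1r ?mul1r => E1 E2 E3; apply: sext_eq => //=;
  rewrite ?(parity_odd u1) ?(parity_even u1) ?(parity_odd v1)
    ?(parity_even v1) E3 ?mulNr ?mulrN E2 ?opprD ?opprK addrC //.
Qed.

Lemma sext_sqr (u : S) : homog sext_grading true u -> u * u = 0.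
Proof.
move=> /sext_homogP[u1 u2]; apply: sext_eq; first exact: sa_sqr.
by rewrite /= (parity_odd u1) mulrN (sa_comm u1 u2) expr0 mul1r subrr.
Qed.

Definition sext_superalg : superalg K := @Superalg K S sext_grading
  ((sext_homogP false (1, 0)).2 (conj (sa_one R) (homog0 R true)))
  sext_homog_mul sext_comm sext_sqr.

Definition sext_inl (a : R) : sext_superalg := (a, 0) : S.
Definition sext_eps : sext_superalg := (0, 1) : S.

Lemma sext_inl_shom : is_shom sext_inl.
Proof.
split=> [k a b|//|a b|a]; apply: sext_eq => //=.
- by rewrite scaler0 addr0.
- by rewrite mulr0 mul0r addr0.
- by rewrite (homog0 R false) subr0.
Qed.

Definition sext_in : shom R sext_superalg := SHom sext_inl_shom.

Lemma sext_eps_odd : homog (sa_gr sext_superalg) true sext_eps.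
Proof. by apply/sext_homogP; split; [exact: homog0 | exact: sa_one]. Qed.

Lemma sext_in_eps (a : R) : sext_in a * sext_eps = ((0, a) : S).
Proof. by apply: sext_eq; rewrite /= ?mulr0 // mulr1 mul0r addr0. Qed.

End OddExtension.

(** * Units, inverses and counits on points *)

Section Points.
Variables (K : fieldType) (G : supergroup K).
Implicit Types R S : superalg K.

Lemma counitE R a : gone G R a = (counit a)%:A.
Proof. by rewrite -(gone_nat G (triv_pt R)). Qed.

Lemma counitP k (a b : G) : counit (k *: a + b) = k * counit a + counit b.
Proof. exact: (linearP (gone G (base_superalg K))). Qed.

Lemma counitM (a b : G) : counit (a * b) = counit a * counit b.
Proof. exact: (rmorphM (gone G (base_superalg K))). Qed.

Lemma counit1 : counit (1 : G) = 1.
Proof. exact: (rmorph1 (gone G (base_superalg K))). Qed.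

Lemma counit_odd (a : G) : homog (sa_gr G) true a -> counit a = 0.
Proof. by move=> /(shom_homog (gone G (base_superalg K))) /esym. Qed.

Lemma gmulgV R (g : shom G R) : gmul g (ginv g) = gone G R.
Proof.
have e := gmulV (ginv g).
by rewrite -[LHS]gmul1 -{1}e -gmulA (gmulA (ginv g)) gmulV gmul1 e.
Qed.

Lemma gmulg1 R (g : shom G R) : gmul g (gone G R) = g.
Proof. by rewrite -(gmulV g) gmulA gmulgV gmul1. Qed.

End Points.

Section MorphismPoints.
Variables (K : fieldType) (G H : supergroup K) (f : sghom G H).

(** The image of the unit is idempotent in H(R), and a group has no other idempotent than its
    unit. *)
Lemma comor_one R : shom_comp (gone G R) (comor f) = gone H R.
Proof.
set e := shom_comp _ _.
have ee : gmul e e = e by rewrite -comor_mul gmul1.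
by rewrite -[e](gmul1 (s := H)) -(gmulV e) -gmulA ee.
Qed.

Lemma counit_comor (b : H) : counit (comor f b) = counit b.
Proof. by rewrite /counit -comor_one. Qed.

End MorphismPoints.

(** * Comultiplication, adjoint action and bracket on points *)

Lemma shom_parity (K : fieldType) (A B : superalg K) (f : shom A B) a :
  f (parity a) = parity (f a).
Proof. by rewrite !parityE !rmorphB /= shom_odd. Qed.

(** The Koszul sign rule for elements that need not be homogeneous: the even part of y commutes with
    x, the odd part passes x at the cost of [parity]. It serves to reorder the middle factors of a
    product of two tensors. *)
Lemma super_swap (K : fieldType) (R : superalg K) (x y : R) :
  x * y = (y - sa_gr R y) * x + sa_gr R y * parity x.
Proof.
have [y0 [y1 [h0 h1 ->]]] := even_oddE y.
have -> : sa_gr R (y0 + y1) = y1.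
  by rewrite -[y0]scale1r odd_partZD h0 h1 scaler0 add0r.
by rewrite addrK mulrDr (even_central x h0) (odd_commE x h1).
Qed.

Section Comultiplication.
Variables (K : fieldType) (G : supergroup K).
Implicit Types a b : G.

(** The product is known on points only; that it comes from an actual tensor is established by
    closure under 1, linear combinations and products, then checked on generators. *)
Definition has_comul a := exists s, comul_eq a s.

Lemma has_comul1 : has_comul 1.
Proof. by exists [:: (1, 1)] => R g h; rewrite big_seq1 !rmorph1 mulr1. Qed.

Lemma has_comul_linear k a b :
  has_comul a -> has_comul b -> has_comul (k *: a + b).
Proof.
move=> [s hs] [t ht]; exists ([seq (k *: p.1, p.2) | p <- s] ++ t) => R g h.
rewrite linearP /= big_cat big_map /= hs ht scaler_sumr; congr (_ + _).
by apply: eq_bigr => p _; rewrite linearZ scalerAl.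
Qed.

Lemma has_comulM a b : has_comul a -> has_comul b -> has_comul (a * b).
Proof.
move=> [s hs] [t ht].
(* The two lists are the contributions of the even and the odd part of q.1, which has to move left
   past p.2. *)
exists ([seq (p.1 * (q.1 - sa_gr G q.1), p.2 * q.2) | p <- s, q <- t] ++
        [seq (p.1 * sa_gr G q.1, parity p.2 * q.2) | p <- s, q <- t]) => R g h.
rewrite rmorphM /= hs ht big_cat !big_allpairs_dep /= -big_split big_distrl /=.
apply: eq_bigr => p _; rewrite big_distrr -big_split /=.
apply: eq_bigr => q _; rewrite !rmorphM rmorphB /= shom_odd shom_parity.
rewrite -[LHS]mulrA [h p.2 * (_ * _)]mulrA (super_swap (h p.2)).
by rewrite mulrDl mulrDr !mulrA.
Qed.

Lemma comul2_exists : (forall a, has_comul a) ->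
  forall a, exists s, comul2_eq a s.
Proof.
move=> H a; have [s hs] := H a.
have [t ht] : exists t : seq (G * G * G), forall R (g h k : shom G R),
    \sum_(p <- s) gmul g h p.1 * k p.2 =
    \sum_(p <- t) g p.1.1 * h p.1.2 * k p.2.
  elim: s {hs} => [|p s [t ht]]; first by exists [::] => R g h k; rewrite !big_nil.
  have [u hu] := H p.1.
  exists ([seq (q.1, q.2, p.2) | q <- u] ++ t) => R g h k.
  by rewrite big_cons ht big_cat big_map /= hu big_distrl.
by exists t => R g h k; rewrite hs ht.
Qed.

End Comultiplication.

Section OddLie.
Variables (K : fieldType) (G : supergroup K) (v : G -> K).
Hypothesis hv : is_lie_odd v.
Variable R : superalg K.

Definition odd_lie_fun (a : G) : sext_superalg R :=
  ((counit a)%:A, (v a)%:A) : sext R.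

(** The even part [a - sa_gr G a] is killed by v. *)
Lemma lie_odd_part a : v (sa_gr G a) = v a.
Proof.
have := hv.2 (a - sa_gr G a).
rewrite addrC -scaleN1r hv.1.1 mulN1r => e; apply/eqP.
rewrite -subr_eq0 -oppr_eq0 opprB addrC e //.
by rewrite /homog odd_partZD odd_partK scaleN1r addNr.
Qed.

Lemma odd_lie_shom : is_shom odd_lie_fun.
Proof.
split=> [k a b||a b|a]; apply: sext_eq => /=.
- by rewrite counitP scalerDl scalerA.
- by rewrite hv.1.1 scalerDl scalerA.
- by rewrite counit1 scale1r.
- by rewrite (hv.2 _ (sa_one G)) scale0r.
- by rewrite counitM -scalerAl mul1r scalerA.
- rewrite hv.1.2 linearZ /= parity1 scalerDl -!scalerAl !mul1r !scalerA.
  by rewrite addrC.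
- rewrite counit_odd ?scale0r; last by rewrite /homog odd_partK.
  by rewrite (homogZ _ (sa_one R)).
by rewrite lie_odd_part (homogZ (v a) (sa_one R)) subr0.
Qed.

(* the tangent vector v as the point 1 + v e *)
Definition odd_lie_pt : shom G (sext_superalg R) := SHom odd_lie_shom.

End OddLie.

(** The sum in [ad_fixed] is the coefficient of e in the conjugate of the point eps + v e. Moving e
    to the right past the last factor applies [parity], which is the identity there because E is
    even. *)
Lemma ad_fixed_pt (K : fieldType) (E G : supergroup K) (i : sghom E G)
  (v : G -> K) (hv : is_lie_odd v) : even_superalg E ->
  (forall a : G, has_comul a) ->
  (forall (R : superalg K) (g : shom E R),
    gmul (gmul (shom_comp (sext_in R) (ginv (on_points i g))) (odd_lie_pt hv R))
      (shom_comp (sext_in R) (on_points i g)) = odd_lie_pt hv R) ->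
  ad_fixed i v.
Proof.
move=> Eev Gc H a; have [s hs] := comul2_exists Gc a; exists s => // R g.
have /(congr1 (fun u : sext R => u.2)) /= <- := congr1 (fun f => shom_fun f a) (H R g).
rewrite hs (big_morph (fun u : sext R => u.2) (id1 := 0) (op1 := +%R)) //.
apply: eq_bigr => p _ /=; rewrite mulr0 add0r mul0r addr0; congr (_ * _).
by rewrite parity_even //; apply: (shom_homog g (Eev _)).
Qed.

Lemma ext_gen_ind (K : fieldType) (M : nmodType) (s : seq (monoid_alg K M))
  (P : ext_superalg (monoid_alg K M) -> Prop) :
  (forall Q : monoid_alg K M -> Prop, Q 1 -> (forall a b, Q a -> Q b -> Q (a * b)) ->
     (forall a, a \in s -> Q a) -> forall m, Q (mon K m)) ->
  P 1 -> (forall k a b, P a -> P b -> P (k *: a + b)) ->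
  (forall a b, P a -> P b -> P (a * b)) ->
  (forall a, a \in s -> P (ext_in a)) -> P (ext_z _) -> forall a, P a.
Proof.
move=> H P1 Pl PM Ps Pz a.
have Pin b : P (ext_in b).
  apply: (@span_mon _ _ (ext_superalg _) (@ext_in K _) P (@ext_in_linear K M)) => //.
  apply: (H (fun b => P (ext_in b))) => // b1 b2 h1 h2.
  by rewrite ext_inM; exact: PM.
by rewrite (ext_decomp a) -[ext_in a.1]scale1r; apply: Pl => //; exact: PM.
Qed.

Lemma parity_sext (K : fieldType) (R : superalg K) (u : sext R) :
  parity (u : sext_superalg R) = (parity u.1, - parity u.2) :> sext R.
Proof.
rewrite !parityE; apply: sext_eq => //=.
by rewrite !opprB [u.2 + _]addrC subrK.
Qed.

Lemma sextM (K : fieldType) (R : superalg K) (u v : sext_superalg R) :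
  u * v = (u.1 * v.1, u.1 * v.2 + u.2 * parity v.1) :> sext R.
Proof. by []. Qed.

Lemma sext_inM (K : fieldType) (R : superalg K) (x : R) (u : sext_superalg R) :
  sext_in R x * u = (x * u.1, x * u.2) :> sext R.
Proof. by rewrite sextM mul0r addr0. Qed.

Definition sext_snd (K : fieldType) (R : superalg K) (u : sext_superalg R) : R :=
  (u : sext R).2.

Lemma sext_sndD (K : fieldType) (R : superalg K) :
  {morph @sext_snd K R : u v / u + v}.
Proof. by []. Qed.

Lemma sext_snd_inMZ (K : fieldType) (R : superalg K) (x : R) (k : K)
  (u : sext_superalg R) : sext_snd u = k%:A -> sext_snd (sext_in R x * u) = k *: x.
Proof. by rewrite /sext_snd sext_inM => ->; rewrite /= -scalerAr mulr1. Qed.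

Section LieProduct.
Variables (K : fieldType) (G : supergroup K) (v w : G -> K).
Hypotheses (hv : is_lie_odd v) (hw : is_lie w).
Hypothesis w_odd : forall a, homog (sa_gr G) true a -> w a = 0.

Local Notation S1 := (sext_superalg (base_superalg K)).
Local Notation S2 := (sext_superalg S1).

Lemma parity_base (k : base_superalg K) : parity k = k.
Proof. exact: parity_even. Qed.

(** The map eps + v e1 + v e2 + w e1 e2. It is multiplicative when w is a derivation, since the
    cross terms v(a) v(b) e1 e2 and v(a) v(b) e2 e1 cancel. *)
Definition lie_product_fun (a : G) : S2 :=
  ((((counit a : K^o), (v a : K^o)) : sext (base_superalg K)),
   (((v a : K^o), (w a : K^o)) : sext (base_superalg K))) : sext S1.

Lemma lie_product_shom : is_shom lie_product_fun.
Proof.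
have [v1 w1] : v 1 = 0 /\ w 1 = 0.
  split; first exact: hv.2 (sa_one G).
  have := hw.2 1 1; rewrite counit1 !mulr1 mul1r => /eqP.
  by rewrite -subr_eq subrr eq_sym => /eqP.
split.
- by move=> k a b; rewrite /lie_product_fun counitP !hv.1.1 hw.1.
- by rewrite /lie_product_fun counit1 v1 w1.
- move=> a b; rewrite sextM /= !sextM parity_sext /= !parity_base.
  rewrite /lie_product_fun counitM hv.1.2 hw.2 mulrN !(addrC (v a * counit b)).
  by congr ((_, _), (_, _)); rewrite addrA addrK addrC.
move=> a; have odd_a : homog (sa_gr G) true (sa_gr G a) by exact: odd_partK.
rewrite /lie_product_fun counit_odd // !(lie_odd_part hv) w_odd //.
by apply: sext_eq; apply: sext_eq; rewrite /= ?subr0 ?subrr.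
Qed.

Definition lie_product_pt : shom G S2 := SHom lie_product_shom.

(* v v = w is read off the coefficient of e1 e2 in (1 + v e1)(1 + v e2) *)
Lemma odd_bracket_pt : (forall a : G, has_comul a) ->
  gmul (shom_comp (sext_in S1) (odd_lie_pt hv (base_superalg K)))
    (odd_lie_pt hv S1) = lie_product_pt ->
  forall a, odd_bracket_eq v v a (2%:R * w a).
Proof.
move=> Gc H a; have [s hs] := Gc a; exists s => //.
pose e12 (u : S2) : base_superalg K := sext_snd (sext_snd u).
have e12D : {morph e12 : x y / x + y} by move=> x y; rewrite /e12 !sext_sndD.
have term p : e12 (sext_in S1 (odd_lie_pt hv (base_superalg K) p.1) *
    odd_lie_pt hv S1 p.2) = v p.1 * v p.2.
  rewrite /e12 (@sext_snd_inMZ _ _ _ (v p.2)) //.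
  rewrite -[LHS]/(v p.2 * (v p.1 * 1)) mulr1; exact: mulrC.
have <- : e12 (lie_product_pt a) = w a by [].
(* With v' = v the bracket adds the same sum twice, which accounts for the factor 2. *)
rewrite -H hs (big_morph e12 e12D (erefl : e12 0 = 0)) mulr_natl -sumrMnl.
by apply: eq_bigr => p _; rewrite mulr2n -[in RHS]term.
Qed.

End LieProduct.

(** * Lie superalgebras and Harish-Chandra pairs *)

Section Lie.
Variables (K : fieldType) (G : supergroup K).
Implicit Types d : G -> K.

Lemma lie0 d : is_lie d -> d 0 = 0.
Proof. by move=> [dl _]; have := dl (-1) 0 0; rewrite scaler0 addr0 mulN1r addNr. Qed.

Lemma lie1 d : is_lie d -> d 1 = 0.
Proof.
move=> [_ dM]; have := dM 1 1; rewrite counit1 !mulr1 mul1r => /eqP.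
by rewrite -subr_eq subrr eq_sym => /eqP.
Qed.

Lemma lie_scale d k : is_lie d -> is_lie (fun a => k * d a).
Proof.
move=> [dl dM]; split=> [l a b|a b]; first by rewrite dl mulrDr !mulrA (mulrC k).
by rewrite dM mulrDr !mulrA (mulrC k (counit a)).
Qed.

Lemma lie_add d d' : is_lie d -> is_lie d' -> is_lie (fun a => d a + d' a).
Proof.
move=> [dl dM] [dl' dM']; split=> [l a b|a b].
  by rewrite dl dl' mulrDr addrACA.
by rewrite dM dM' mulrDl mulrDr addrACA.
Qed.

Lemma lie_zero d : is_lie d ->
  (exists2 s : seq G, forall p, p \in s -> d p = 0 & forall P : G -> Prop,
    P 1 -> (forall k a b, P a -> P b -> P (k *: a + b)) ->
    (forall a b, P a -> P b -> P (a * b)) -> (forall a, a \in s -> P a) ->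
    forall a, P a) ->
  forall a, d a = 0.
Proof.
move=> hd [s ds sgen]; apply: sgen => //; first exact: lie1.
  by move=> k a b da db; rewrite hd.1 da db mulr0 addr0.
by move=> a b da db; rewrite hd.2 da db mul0r mulr0 addr0.
Qed.

End Lie.

Lemma lie_map_lie (K : fieldType) (G H : supergroup K) (f : sghom G H)
  (d : G -> K) : is_lie d -> is_lie (lie_map f d).
Proof.
move=> [dl dM]; split=> [k a b|a b]; rewrite /lie_map.
  by rewrite linearP; exact: dl.
by rewrite rmorphM dM !counit_comor.
Qed.

Section Augmentation.
Variables (K : fieldType) (M : nmodType).
Local Notation A := (monoid_alg K M).

Variable chi : char_pt M (base_superalg K).

Definition aug : shom (evenalg A) (base_superalg K) := mon_pt chi.

Lemma augD (a b : A) : aug (a + b) = aug a + aug b.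
Proof. exact: (rmorphD aug). Qed.

Lemma augM (a b : A) : aug (a * b) = aug a * aug b.
Proof. exact: (rmorphM aug). Qed.

Definition ext_proj_fun (u : ext_superalg A) : evenalg A := u.1.

Lemma ext_proj_shom : is_shom ext_proj_fun. Proof. by []. Qed.

Definition ext_proj : shom (ext_superalg A) (evenalg A) := SHom ext_proj_shom.

(** The ideal generated by the odd elements is the set of multiples of z. *)
Lemma ext_proj_odd_ideal (a : ext_superalg A) :
  ext_proj a = 0 <-> in_ideal (homog (sa_gr (ext_superalg A)) true) a.
Proof.
split=> [a1|[s hs ->]].
  exists [:: (ext_in a.2, ext_z A)]; first by move=> p; rewrite inE => /eqP ->.
  rewrite big_seq1 [LHS]ext_decomp -[a.1]/(ext_proj a) a1.
  by rewrite [ext_in 0](_ : _ = 0) ?add0r.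
rewrite linear_sum big_seq big1 //= => p /hs /ext_homogP hp.
by rewrite /ext_proj_fun /= hp mulr0.
Qed.

End Augmentation.

(** * The odd tangent line when z is the only odd generator *)

Section ExtSupergroup.
Variables (K : fieldType) (M : nmodType).
Local Notation A := (monoid_alg K M).
Local Notation E := (ext_superalg A).
Variables (fin : fin_generated E)
  (mul : forall R : superalg K, shom E R -> shom E R -> shom E R)
  (one : forall R : superalg K, shom E R)
  (inv : forall R : superalg K, shom E R -> shom E R)
  (mA : forall R, associative (@mul R)) (m1 : forall R, left_id (one R) (@mul R))
  (mV : forall R, left_inverse (one R) (@inv R) (@mul R))
  (mN : forall (R S : superalg K) (f : shom R S) (g h : shom E R),
    shom_comp f (mul g h) = mul (shom_comp f g) (shom_comp f h)).
Variable chi : char_pt M (base_superalg K).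
Let G := Supergroup fin mA m1 mV mN.
Hypothesis one_mon : one (base_superalg K) = shom_comp (aug chi) (ext_proj K M).

Lemma ext_counitE (u : G) : counit u = aug chi (u : E).1.
Proof. by rewrite /counit /= one_mon. Qed.

(** The derivative along z at the identity: b + b' z goes to eps(b'). *)
Definition odd_dir (u : G) : K := aug chi (u : E).2.

Lemma odd_dir_lie : is_lie_odd odd_dir.
Proof.
split; last by move=> a /ext_homogP /= h; rewrite /odd_dir h linear0.
split=> [k a b|a b]; first by rewrite /odd_dir /= linearP.
by rewrite !ext_counitE /odd_dir augD !augM addrC; congr (_ + _).
Qed.

Lemma odd_dir_z : odd_dir (ext_z A) = 1. Proof. exact: (rmorph1 (aug chi)). Qed.

(** An odd v vanishes on the even elements b and b', so the Leibniz rule leaves v(b + b' z) =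
    eps(b') v(z). *)
Lemma odd_dir_uniq (v : G -> K) : is_lie_odd v ->
  exists k, forall a, v a = k * odd_dir a.
Proof.
move=> [[vl vM] v0]; exists (v (ext_z A)) => a.
have vin (b : A) : v (ext_in b) = 0 by apply: v0.
rewrite [in LHS](ext_decomp a) -[ext_in (a : E).1]scale1r vl vin mulr0 add0r.
by rewrite vM vin mul0r add0r ext_counitE; exact: mulrC.
Qed.

End ExtSupergroup.

Section HarishChandra.
Variables (K : fieldType) (c d : K).
Local Notation GG := (GaGm_super c d).
Local Notation HH := (Gm_super d).

Definition int_counit_char : char_pt int (base_superalg K) :=
  int_char (ev1 _) (ev1 _) (mulr1 1).
Definition pair_counit_char : char_pt (nat * int)%type (base_superalg K) :=
  pair_char (nat_char (ev0 _)) int_counit_char.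

Lemma GaGm_super_one_aug : gone GG (base_superalg K) =
  shom_comp (aug pair_counit_char) (ext_proj K (nat * int)%type).
Proof.
apply: ext_pt_ext => [m|]; first by rewrite ext_ptE shom_compE [RHS]mon_ptE.
by rewrite ext_pt_z shom_compE (linear0 (aug _)).
Qed.

Lemma Gm_super_one_aug : gone HH (base_superalg K) =
  shom_comp (aug int_counit_char) (ext_proj K int).
Proof.
apply: ext_pt_ext => [m|]; first by rewrite ext_ptE shom_compE [RHS]mon_ptE.
by rewrite ext_pt_z shom_compE (linear0 (aug _)).
Qed.

Lemma GaGms_mulV R (g h : shom GG R) : GaGms_mul c d g h (ext_in cotV2) =
  g (ext_in cotV2) * h (ext_in cotV2) * ufactor d (- g (ext_z _)) (h (ext_z _)).
Proof. by rewrite amz_ptE. Qed.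

Lemma Gms_mulV R (g h : shom HH R) : Gms_mul d g h (ext_in cotV) =
  g (ext_in cotV) * h (ext_in cotV) * ufactor d (- g (ext_z _)) (h (ext_z _)).
Proof. by rewrite mz_ptE. Qed.

Lemma ufactorN (R : superalg K) (x y : R) : ufactor d (- x) y = ufactor (- d) x y.
Proof. by rewrite /ufactor mulNr scalerN scaleNr. Qed.

(** As t' is even, t t' (1 + k z z') = t t' + k (t z)(t' z'), so Delta t = t (x) t + k (t z (x) t
    z). It applies to t with k = d and to 1/t with k = - d. *)
Lemma has_comul_twisted (G : supergroup K) (t z : G) k :
  homog (sa_gr G) false t ->
  (forall R (g h : shom G R),
     gmul g h t = g t * h t * ufactor k (g z) (h z)) -> has_comul t.
Proof.
move=> t0 H; exists [:: (t, t); (k *: (t * z), t * z)] => R g h.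
rewrite H big_cons big_seq1 /= linearZ !rmorphM /ufactor mulrDr mulr1.
rewrite -scalerAr -scalerAl; congr (_ + _ *: _).
by rewrite -!mulrA (mulrA (h t)) (even_central (g z) (shom_homog h t0)) -mulrA.
Qed.

Lemma has_comul_primitive (G : supergroup K) (t : G) (s : seq (G * G)) :
  (forall R (g h : shom G R),
     gmul g h t = g t + h t + \sum_(p <- s) g p.1 * h p.2) -> has_comul t.
Proof.
move=> H; exists [:: (t, 1), (1, t) & s] => R g h.
by rewrite H !big_cons /= !rmorph1 mulr1 mul1r addrA.
Qed.

Lemma GaGm_super_comul (a : GG) : has_comul a.
Proof.
move: a; apply: (ext_gen_ind (@pair_gen K)).
- exact: (@has_comul1 K GG).
- exact: (@has_comul_linear K GG).
- exact: (@has_comulM K GG).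
- move=> a; rewrite !inE => /or3P[] /eqP ->.
  + apply: (@has_comul_primitive GG _ [:: (c *: ext_z _, ext_z _)]) => R g h.
    by rewrite big_seq1 /= linearZ -scalerAl; exact: (GaGms_mulE c d g h).1.1.
  + apply: (@has_comul_twisted GG _ (ext_z _) d) => // R g h.
    exact: (GaGms_mulE c d g h).1.2.
  apply: (@has_comul_twisted GG _ (ext_z _) (- d)) => // R g h.
  by rewrite -ufactorN; exact: GaGms_mulV.
apply: (@has_comul_primitive GG _ [::]) => R g h.
by rewrite big_nil addr0; exact: (GaGms_mulE c d g h).2.
Qed.

Lemma Gm_super_comul (a : HH) : has_comul a.
Proof.
move: a; apply: (ext_gen_ind (@int_gen K)).
- exact: (@has_comul1 K HH).
- exact: (@has_comul_linear K HH).
- exact: (@has_comulM K HH).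
- move=> a; rewrite !inE => /orP[] /eqP ->.
  + apply: (@has_comul_twisted HH _ (ext_z _) d) => // R g h.
    exact: (Gms_mulE d g h).1.
  apply: (@has_comul_twisted HH _ (ext_z _) (- d)) => // R g h.
  by rewrite -ufactorN; exact: Gms_mulV.
apply: (@has_comul_primitive HH _ [::]) => R g h.
by rewrite big_nil addr0; exact: (Gms_mulE d g h).2.
Qed.

Definition GaGm_odd : GG -> K := odd_dir pair_counit_char.
Definition Gm_odd : HH -> K := odd_dir int_counit_char.

Lemma GaGm_odd_lie : is_lie_odd GaGm_odd.
Proof. by apply: odd_dir_lie; exact: GaGm_super_one_aug. Qed.

Lemma Gm_odd_lie : is_lie_odd Gm_odd.
Proof. by apply: odd_dir_lie; exact: Gm_super_one_aug. Qed.

Lemma GaGm_comor_proj : comor (GaGm_GaGm_super c d) = ext_proj K (nat * int)%type.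
Proof. by apply: amz_pt_ext; rewrite amz_ptE. Qed.

Lemma Gm_comor_proj : comor (Gm_Gm_super d) = ext_proj K int.
Proof. by apply: mz_pt_ext; rewrite mz_ptE. Qed.

Lemma GaGm_is_ev : is_ev (GaGm_GaGm_super c d).
Proof.
split=> [b|a]; first by exists (ext_in b); rewrite GaGm_comor_proj.
by rewrite GaGm_comor_proj; exact: ext_proj_odd_ideal.
Qed.

Lemma Gm_is_ev : is_ev (Gm_Gm_super d).
Proof.
split=> [b|a]; first by exists (ext_in b); rewrite Gm_comor_proj.
by rewrite Gm_comor_proj; exact: ext_proj_odd_ideal.
Qed.

End HarishChandra.

Lemma odd_lie_ptE (K : fieldType) (G : supergroup K) (v : G -> K)
  (hv : is_lie_odd v) (R : superalg K) (a : G) :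
  odd_lie_pt hv R a = (((counit a)%:A, (v a)%:A) : sext R).
Proof. by []. Qed.

Section Sections.
Variables (K : fieldType) (c d : K).
Local Notation GG := (GaGm_super c d).
Local Notation HH := (Gm_super d).

Lemma GaGm_super_mulE (R : superalg K) (g h : shom GG R) :
  (gmul g h (ext_in coT2) =
    g (ext_in coT2) + h (ext_in coT2) + c *: (g (ext_z _) * h (ext_z _))) *
  (gmul g h (ext_in cot2) =
    g (ext_in cot2) * h (ext_in cot2) * ufactor d (g (ext_z _)) (h (ext_z _))) *
  (gmul g h (ext_z _) = g (ext_z _) + h (ext_z _)).
Proof. exact: GaGms_mulE. Qed.

Lemma GaGm_super_invE (R : superalg K) (g : shom GG R) :
  (ginv g (ext_in coT2) = - g (ext_in coT2)) *
  (ginv g (ext_in cot2) = g (ext_in cotV2)) *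
  (ginv g (ext_z _) = - g (ext_z _)).
Proof. exact: GaGms_invE. Qed.

Lemma Gm_super_mulE (R : superalg K) (g h : shom HH R) :
  (gmul g h (ext_in cot) =
    g (ext_in cot) * h (ext_in cot) * ufactor d (g (ext_z _)) (h (ext_z _))) *
  (gmul g h (ext_z _) = g (ext_z _) + h (ext_z _)).
Proof. exact: Gms_mulE. Qed.

Lemma Gm_super_invE (R : superalg K) (g : shom HH R) :
  (ginv g (ext_in cot) = g (ext_in cotV)) *
  (ginv g (ext_z _) = - g (ext_z _)).
Proof. exact: Gms_invE. Qed.

Lemma GaGm_odd_ptE (R : superalg K) (h := odd_lie_pt (GaGm_odd_lie c d) R) :
  (h (ext_in coT2) = 0) * (h (ext_in cot2) = 1) * (h (ext_z _) = sext_eps R).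
Proof.
split; [split|]; apply: sext_eq; rewrite /h odd_lie_ptE /=.
- by rewrite /counit [gone _ _ _](GaGms_oneE _).1.1 scale0r.
- by rewrite /GaGm_odd /odd_dir (linear0 (aug _)) scale0r.
- by rewrite /counit [gone _ _ _](GaGms_oneE _).1.2 scale1r.
- by rewrite /GaGm_odd /odd_dir (linear0 (aug _)) scale0r.
- by rewrite /counit [gone _ _ _](GaGms_oneE _).2 scale0r.
by rewrite /GaGm_odd odd_dir_z scale1r.
Qed.

Lemma Gm_odd_ptE (R : superalg K) (h := odd_lie_pt (Gm_odd_lie d) R) :
  (h (ext_in cot) = 1) * (h (ext_z _) = sext_eps R).
Proof.
split; apply: sext_eq; rewrite /h odd_lie_ptE /=.
- by rewrite /counit [gone _ _ _](Gms_oneE _).1 scale1r.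
- by rewrite /Gm_odd /odd_dir (linear0 (aug _)) scale0r.
- by rewrite /counit [gone _ _ _](Gms_oneE _).2 scale0r.
by rewrite /Gm_odd odd_dir_z scale1r.
Qed.

(** The coordinate z vanishes on points of G_ev, so every twist in the conjugation disappears and
    all three coordinates of 1 + v e are preserved. *)
Lemma GaGm_ad_fixed : ad_fixed (GaGm_GaGm_super c d) (@GaGm_odd K c d).
Proof.
apply: (ad_fixed_pt (hv := GaGm_odd_lie c d)) => [//||R g].
  exact: GaGm_super_comul.
set p : shom _ R := on_points _ g; have pz : p (ext_z _) = 0.
  by rewrite /p /on_points shom_compE GaGm_comor_proj linear0.
move: p pz => p pz; apply: amz_pt_ext; rewrite !GaGm_super_mulE !GaGm_odd_ptE
  !shom_compE !GaGm_super_invE pz oppr0 !rmorph0.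
- by rewrite mul0r mulr0 !scaler0 !addr0 rmorphN addNr.
- rewrite ufactor0 ufactor0l !mulr1 -rmorphM GaGms_VV; exact: rmorph1.
by rewrite add0r addr0.
Qed.

Lemma Gm_ad_fixed : ad_fixed (Gm_Gm_super d) (@Gm_odd K d).
Proof.
apply: (ad_fixed_pt (hv := Gm_odd_lie d)) => [//||R g].
  exact: Gm_super_comul.
set p : shom _ R := on_points _ g; have pz : p (ext_z _) = 0.
  by rewrite /p /on_points shom_compE Gm_comor_proj linear0.
move: p pz => p pz; apply: mz_pt_ext; rewrite !Gm_super_mulE !Gm_odd_ptE
  !shom_compE !Gm_super_invE pz oppr0 !rmorph0.
- rewrite ufactor0 ufactor0l !mulr1 -rmorphM Gms_VV; exact: rmorph1.
by rewrite add0r addr0.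
Qed.

End Sections.

(** * The bracket [v, v] = 2 w *)

Section Brackets.
Variables (K : fieldType) (x : Ga K -> K) (y : Gm K -> K) (alpha beta : K).
Hypotheses (hx : is_lie x) (hy : is_lie y).
Local Notation c := (alpha * x coT).
Local Notation d := (beta * y cot).
Local Notation S1 := (sext_superalg (base_superalg K)).

Lemma lie_w_lie : is_lie (lie_w x y alpha beta).
Proof. by apply: lie_add; apply/lie_scale/lie_map_lie. Qed.

(** T restricts to 0 on the multiplicative factor, so only x contributes; in [lie_w_t], t restricts
    to 1 on the additive factor and derivations kill constants. *)
Lemma lie_w_T : lie_w x y alpha beta coT2 = c.
Proof.
rewrite /lie_w /lie_map [comor (Ga_GaGm K) _](am_ptE (R := Ga K) _ _ _ _).1.1.
rewrite [comor (Gm_GaGm K) _](am_ptE (R := Gm K) _ _ _ _).1.1.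
by rewrite (lie0 hy) mulr0 addr0.
Qed.

Lemma lie_w_t : lie_w x y alpha beta cot2 = d.
Proof. 
rewrite /lie_w /lie_map [comor (Ga_GaGm K) _](am_ptE (R := Ga K) _ _ _ _).1.2.
rewrite [comor (Gm_GaGm K) _](am_ptE (R := Gm K) _ _ _ _).1.2.
by rewrite (lie1 hx) mulr0 add0r.
 Qed.

Lemma even_lie_map_odd (E G : supergroup K) (i : sghom E G) (w : E -> K) :
  even_superalg E -> is_lie w ->
  forall a, homog (sa_gr G) true a -> lie_map i w a = 0.
Proof.
move=> Eev hw a ha; rewrite /lie_map.
by rewrite -(shom_homog (comor i) ha) (Eev _) lie0.
Qed.

Lemma scale_e12 (k : K) :
  k *: (sext_in S1 (sext_eps (base_superalg K)) * sext_eps S1) =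
  (0, ((0, k) : sext (base_superalg K))) :> sext S1.
Proof.
rewrite sext_in_eps; apply: sext_eq; first exact: scaler0.
by apply: sext_eq; [exact: scaler0 | exact: mulr1].
Qed.

(** The product (1 + v e1)(1 + v e2) has coordinates T = c e1 e2, t = 1 + d e1 e2 and z = e1 + e2.
    This is where the constants c and d of the group law are matched with the values of w at T and
    t. *)
Lemma GaGm_lie_product (wo : forall a, homog _ true a -> _) :
  gmul (shom_comp (sext_in S1) (odd_lie_pt (GaGm_odd_lie c d) (base_superalg K)))
    (odd_lie_pt (GaGm_odd_lie c d) S1) =
  lie_product_pt (GaGm_odd_lie c d)
    (lie_map_lie (ev_incl x y alpha beta) lie_w_lie) wo.
Proof.
have comor_in (b : monoid_alg K (nat * int)%type) :
  comor (ev_incl x y alpha beta) (ext_in b) = b by rewrite GaGm_comor_proj.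
have comor_z : comor (ev_incl x y alpha beta) (ext_z _) = 0.
  by rewrite GaGm_comor_proj.
have v0 b : @GaGm_odd K c d (ext_in b) = 0 by rewrite /GaGm_odd /odd_dir linear0.
have [[e1 e2] e3] := GaGms_oneE (base_superalg K).
apply: amz_pt_ext; rewrite !GaGm_super_mulE !shom_compE !GaGm_odd_ptE;
  rewrite -[RHS]/(lie_product_fun _ _ _) /lie_product_fun
    ?v0 /lie_map ?comor_in ?comor_z ?(lie0 lie_w_lie) ?lie_w_T ?lie_w_t.
- rewrite rmorph0 !add0r scale_e12 /counit [gone _ _ _]e1.
  by [].
- rewrite rmorph1 !mul1r /ufactor scale_e12 /counit [gone _ _ _]e2.
  by apply: sext_eq; apply: sext_eq; rewrite /= ?addr0 ?add0r.
rewrite /counit [gone _ _ _]e3 /GaGm_odd odd_dir_z.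
by apply: sext_eq; apply: sext_eq; rewrite /= ?addr0 ?add0r.
Qed.

Lemma GaGm_hc : hc_pair_trivial_line (ev_incl x y alpha beta)
        (fun a => 2%:R * lie_w x y alpha beta a).
Proof.
split=> //; first exact: GaGm_is_ev.
exists (@GaGm_odd K c d); split.
- exact: GaGm_odd_lie.
- exists (ext_z _); rewrite /GaGm_odd odd_dir_z; exact/eqP/oner_neq0.
- by apply: odd_dir_uniq; exact: GaGm_super_one_aug.
- exact: GaGm_ad_fixed.
move=> a; have wo := even_lie_map_odd (ev_incl x y alpha beta)
  (fun _ => erefl) lie_w_lie.
apply: (odd_bracket_pt _ (GaGm_lie_product wo)).
exact: GaGm_super_comul.
Qed.

Let w b := beta * y b.

Lemma Gm_w_lie : is_lie w.
Proof. exact: lie_scale. Qed.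

Lemma Gm_lie_product (wo : forall a, homog _ true a -> _) :
  gmul (shom_comp (sext_in S1) (odd_lie_pt (Gm_odd_lie d) (base_superalg K)))
    (odd_lie_pt (Gm_odd_lie d) S1) =
  lie_product_pt (Gm_odd_lie d) (lie_map_lie (Gm_ev_incl y beta) Gm_w_lie) wo.
Proof.
have comor_in (b : monoid_alg K int) : comor (Gm_ev_incl y beta) (ext_in b) = b.
  by rewrite Gm_comor_proj.
have comor_z : comor (Gm_ev_incl y beta) (ext_z _) = 0 by rewrite Gm_comor_proj.
have v0 b : @Gm_odd K d (ext_in b) = 0 by rewrite /Gm_odd /odd_dir linear0.
have [e2 e3] := Gms_oneE (base_superalg K).
apply: mz_pt_ext; rewrite !Gm_super_mulE !shom_compE !Gm_odd_ptE;
  rewrite -[RHS]/(lie_product_fun _ _ _) /lie_product_fun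
    ?v0 /lie_map ?comor_in ?comor_z ?(lie0 Gm_w_lie).
- rewrite rmorph1 !mul1r /ufactor scale_e12 /counit [gone _ _ _]e2.
  by apply: sext_eq; apply: sext_eq; rewrite /= ?addr0 ?add0r.
rewrite /counit [gone _ _ _]e3 /Gm_odd odd_dir_z.
by apply: sext_eq; apply: sext_eq; rewrite /= ?addr0 ?add0r.
Qed.

Lemma Gm_hc :
  hc_pair_trivial_line (Gm_ev_incl y beta) (fun b => 2%:R * (beta * y b)).
Proof.
split=> //; first exact: Gm_is_ev.
exists (@Gm_odd K d); split.
- exact: Gm_odd_lie.
- exists (ext_z _); rewrite /Gm_odd odd_dir_z; exact/eqP/oner_neq0.
- by apply: odd_dir_uniq; exact: Gm_super_one_aug.
- exact: Gm_ad_fixed.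
move=> a; have wo := even_lie_map_odd (Gm_ev_incl y beta) (fun _ => erefl) Gm_w_lie.
apply: (odd_bracket_pt _ (Gm_lie_product wo)).
exact: Gm_super_comul.
Qed.

End Brackets.

(** * The quotient by the additive group *)

Section Quotient.
Variables (K : fieldType) (c d : K).
Local Notation GG := (GaGm_super c d).
Local Notation HH := (Gm_super d).
Local Notation i := (Ga_GaGm_super c d).
Local Notation q := (GaGm_Gm_super c d).

Lemma Ga_incl_comorE : (comor i (ext_in coT2) = coT) *
  (comor i (ext_in cot2) = 1) * (comor i (ext_in cotV2) = 1) *
  (comor i (ext_z _) = 0).
Proof. exact: (amz_ptE (R := Ga K)). Qed.

Lemma quot_comorE : (comor q (ext_in cot) = ext_in cot2) *
  (comor q (ext_in cotV) = ext_in cotV2) * (comor q (ext_z _) = ext_z _).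
Proof. exact: (mz_ptE (R := GG)). Qed.

(* the comorphism of the projection of superspaces G -> G_a *)
Definition Ga_section : shom (Ga K) GG :=
  a_pt (R := GG) (even_ext_in (shom_id GG) coT2).

Lemma Ga_sectionE : Ga_section coT = ext_in coT2.
Proof. exact: a_ptE. Qed.

Lemma Ga_sectionK b : comor i (Ga_section b) = b.
Proof.
rewrite -[LHS]/(shom_comp (comor i) Ga_section b) -[RHS]/(shom_id (Ga K) b).
congr (shom_fun _ b); apply: a_pt_ext.
by rewrite shom_compE Ga_sectionE Ga_incl_comorE.
Qed.

Lemma Ga_closed_embedding : closed_embedding i.
Proof. by move=> b; exists (Ga_section b); exact: Ga_sectionK. Qed.

Lemma Ga_ptE (R : superalg K) (n : shom (Ga K) R) :
  (on_points i n (ext_in coT2) = n coT) * (on_points i n (ext_in cot2) = 1) *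
  (on_points i n (ext_z _) = 0).
Proof. by rewrite /on_points !shom_compE !Ga_incl_comorE rmorph1 rmorph0. Qed.

Lemma Ga_central : central_image i.
Proof.
move=> R g n; apply: amz_pt_ext; rewrite !GaGm_super_mulE !Ga_ptE.
- by rewrite mulr0 mul0r !scaler0 !addr0 addrC.
- by rewrite ufactor0 ufactor0l mulr1 mul1r.
by rewrite addr0 add0r.
Qed.

(** Sets T = 0. As an algebra map it retracts [comor q] for every c; when c = 0 it also respects
    products and becomes the section of the quotient morphism. *)
Definition quot_retraction : shom GG HH :=
  amz_pt (R := HH) (ev0 HH) (even_ext_in (shom_id HH) cot)
    (even_ext_in (shom_id HH) cotV) (odd_ext_z (shom_id HH)) (mz_ptV (shom_id HH)).

Lemma quot_retractionE : (quot_retraction (ext_in coT2) = 0) *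
  (quot_retraction (ext_in cot2) = ext_in cot) *
  (quot_retraction (ext_in cotV2) = ext_in cotV) *
  (quot_retraction (ext_z _) = ext_z _).
Proof. exact: (amz_ptE (R := HH)). Qed.

Lemma quot_retractionK : cancel (comor q) quot_retraction.
Proof.
move=> b; rewrite -[LHS]/(shom_comp quot_retraction (comor q) b).
rewrite -[RHS]/(shom_id HH b); congr (shom_fun _ b).
by apply: mz_pt_ext; rewrite shom_compE !quot_comorE !quot_retractionE.
Qed.

Lemma in_ideal_comb (A : nzRingType) (S : A -> Prop) u v a b :
  in_ideal S a -> in_ideal S b -> in_ideal S (u * a + v * b).
Proof.
move=> [s hs ->] [t ht ->].
exists ([seq (u * p.1, p.2) | p <- s] ++ [seq (v * p.1, p.2) | p <- t]).
  by move=> p; rewrite mem_cat => /orP[] /mapP[p' hp' ->] /=; [exact: hs|exact: ht].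
rewrite big_cat !big_map /= !big_distrr /=.
by congr (_ + _); apply: eq_bigr => p _; rewrite mulrA.
Qed.

Lemma in_ideal_gen (A : nzRingType) (S : A -> Prop) a : S a -> in_ideal S a.
Proof.
move=> Sa; exists [:: (1, a)]; last by rewrite big_seq1 mul1r.
by move=> p; rewrite inE => /eqP ->.
Qed.

Lemma mulB_mul (A : nzRingType) (a b x y : A) :
  a * b - x * y = (a - x) * y + a * (b - y).
Proof. by rewrite mulrBl mulrBr [RHS]addrC addrA subrK. Qed.

Lemma counitB1 (G : supergroup K) (a : G) : counit a = 1 -> counit (a - 1) = 0.
Proof. by move=> ha; rewrite addrC -scaleN1r counitP counit1 ha mulr1 addNr. Qed.

(** Modulo the ideal, every a equals its restriction to G_a read back through [Ga_section]: T is
    unchanged, while t - 1, 1/t - 1 and z come from elements of counit 0. So a vanishing on G_a lies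
    in the ideal. Conversely the composite of [i] and [q] is trivial. *)
Lemma Ga_quotient : is_quotient i q.
Proof.
split; first exact: can_inj quot_retractionK.
set I := in_ideal _.
have I0 : I 0 by exists [::]; rewrite ?big_nil.
have key a : I (a - Ga_section (comor i a)).
  pose f := shom_comp Ga_section (comor i); rewrite -[Ga_section _]/(f a).
  have gen b : counit b = 0 -> I (comor q b).
    by move=> hb; apply: in_ideal_gen; exists b.
  move: a; apply: (ext_gen_ind (@pair_gen K)).
  - by rewrite rmorph1 subrr.
  - move=> k a b Ia Ib; rewrite linearP opprD addrACA -scalerBr.
    by rewrite -[X in _ + X]mul1r -mulr_algl; exact: in_ideal_comb.
  - move=> a b Ia Ib; rewrite rmorphM.
    have -> : a * b - f a * f b = f b * (a - f a) + a * (b - f b).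
      (* The ideal is built from left multiples, so the factor f b must be moved to the left; it is
         even, hence central, because K[G_a] is purely even. *)
      have -> : f b * (a - f a) = (a - f a) * f b.
        apply: even_central.
        exact: (@shom_homog _ _ _ Ga_section false _ erefl).
      exact: mulB_mul.
    exact: in_ideal_comb.
  - move=> a; rewrite !inE => /or3P[] /eqP ->.
    + by rewrite /f shom_compE Ga_incl_comorE Ga_sectionE subrr.
    + rewrite /f shom_compE Ga_incl_comorE rmorph1 -quot_comorE -(rmorph1 (comor q)).
      rewrite -rmorphB; apply: gen; rewrite counitB1 //.
      by rewrite /counit [gone _ _ _](Gms_oneE _).1.
    rewrite /f shom_compE Ga_incl_comorE rmorph1 -quot_comorE -(rmorph1 (comor q)).
    rewrite -rmorphB; apply: gen; rewrite counitB1 //.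
    exact: (mz_ptE (R := base_superalg K) _ _ _ _).1.2.
  rewrite /f shom_compE Ga_incl_comorE rmorph0 subr0 -quot_comorE; apply: gen.
  by rewrite /counit [gone _ _ _](Gms_oneE _).2.
split=> [ia|[s hs ->]].
  by have := key a; rewrite ia rmorph0 subr0.
have iq b : comor i (comor q b) = (counit b)%:A.
  rewrite -counitE -[LHS]/(shom_comp (comor i) (comor q) b); congr (shom_fun _ b).
  apply: mz_pt_ext; rewrite shom_compE !quot_comorE !Ga_incl_comorE;
  by rewrite [RHS]mz_ptE.
rewrite linear_sum big_seq big1 // => p /hs [b hb e2].
have ip : comor i p.2 = 0 by rewrite e2 iq hb scale0r.
apply: etrans (rmorphM (comor i) _ _) _.
exact: etrans (congr1 ( *%R _) ip) (mulr0 _).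
Qed.

End Quotient.

(** * Splitting *)

Section Coefficients.
Variables (K : fieldType) (M : nmodType).

Definition coef (n : M) (a : monoid_alg K M) : K^o := (a : {malg K[M]})@_n.

Lemma coef_linear n : linear (coef n).
Proof. by move=> k a b; rewrite /coef mcoeffD mcoeffZ. Qed.

HB.instance Definition _ n :=
  GRing.isLinear.Build K (monoid_alg K M) K^o *:%R (coef n) (coef_linear n).

Lemma coef_mon n m : coef n (mon K m) = (m == n)%:R.
Proof. by rewrite /coef mcoeff_mon. Qed.

Lemma coef_eq0 (a : monoid_alg K M) : (forall n, coef n a = 0) -> a = 0.
Proof. by move=> h; apply/malgP => n; rewrite mcoeff0; exact: h. Qed.

End Coefficients.

(** There is no nonzero morphism from G_m to G_a. The coefficient of t^n (x) t^n gives f_n = 0 when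
    n is nonzero, and f_0 = f_0 + f_0 when n = 0. *)
Lemma int_alg_additive0 (K : fieldType) (f : monoid_alg K int) :
  linext (fun m => mon K (m, m)) f =
    linext (fun m => mon K (m, 0)) f + linext (fun m => mon K (0, m)) f
    :> monoid_alg K (int * int)%type ->
  f = 0.
Proof.
move=> E; apply: coef_eq0 => n.
have coef_linext (F : int -> monoid_alg K (int * int)%type) b a :
    (forall m, coef (n, n) (F m) = b%:R * coef n (mon K m)) ->
    coef (n, n) (linext F a) = b%:R * coef n a.
  move=> hF; move: a; apply: (monalg_ext (V := K^o)) => [k a b'|k a b'|m].
  - by rewrite !linearP.
  - by rewrite linearP mulrDr scalerAr.
  by rewrite linext_mon.
have cleft : coef (n, n) (linext (fun m => mon K (m, 0)) f) = (n == 0)%:R * coef n f.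
  apply: coef_linext => m.
  by rewrite !coef_mon -pair_eqE /= -natrM mulnb andbC (eq_sym n).
have cright : coef (n, n) (linext (fun m => mon K (0, m)) f) = (n == 0)%:R * coef n f.
  by apply: coef_linext => m; rewrite !coef_mon -pair_eqE /= -natrM mulnb (eq_sym n).
have cdiag : coef (n, n) (linext (fun m => mon K (m, m)) f) = true%:R * coef n f.
  by apply: coef_linext => m; rewrite !coef_mon -pair_eqE /= andbb mul1r.
move/(congr1 (coef (n, n))): E; rewrite linearD /= cdiag cleft cright mul1r.
case: eqP => _; last by rewrite !mul0r addr0.
by rewrite !mul1r => /eqP; rewrite -subr_eq subrr eq_sym => /eqP.
Qed.

Section Splitting.
Variables (K : fieldType) (c d : K).
Local Notation GG := (GaGm_super c d).
Local Notation HH := (Gm_super d).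
Local Notation q := (GaGm_Gm_super c d).
Local Notation S1 := (sext_superalg (base_superalg K)).

Lemma split_of_eq0 : c = 0 -> splits q.
Proof.
move=> c0; have sM (R : superalg K) (g h : shom HH R) :
    shom_comp (gmul g h) (quot_retraction c d) =
    gmul (s := GG) (shom_comp g (quot_retraction c d))
      (shom_comp h (quot_retraction c d)).
  apply: amz_pt_ext; rewrite GaGm_super_mulE !shom_compE !quot_retractionE.
  - by rewrite !rmorph0 c0 scale0r !addr0.
  - by rewrite Gm_super_mulE.
  by rewrite Gm_super_mulE.
exists (SGHom sM) => R g.
rewrite -[on_points (SGHom sM) g]/(shom_comp g (quot_retraction c d)).
by apply: mz_pt_ext; rewrite /on_points !shom_compE quot_comorE quot_retractionE.
Qed.

Lemma split_eq0 : splits q -> c = 0.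
Proof.
move=> [s hs]; set f := comor s (ext_in coT2).
have fM (R : superalg K) (g h : shom HH R) :
    gmul g h f = g f + h f + c *: (g (ext_z _) * h (ext_z _)).
  (* The quotient morphism preserves the coordinate z, so any section preserves it too. *)
  have sz : comor s (ext_z _) = ext_z _.
    have := congr1 (fun f => shom_fun f (ext_z _)) (hs _ (shom_id HH)).
    by rewrite /on_points !shom_compE quot_comorE.
  have := congr1 (fun f => shom_fun f (ext_in coT2)) (comor_mul s g h).
  by rewrite GaGm_super_mulE !shom_compE sz.
have f0 : f = 0.
  have [f1 ef] : exists f1, f = ext_in f1.
    exists (f : extalg _).1; apply: ext_eq => //.
    by have /ext_homogP := even_ext_in (comor s) coT2.
  (* The universal pair of points with z = z' = 0: [left] and [right] are the two inclusions into
     K[t, 1/t] (x) K[t, 1/t], and their product [delta] is the diagonal t to t (x) t. *)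
  pose R := evenalg (monoid_alg K (int * int)%type).
  pose delta := @CharPt K int R (fun m => mon K (m, m)) erefl
    (fun m n => esym (monM K (m, m) (n, n))) (fun _ => erefl).
  pose left := @CharPt K int R (fun m => mon K (m, 0)) erefl
    (fun m n => esym (monM K (m, 0) (n, 0))) (fun _ => erefl).
  pose right := @CharPt K int R (fun m => mon K (0, m)) erefl
    (fun m n => esym (monM K (0, m) (0, n))) (fun _ => erefl).
  have ptE (x : char_pt int R) (a : monoid_alg K int) :
    ext_pt x (od0 R) (ext_in a) = linext x a.
    by rewrite [LHS]/(ext_fun _ _ _) /ext_fun mulr0 addr0.
  have mul_lr : gmul (ext_pt left (od0 R) : shom HH R) (ext_pt right (od0 R)) =
      ext_pt delta (od0 R).
    apply: mz_pt_ext; rewrite Gm_super_mulE !ext_pt_z ?addr0 //.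
    by rewrite !ext_ptE ufactor0 mulr1; exact: monM.
  have := fM R (ext_pt left (od0 R)) (ext_pt right (od0 R)).
  rewrite ef mul_lr !ptE !ext_pt_z mulr0 scaler0 addr0 => /int_alg_additive0 ->.
  by [].
(* With f = 0 the relation reads c z z' = 0; at the points 1 + v e1 and 1 + v e2 the product z z' is
   e1 e2, which is nonzero. *)
have := fM _ (shom_comp (sext_in S1) (odd_lie_pt (Gm_odd_lie d) (base_superalg K)))
  (odd_lie_pt (Gm_odd_lie d) S1).
rewrite f0 !rmorph0 !add0r shom_compE !Gm_odd_ptE scale_e12.
by move=> /(congr1 (fun u : sext S1 => (u.2 : sext (base_superalg K)).2)).
Qed.

End Splitting.

(** * Supermodules and unipotency *)

Lemma linear_combE (K : fieldType) (U W : lmodType K) (f : U -> W) (I : Type)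
  (r : seq I) (k : I -> K) (x : I -> U) : linear f ->
  f (\sum_(i <- r) k i *: x i) = \sum_(i <- r) k i *: f (x i).
Proof.
move=> fl; pose F := GRing.isLinear.Build K U W *:%R f fl.
pose f' : {linear U -> W} := HB.pack f F.
rewrite -[f _]/(f' _) linear_sum; apply: eq_bigr => i _.
by rewrite linearZ.
Qed.

Section Comodules.
Variables (K : fieldType) (G : supergroup K) (V : supermodule G).
Implicit Types u v w : V.

Section Bilinear.
Variables (X : lmodType K) (b : V -> G -> X).
Hypotheses (br : forall v, linear (b v)) (bl : forall a, linear (b^~ a)).

(** A coaction is a formal sum determined only up to [tensor_eq]; what can be used of it are its
    images under bilinear maps, and these depend linearly on v. *)
Lemma coact_sum_linear : linear (fun v => \sum_(p <- coact v) b p.1 p.2).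
Proof.
move=> k u v; rewrite (coact_linear k u v br bl) big_cat big_map /= scaler_sumr.
congr (_ + _); apply: eq_bigr => p _.
have := bl p.2 k p.1 0; rewrite addr0 /= => ->.
(* Linearity at the scalar -1 and two zero vectors yields the value 0 at 0; the same device recurs
   below. *)
by have := bl p.2 (-1) 0 0; rewrite scaleN1r oppr0 addr0 scaleN1r addNr => ->;
  rewrite addr0.
Qed.

End Bilinear.

Lemma homog_ss0 i : homog (ss_gr V) i (0 : V).
Proof.
have := odd_part_linear (ss_gr V) (-1) 0 0.
by rewrite scaleN1r oppr0 addr0 scaleN1r addNr /homog => ->; case: i.
Qed.

Lemma homog_ssP i k u v : homog (ss_gr V) i u -> homog (ss_gr V) i v ->
  homog (ss_gr V) i (k *: u + v).
Proof.
rewrite /homog => hu hv; rewrite odd_part_linear hu hv.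
by case: i {hu hv}; rewrite // scaler0 addr0.
Qed.

Lemma homog_nonzero : (exists v : V, v <> 0) ->
  exists i v, v != 0 /\ homog (ss_gr V) i v.
Proof.
move=> [v /eqP v0]; case: (eqVneq (ss_gr V v) 0) => [e|h].
  by exists false, v; split.
by exists true, (ss_gr V v); split=> //; exact: odd_partK.
Qed.

(** A fixed homogeneous vector spans a graded subcomodule, which simplicity forces to be
    everything. *)
Lemma simple_fixed i u : simple_supermodule V -> u != 0 ->
  homog (ss_gr V) i u -> tensor_eq (coact u) [:: (u, 1)] -> trivial_line V.
Proof.
move=> [_ simpleV] u0 hu cu; pose W w := exists k : K, w = k *: u.
have cW k : tensor_eq (coact (k *: u)) [:: (k *: u, 1)].
  move=> X b br bl; have := coact_sum_linear br bl k u 0.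
  rewrite addr0 cu // !big_seq1 /= => ->.
  have := coact_sum_linear br bl (-1) 0 0.
  rewrite scaleN1r oppr0 addr0 scaleN1r addNr => ->.
  have := bl 1 k u 0; rewrite addr0 /= => ->; congr (_ + _).
  by have := bl 1 (-1) 0 0; rewrite scaleN1r oppr0 addr0 scaleN1r addNr.
have subW : subsupermodule W.
  split.
  - by exists 0; rewrite scale0r.
  - by move=> k _ _ [l ->] [m ->]; exists (k * l + m); rewrite scalerDl scalerA.
  - move=> _ [k ->]; have := homog_ssP k hu (homog_ss0 i).
    rewrite addr0 /homog => ->; case: (i); first by exists k.
    by exists 0; rewrite scale0r.
  move=> _ [k ->]; exists [:: (k *: u, 1)] => // p; rewrite inE => /eqP -> /=.
  by exists k.
case: (simpleV W subW) => [W0|allW].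
  by move/eqP: u0; case; apply: W0; exists 1; rewrite scale1r.
by split=> [|w]; [exists u => //; exact/eqP | have [k ->] := allW w].
Qed.

End Comodules.

Section Pullback.
Variables (K : fieldType) (G H : supergroup K) (f : sghom G H).
Variable V : supermodule H.

Definition pull_coact (v : V) : seq (V * G) :=
  [seq (p.1, comor f p.2) | p <- coact v].

Lemma pull_tensor (s t : seq (V * H)) : tensor_eq s t ->
  tensor_eq [seq (p.1, comor f p.2) | p <- s] [seq (p.1, comor f p.2) | p <- t].
Proof.
move=> st X b br bl; rewrite !big_map /=.
apply: (st X (fun v a => b v (comor f a))) => [v k a a'|a k u v] /=.
  by rewrite linearP br.
exact: bl.
Qed.

Lemma pull_coact_linear k u v : tensor_eq (pull_coact (k *: u + v))
  ([seq (k *: p.1, p.2) | p <- pull_coact u] ++ pull_coact v).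
Proof.
have := pull_tensor (coact_linear k u v).
by rewrite map_cat -!map_comp.
Qed.

Lemma pull_counit v : \sum_(p <- pull_coact v) counit p.2 *: p.1 = v.
Proof.
rewrite big_map /= -[RHS]coact_counit.
by apply: eq_bigr => p _; rewrite counit_comor.
Qed.

Lemma pull_mul (R : superalg K) (g h : shom G R) v : @tensor_eq K V R
  [seq (p.1, gmul g h p.2) | p <- pull_coact v]
  [seq (q.1, g q.2 * h p.2) | p <- pull_coact v, q <- pull_coact p.1].
Proof.
move=> X b br bl; rewrite big_allpairs_dep !big_map /=.
have := coact_mul (shom_comp g (comor f)) (shom_comp h (comor f)) v br bl.
rewrite big_allpairs_dep big_map /= -comor_mul => ->.
by apply: eq_bigr => p _; rewrite big_map.
Qed.

Lemma pull_even i v : homog (ss_gr V) i v ->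
  exists2 s, tensor_eq (pull_coact v) s &
    forall p, p \in s -> exists j,
      homog (ss_gr V) j p.1 /\ homog (sa_gr G) (i (+) j) p.2.
Proof.
move=> /coact_even[s vs hs]; exists [seq (p.1, comor f p.2) | p <- s].
  exact: pull_tensor.
move=> _ /mapP[p /hs[j [h1 h2]] ->]; exists j; split=> //=.
exact: shom_homog.
Qed.

Definition pullback : supermodule G :=
  Supermodule pull_coact_linear pull_counit pull_mul pull_even.

(** A linear retraction of the comorphism recovers the original tensor from its pullback;
    multiplicativity of r plays no part in a statement about coactions. *)
Lemma pull_retract (r : G -> H) : linear r -> cancel (comor f) r ->
  forall (s : seq (V * H)) (t : seq (V * G)),
  tensor_eq [seq (p.1, comor f p.2) | p <- s] t ->
  tensor_eq s [seq (p.1, r p.2) | p <- t].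
Proof.
move=> rl rK s t st X b br bl; rewrite big_map /=.
have := st X (fun v a => b v (r a)); rewrite big_map /= => <-.
- by apply: eq_bigr => p _; rewrite rK.
- by move=> v k a a'; rewrite rl br.
by move=> a; exact: bl.
Qed.

End Pullback.

(** Since r recovers the H-coaction, subsupermodules of the pullback are subsupermodules of V, so
    simplicity passes to the pullback and triviality comes back. *)
Lemma unipotent_quotient (K : fieldType) (G H : supergroup K) (f : sghom G H)
  (r : G -> H) : linear r -> cancel (comor f) r -> unipotent G -> unipotent H.
Proof.
move=> rl rK unG V [V0 simpleV]; have [|line fixed] := unG (pullback f V).
  split=> // W [W0 Wl Wgr Wco]; apply: simpleV; split=> // v /Wco[s vs Ws].
  exists [seq (p.1, r p.2) | p <- s]; first exact: (pull_retract rl rK vs).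
  by move=> _ /mapP[p /Ws Wp ->].
split=> // u; have := pull_retract rl rK (fixed u).
by rewrite /= -[in r 1](rmorph1 (comor f)) rK.
Qed.

(* B_k is a basis of K[G] with dual basis l_k; the points g and h of R stand for
   the two tensor factors, and E k applies l_k to the second one. The fourth
   hypothesis says that (id (x) l_k) Delta B_j is 0 for j < k and 1 for j = k.
   Hence, if k is the largest index such that v_k = sum l_k(v_(1)) v_(0) <> 0,
   then v_k is fixed. *)
Lemma unipotent_criterion (K : fieldType) (G : supergroup K) (R : superalg K)
  (g h : shom G R) (E : nat -> {linear R -> G}) (l : nat -> {linear G -> K^o})
  (B : nat -> G) (par : nat -> bool) :
  (forall a, exists n, forall k, (n <= k)%N -> l k a = 0) ->
  (forall a, (forall k, l k a = 0) -> a = 0) ->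
  (forall i j, l i (B j) = (i == j)%:R) ->
  (forall k a b, E k (g a * h b) = l k b *: a) ->
  (forall k j, (j <= k)%N -> E k (gmul g h (B j)) = ((j == k)%:R : K)%:A) ->
  l 0%N =1 @counit K G ->
  (forall j i a, homog (sa_gr G) i a -> i != par j -> l j a = 0) ->
  unipotent G.
Proof.
move=> l_fin l_inj lBd Egh mul_coef l0 l_even V simpleV.
have [i [v [v0 hv]]] := homog_nonzero simpleV.1.
pose c k (u : V) := \sum_(p <- coact u) l k p.2 *: p.1.
have [n hn] : exists n, forall p k, p \in coact v -> (n <= k)%N -> l k p.2 = 0.
  elim: (coact v) => [|p s [n IHn]]; first by exists 0%N.
  have [m hm] := l_fin p.2; exists (maxn n m) => q k; rewrite geq_max inE.
  by move=> /predU1P[->|qs] /andP[nk mk]; [exact: hm | exact: IHn].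
have expand a : (forall k, (n <= k)%N -> l k a = 0) ->
    a = \sum_(j < n) l j a *: B j.
  move=> ha; apply/eqP; rewrite -subr_eq0; apply/eqP/l_inj => k.
  rewrite linearB linear_sum /=; apply/eqP; rewrite subr_eq0; apply/eqP.
  under eq_bigr => j _ do rewrite linearZ /= lBd.
  case: (ltnP k n) => [kn|nk].
    rewrite (bigD1 (Ordinal kn)) //= eqxx big1 ?addr0; first exact/esym/mulr1.
    move=> j jk; rewrite (_ : (k == j :> nat) = false) ?scaler0 // eq_sym.
    exact/negbTE.
  rewrite ha // big1 // => j _; case: eqP => [e|_]; last exact: scaler0.
  by have := ltn_ord j; rewrite -e ltnNge nk.
have cn k : (n <= k)%N -> c k v = 0.
  by move=> nk; rewrite /c big_seq big1 // => p /hn -> //; rewrite scale0r.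
have c0 : c 0%N v = v.
  by rewrite -[RHS]coact_counit; apply: eq_bigr => p _; rewrite l0.
(* Index 0 is the counit, which returns v itself, so a largest k with c k v nonzero exists. *)
have exk : exists k, c k v != 0 by exists 0%N; rewrite c0.
have ubk k : c k v != 0 -> (k <= n)%N.
  by apply: contraR; rewrite -ltnNge => /ltnW /cn ->.
case: (ex_maxnP exk ubk) => k ck maxk.
have kn : (k < n)%N.
  by rewrite ltnNge; apply: contra_neqN ck => /cn.
have lk_br (w : V) : linear (fun a => l k a *: w).
  by move=> t a b; rewrite linearP scalerDl scalerA.
have lk_bl a : linear (fun w : V => l k a *: w).
  by move=> t u w; rewrite scalerDr !scalerA mulrC.
(* The functional l_k sees only elements of parity [par k], so c k v is homogeneous. *)
apply: (simple_fixed (i := i (+) par k) simpleV ck).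
  have [s vs hs] := coact_even hv; rewrite /c (vs V (fun w a => l k a *: w)) //.
  rewrite big_seq; elim/big_ind: _ => [|u w hu hw|p /hs[j [h1 h2]]].
  - exact: homog_ss0.
  - by rewrite -[u]scale1r; exact: homog_ssP.
  case: (eqVneq (i (+) j) (par k)) => [<-|ne].
    by rewrite addKb -[_ *: _]addr0; apply: homog_ssP => //; exact: homog_ss0.
  by rewrite (l_even _ _ _ h2 ne) scale0r; exact: homog_ss0.
move=> X b br bl; rewrite big_seq1 /=.
have Ebr (w : V) : linear (fun r => b w (E k r)).
  by move=> t r r'; rewrite linearP br.
have := coact_mul g h v Ebr (fun r => bl (E k r)).
rewrite big_allpairs_dep big_map /=.
(* One side of coassociativity: applying l_k to the second factor leaves the coaction on c k v. *)
have -> : \sum_(p <- coact v) \sum_(q <- coact p.1) b q.1 (E k (g q.2 * h p.2)) =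
    \sum_(p <- coact (c k v)) b p.1 p.2.
  rewrite (linear_combE _ _ _ (coact_sum_linear br bl)); apply: eq_bigr => p _.
  rewrite scaler_sumr; apply: eq_bigr => q _; rewrite Egh.
  have := br q.1 (l k p.2) q.2 0; rewrite addr0 => ->.
  have := br q.1 (-1) 0 0; rewrite scaleN1r oppr0 addr0 scaleN1r addNr => ->.
  by rewrite addr0.
move=> <-.
(* The other side, expanded in the basis B_j. Terms with j < k vanish by [mul_coef], those with j >
   k by maximality of k, and j = k contributes c k v (x) 1. *)
transitivity (\sum_(j < n) b (c j v) (E k (gmul g h (B j)))).
  under [RHS]eq_bigr => j _.
    rewrite (linear_combE _ (fun p => l j p.2) (fun p => p.1) (bl _)).
    over.
  rewrite exchange_big /= big_seq [RHS]big_seq; apply: eq_bigr => p pv.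
  rewrite {1}(expand p.2 (fun k => hn p k pv)).
  apply: (linear_combE (f := fun a => b p.1 (E k (gmul g h a)))) => t a a'.
  by rewrite !linearP br.
have b0 a : b 0 a = 0.
  by have := bl a (-1) 0 0; rewrite scaleN1r oppr0 addr0 scaleN1r addNr.
have b0r w : b w 0 = 0.
  by have := br w (-1) 0 0; rewrite scaleN1r oppr0 addr0 scaleN1r addNr.
rewrite (bigD1 (Ordinal kn)) //= big1 ?addr0 => [|j jk].
  by rewrite mul_coef // eqxx scale1r.
case: (leqP j k) => [le|lt].
  by rewrite mul_coef // (_ : (j == k :> nat) = false) ?scale0r ?b0r //; exact/negbTE.
case: (eqVneq (c j v) 0) => [->//|/maxk]; by rewrite leqNgt lt.
Qed.

(* The subgroup t = 1 of G_{1,w} when beta = 0: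
   (a, z) (a', z') = (a + a' + c z z', z + z'). *)
Section GaSuper.
Variables (K : fieldType) (c : K).
Implicit Types R S : superalg K.
Local Notation Ea := (ext_superalg (monoid_alg K nat)).

Section Pt.
Variables (R : superalg K) (a z : R).
Hypotheses (ha : homog (sa_gr R) false a) (hz : homog (sa_gr R) true z).

Definition az_pt : shom Ea R := ext_pt (nat_char ha) hz.

Lemma az_ptE : (az_pt (ext_in coT) = a) * (az_pt (ext_z _) = z).
Proof. by split; rewrite /az_pt ?ext_pt_z ?ext_ptE //= expr1. Qed.

End Pt.

Lemma az_pt_ext R (g h : shom Ea R) : g (ext_in coT) = h (ext_in coT) ->
  g (ext_z _) = h (ext_z _) -> g = h.
Proof.
move=> gh ghz; apply: ext_pt_ext; last exact: ghz.
exact: (@nat_char_uniq _ _ (ext_char g) (ext_char h) gh).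
Qed.

Definition Gas_mul R (g h : shom Ea R) : shom Ea R :=
  az_pt (ev_c c (even_ext_in g coT) (even_ext_in h coT) (odd_ext_z g) (odd_ext_z h))
    (homogD (odd_ext_z g) (odd_ext_z h)).
Definition Gas_one R : shom Ea R := az_pt (ev0 R) (od0 R).
Definition Gas_inv R (g : shom Ea R) : shom Ea R :=
  az_pt (homogN (even_ext_in g coT)) (homogN (odd_ext_z g)).

Lemma Gas_mulE R (g h : shom Ea R) :
  (Gas_mul g h (ext_in coT) = g (ext_in coT) + h (ext_in coT) +
     c *: (g (ext_z _) * h (ext_z _))) *
  (Gas_mul g h (ext_z _) = g (ext_z _) + h (ext_z _)).
Proof. exact: az_ptE. Qed.
Lemma Gas_oneE R : (Gas_one R (ext_in coT) = 0) * (Gas_one R (ext_z _) = 0).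
Proof. exact: az_ptE. Qed.
Lemma Gas_invE R (g : shom Ea R) : (Gas_inv g (ext_in coT) = - g (ext_in coT)) *
  (Gas_inv g (ext_z _) = - g (ext_z _)).
Proof. exact: az_ptE. Qed.

Lemma Gas_mulA R : associative (@Gas_mul R).
Proof.
move=> g h k; apply: az_pt_ext; rewrite !Gas_mulE; last exact: addrA.
rewrite mulrDl mulrDr !scalerDr -!addrA; congr (_ + (_ + _)).
by rewrite [RHS]addrCA; congr (_ + _); rewrite addrC -addrA.
Qed.
Lemma Gas_mul1 R : left_id (Gas_one R) (@Gas_mul R).
Proof.
move=> g; apply: az_pt_ext; rewrite Gas_mulE !Gas_oneE ?add0r //.
by rewrite mul0r scaler0 addr0.
Qed.
Lemma Gas_mulV R : left_inverse (Gas_one R) (@Gas_inv R) (@Gas_mul R).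
Proof.
move=> g; apply: az_pt_ext; rewrite Gas_mulE Gas_oneE !Gas_invE addNr //.
by rewrite add0r mulNr (sa_sqr (odd_ext_z g)) oppr0 scaler0.
Qed.
Lemma Gas_nat R S (f : shom R S) (g h : shom Ea R) :
  shom_comp f (Gas_mul g h) = Gas_mul (shom_comp f g) (shom_comp f h).
Proof.
apply: az_pt_ext; rewrite !(shom_compE, Gas_mulE).
  by rewrite addrC linearP rmorphD rmorphM addrC.
exact: rmorphD.
Qed.

Definition Ga_super : supergroup K :=
  @Supergroup K Ea (fin_gen_ext (@nat_gen K)) Gas_mul Gas_one Gas_inv
    Gas_mulA Gas_mul1 Gas_mulV Gas_nat.

End GaSuper.

(** * Unipotency of the group with coordinates T and z *)

Section Slices.
Variable K : fieldType.
Local Notation A := (monoid_alg K nat).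
Local Notation A2 := (monoid_alg K (nat * nat)%type).

(* the coefficient of T'^N in K[T][T'] *)
Definition slice (N : nat) : A2 -> A :=
  linext (fun m : nat * nat => if m.2 == N then mon K m.1 else 0).
HB.instance Definition _ N := GRing.Linear.on (slice N).

Definition inl_alg : A -> A2 := linext (fun m => mon K (m, 0%N)).
Definition inr_alg : A -> A2 := linext (fun m => mon K (0%N, m)).
HB.instance Definition _ := GRing.Linear.on inl_alg.
HB.instance Definition _ := GRing.Linear.on inr_alg.

Lemma slice_mon N m : slice N (mon K m) = if m.2 == N then mon K m.1 else 0.
Proof. exact: linext_mon. Qed.

Lemma slice_prod N a b : slice N (inl_alg a * inr_alg b) = coef N b *: a.
Proof.
move: a; apply: monalg_ext => [k a a'|k a a'|m].
- by rewrite linearP mulrDl -scalerAl linearP.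
- by rewrite scalerDr !scalerA mulrC.
move: b; apply: monalg_ext => [k b b'|k b b'|n].
- by rewrite linearP mulrDr -scalerAr linearP.
- by rewrite linearP scalerDl scalerA.
rewrite /inl_alg /inr_alg !linext_mon monM slice_mon coef_mon /= addr0 add0r.
by case: eqP; rewrite ?scale1r ?scale0r.
Qed.

Lemma slice_mull N u : slice N (mon K (1%N, 0%N) * u) = mon K 1%N * slice N u.
Proof.
move: u; apply: monalg_ext => [k a a'|k a a'|m].
- by rewrite mulrDr -scalerAr linearP.
- by rewrite linearP mulrDr -scalerAr.
by rewrite monM !slice_mon /= add0r; case: eqP; rewrite ?monM ?mulr0.
Qed.

Lemma slice_mulr N u : slice N.+1 (mon K (0%N, 1%N) * u) = slice N u.
Proof.
move: u; apply: monalg_ext => [k a a'|k a a'|m].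
- by rewrite mulrDr -scalerAr linearP.
- by rewrite linearP.
by rewrite monM !slice_mon /= add0r -[X in X == _]/(m.2.+1) eqSS.
Qed.

(** (T + T')^m has degree m in T' with leading coefficient 1. Asking only for powers T'^N with N at
    least m keeps binomial coefficients out. *)
Lemma slice_exp N m : (m <= N)%N ->
  slice N ((mon K (1%N, 0%N) + mon K (0%N, 1%N)) ^+ m) = (m == N)%:R.
Proof.
elim: m N => [|m IHm] [|N] // lemN; rewrite ?expr0.
- by rewrite -mon0 slice_mon.
- by rewrite -mon0 slice_mon.
set S := _ + _ in IHm *.
have -> : S ^+ m.+1 = mon K (1%N, 0%N) * S ^+ m + mon K (0%N, 1%N) * S ^+ m.
  by rewrite exprS mulrDl.
rewrite [LHS](linearD (slice N.+1)) [X in X + _]slice_mull [X in _ + X]slice_mulr.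
by rewrite (IHm N.+1 (ltnW lemN)) (IHm N lemN) (ltn_eqF lemN) mulr0 add0r.
Qed.

End Slices.

Lemma linext_comp (K : fieldType) (M : choiceType) (U W : lmodType K)
  (F : M -> U) (f : U -> W) a : linear f ->
  linext (fun m => f (F m)) a = f (linext F a).
Proof.
move=> fl; pose H := GRing.isLinear.Build K U W *:%R f fl.
pose f' : {linear U -> W} := HB.pack f H.
rewrite !linextE -[RHS]/(f' _) linear_sum; apply: eq_bigr => i _.
by rewrite linearZ.
Qed.

Section GaSuperUnipotent.
Variables (K : fieldType) (c : K).
Local Notation A := (monoid_alg K nat).
Local Notation A2 := (monoid_alg K (nat * nat)%type).
Local Notation G := (Ga_super c).
Local Notation R1 := (ext_superalg A2).
Local Notation R := (sext_superalg R1).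

Definition left_char : char_pt nat R1 :=
  @CharPt K nat R1 (fun m => ext_in (mon K (m, 0%N))) erefl
    (fun m n => etrans (congr1 (@ext_in K _) (esym (monM K (m, 0%N) (n, 0%N))))
       (ext_inM _ _)) (fun _ => erefl).

Definition right_char : char_pt nat R1 :=
  @CharPt K nat R1 (fun m => ext_in (mon K (0%N, m))) erefl
    (fun m n => etrans (congr1 (@ext_in K _) (esym (monM K (0%N, m) (0%N, n))))
       (ext_inM _ _)) (fun _ => erefl).

(** R is K[G] (x) K[G], namely K[T, T'] with z for the first factor and the adjoined e for z' of the
    second. [left_pt] and [right_pt] are the two inclusions, so their product is Delta. *)
Definition left_pt0 : shom G R1 :=
  ext_pt left_char (erefl : homog (sa_gr R1) true (ext_z A2)).
Definition left_pt : shom G R := shom_comp (sext_in R1) left_pt0.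

Lemma right_char_sext0 : sext_in R1 (right_char 0) = 1.
Proof. by rewrite cp0 rmorph1. Qed.
Lemma right_char_sextD m n : sext_in R1 (right_char (m + n)) =
  sext_in R1 (right_char m) * sext_in R1 (right_char n).
Proof. by rewrite cpD rmorphM. Qed.
Lemma right_char_sext_even m : homog (sa_gr R) false (sext_in R1 (right_char m)).
Proof. exact/shom_homog/cp_even. Qed.

Definition right_pt : shom G R :=
  ext_pt (CharPt right_char_sext0 right_char_sextD right_char_sext_even)
    (sext_eps_odd R1).

Lemma left_pt0E (a : G) : left_pt0 a =
  ((inl_alg (a : extalg A).1, inl_alg (a : extalg A).2) : extalg A2).
Proof.
rewrite [LHS]/(ext_fun _ _ _) /ext_fun !(linext_comp _ _ (@ext_in_linear K _)).
by apply: ext_eq; rewrite /= ?(mulr0, mulr1, addr0, add0r).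
Qed.

Lemma right_ptE (a : G) : right_pt a =
  ((ext_in (inr_alg (a : extalg A).1), ext_in (inr_alg (a : extalg A).2)) : sext R1).
Proof.
have E b : linext (fun m => sext_in R1 (ext_in (mon K (0%N, m)))) b =
    sext_in R1 (ext_in (inr_alg b)).
  rewrite (linext_comp _ _ (linearP (sext_in R1))).
  by rewrite (linext_comp _ _ (@ext_in_linear K _)).
rewrite [LHS]/(ext_fun _ _ _) /ext_fun !E sext_in_eps.
by apply: sext_eq; rewrite /= ?addr0 ?add0r.
Qed.

(** Index 2N stands for T^N and 2N + 1 for T^N z, that is, T has weight 2 and z weight 1. The term c
    (z (x) z) of Delta T then has the weight of T. *)
Definition half_coef (k : nat) (a : G) : K^o :=
  coef k./2 (if odd k then (a : extalg A).2 else (a : extalg A).1).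

Lemma half_coef_linear k : linear (half_coef k).
Proof. by move=> t a b; rewrite /half_coef; case: odd; exact: linearP. Qed.
HB.instance Definition _ k :=
  GRing.isLinear.Build K G K^o *:%R (half_coef k) (half_coef_linear k).

Definition slice_ext (N : nat) (u : R1) : G :=
  (slice N (u : extalg A2).1, slice N (u : extalg A2).2) : extalg A.

Definition half_slice (k : nat) (r : R) : G :=
  slice_ext k./2 (if odd k then (r : sext R1).2 else (r : sext R1).1).

Lemma half_slice_linear k : linear (half_slice k).
Proof.
move=> t a b; rewrite /half_slice; case: odd;
  by apply: ext_eq; rewrite /= linearP.
Qed.
HB.instance Definition _ k :=
  GRing.isLinear.Build K R G *:%R (half_slice k) (half_slice_linear k).

Definition half_basis (k : nat) : G :=
  (if odd k then (0, mon K k./2) else (mon K k./2, 0)) : extalg A.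

Lemma half_slice_prod k (a b : G) :
  half_slice k (left_pt a * right_pt b) = half_coef k b *: a.
Proof.
rewrite /left_pt shom_compE sext_inM right_ptE left_pt0E.
rewrite /half_slice /half_coef; case: odd => /=;
  by apply: ext_eq; rewrite /= ?mulr0 ?add0r ?addr0 slice_prod.
Qed.

Lemma half_coef_basis i j : half_coef i (half_basis j) = (i == j)%:R.
Proof.
rewrite /half_coef /half_basis.
have -> : (i == j) = (odd i == odd j) && (i./2 == j./2).
  apply/eqP/andP => [->//|[/eqP o /eqP h]].
  by rewrite -[i]odd_double_half -[j]odd_double_half o h.
by case: (odd i) (odd j) => [] [] /=; rewrite ?linear0 // coef_mon eq_sym.
Qed.

Lemma coef_bound (a : A) : exists n, forall k, (n <= k)%N -> coef k a = 0.
Proof.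
exists (\max_(m <- msupp a) m).+1 => k hk; apply: mcoeff_outdom.
apply/negP => ka; have := @leq_bigmax_seq _ (enum_fset (msupp a)) xpredT id k ka isT.
by rewrite leqNgt hk.
Qed.

Lemma half_coef_bound (a : G) :
  exists n, forall k, (n <= k)%N -> half_coef k a = 0.
Proof.
have [n1 h1] := coef_bound (a : extalg A).1.
have [n2 h2] := coef_bound (a : extalg A).2.
exists (maxn n1 n2).*2 => k; rewrite -geq_half_double geq_max => /andP[k1 k2].
by rewrite /half_coef; case: odd; [exact: h2 | exact: h1].
Qed.

Lemma half_coef_inj (a : G) : (forall k, half_coef k a = 0) -> a = 0.
Proof.
move=> h; apply: ext_eq; apply: coef_eq0 => n.
  by have := h n.*2; rewrite /half_coef odd_double doubleK.
by have := h n.*2.+1; rewrite /half_coef /= odd_double /= uphalf_double.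
Qed.

Lemma half_coef_parity j i (a : G) : homog (sa_gr G) i a -> i != odd j ->
  half_coef j a = 0.
Proof.
by move=> /ext_homogP; rewrite /half_coef; case: i (odd j) => [] [] // -> _;
  rewrite linear0.
Qed.

Lemma half_coef0 : half_coef 0 =1 @counit K G.
Proof.
move=> a; rewrite /counit [RHS]/(ext_fun _ _ _) /ext_fun mulr0 addr0.
rewrite /half_coef /=; move: (a : extalg A).1; apply: (monalg_ext (V := K^o)).
- by move=> k u v; rewrite linearP.
- by move=> k u v; rewrite linearP.
by move=> m; rewrite linext_mon coef_mon /= expr0n.
Qed.

Local Notation S := (mon K (1%N, 0%N) + mon K (0%N, 1%N) : A2).

Lemma gmul_left_rightE :
  (gmul left_pt right_pt (ext_in coT) =
    (((S, 0) : extalg A2), ((0, c%:A) : extalg A2)) :> sext R1) *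
  (gmul left_pt right_pt (ext_z A) =
    (((0, 1) : extalg A2), ((1, 0) : extalg A2)) :> sext R1).
Proof.
have [mT mz] := Gas_mulE c left_pt right_pt; split.
  rewrite [LHS]mT.
  have -> : left_pt (ext_in coT) = sext_in R1 (ext_in (mon K (1%N, 0%N))).
    by rewrite shom_compE ext_ptE.
  have -> : left_pt (ext_z A) = sext_in R1 (ext_z A2) by rewrite shom_compE ext_pt_z.
  have -> : right_pt (ext_in coT) = sext_in R1 (ext_in (mon K (0%N, 1%N))).
    by rewrite ext_ptE.
  have -> : right_pt (ext_z A) = sext_eps R1 by rewrite ext_pt_z.
  rewrite sext_in_eps; apply: sext_eq; apply: ext_eq; rewrite /= ?addr0 ?add0r //;
    by rewrite ?scaler0 ?addr0.
rewrite [LHS]mz shom_compE !ext_pt_z.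
by apply: sext_eq; apply: ext_eq; rewrite /= ?addr0 ?add0r.
Qed.

(** Since z z' is even of square 0, (S + c z z')^m = S^m + m c S^(m-1) z z'. At m = 0 the
    coefficient is 0, so the truncated exponent [m.-1] does no harm. *)
Lemma gmul_T_exp m : gmul left_pt right_pt (ext_in (mon K m)) =
  (((S ^+ m, 0) : extalg A2), ((0, (c *+ m) *: S ^+ m.-1) : extalg A2)) :> sext R1.
Proof.
elim: m => [|m IHm].
  by rewrite [ext_in _](_ : _ = 1) // rmorph1 mulr0n scale0r expr0.
have -> : ext_in (mon K m.+1) = ext_in coT * ext_in (mon K m).
  by rewrite -ext_inM monM.
rewrite [LHS]rmorphM [X in X * _]gmul_left_rightE.1 [X in _ * X]IHm sextM /=.
have -> : parity ((S ^+ m, 0) : R1) = ((S ^+ m, 0) : extalg A2).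
  by apply: parity_even; apply/ext_homogP.
apply: sext_eq; apply: ext_eq; rewrite /= ?mulr0 ?mul0r ?addr0 ?add0r ?exprS //.
rewrite -scalerAr -scalerAl mul1r; case: m {IHm} => [|m].
  by rewrite mulr0n scale0r add0r mulr1n.
by rewrite -[S * _]exprS -scalerDl -mulrSr.
Qed.

Lemma gmul_half_basis m :
  (gmul left_pt right_pt (half_basis m.*2) =
    (((S ^+ m, 0) : extalg A2), ((0, (c *+ m) *: S ^+ m.-1) : extalg A2)) :> sext R1) *
  (gmul left_pt right_pt (half_basis m.*2.+1) =
    (((0, S ^+ m) : extalg A2), ((S ^+ m, 0) : extalg A2)) :> sext R1).
Proof.
have -> : half_basis m.*2 = ext_in (mon K m).
  by rewrite /half_basis odd_double doubleK.
have -> : half_basis m.*2.+1 = ext_in (mon K m) * ext_z A.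
  rewrite /half_basis /= odd_double /= uphalf_double.
  by apply: ext_eq; rewrite /= ?(mulr0, mulr1, addr0, mul0r).
split; first exact: gmul_T_exp.
rewrite [LHS]rmorphM [X in X * _]gmul_T_exp [X in _ * X]gmul_left_rightE.2 sextM /=.
rewrite [parity _](_ : _ = ((0, -1) : extalg A2)); last first.
  rewrite parity_odd ?oppr0; last exact/ext_homogP.
  by apply: ext_eq; rewrite //= oppr0.
by apply: sext_eq; apply: ext_eq; rewrite /= ?(mulr0, mulr1, mul0r, addr0, add0r).
Qed.

(** Mixed parities are where the interleaved order matters. If 2m + 1 <= 2N then m < N, and S^m
    contains no T'^N; if 2m <= 2N + 1 then m <= N, and S^(m-1), from the twist, contains none
    either. *)
Lemma half_slice_basis k j : (j <= k)%N ->
  half_slice k (gmul left_pt right_pt (half_basis j)) = ((j == k)%:R : K)%:A.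
Proof.
have boolA (b : bool) : (b%:R : K)%:A = ((b%:R, 0) : extalg A) :> G.
  by case: b; rewrite ?scale1r ?scale0r.
have slice0 N : slice N (0 : A2) = 0 by rewrite linear0.
have half_cases n : n = if odd n then n./2.*2.+1 else n./2.*2.
  by rewrite -{1}[n]odd_double_half; case: odd.
rewrite boolA; move: (half_cases j) (half_cases k).
move: (j./2) (k./2) => m N; case: (odd j) => ->; case: (odd k) => -> le;
  rewrite gmul_half_basis;
  rewrite /half_slice /slice_ext /= ?odd_double /= ?uphalf_double ?doubleK ?slice0.
- by rewrite ltnS leq_double in le; rewrite eqSS -!muln2 eqn_pmul2r // slice_exp.
- rewrite ltn_double in le; rewrite slice_exp ?(ltnW le) // (ltn_eqF le).
  rewrite (_ : (_ == _) = false) //.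
  by apply/eqP => /(congr1 odd); rewrite /= !odd_double.
- rewrite (_ : (_ == _) = false); last first.
    by apply/eqP => /(congr1 odd); rewrite /= !odd_double.
  have {}le : (m <= N)%N by rewrite leqNgt -ltn_Sdouble -leqNgt.
  case: m le => [|m] le; first by rewrite mulr0n scale0r slice0.
  rewrite linearZ /= slice_exp ?(ltnW le) //.
  by rewrite (ltn_eqF le) scaler0.
by rewrite leq_double in le; rewrite -!muln2 eqn_pmul2r // slice_exp.
Qed.

Lemma Ga_super_unipotent : unipotent G.
Proof.
apply: (unipotent_criterion (g := left_pt) (h := right_pt)
  (E := fun k => half_slice k) (l := fun k => half_coef k)
  (B := half_basis) (par := odd)).
- exact: half_coef_bound.
- exact: half_coef_inj.
- exact: half_coef_basis.
- exact: half_slice_prod.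
- exact: half_slice_basis.
- exact: half_coef0.
by move=> j i a; exact: half_coef_parity.
Qed.

End GaSuperUnipotent.

(** * Unipotency of the trivial group and of G_a *)

Section OtherUnipotent.
Variable K : fieldType.

Lemma triv_sghom_mul (G : supergroup K) (R : superalg K) (g h : shom G R) :
  shom_comp (gmul g h) (triv_pt G) =
  gmul (s := triv_grp K) (shom_comp g (triv_pt G)) (shom_comp h (triv_pt G)).
Proof. exact: triv_uniq. Qed.

Definition to_triv (G : supergroup K) : sghom G (triv_grp K) :=
  @SGHom K G (triv_grp K) (triv_pt G) (@triv_sghom_mul G).

Lemma triv_unipotent : unipotent (triv_grp K).
Proof.
have := @Ga_super_unipotent K 0.
apply: (@unipotent_quotient K _ _ (to_triv (Ga_super 0))
  (gone (Ga_super 0) (base_superalg K))).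
  exact: linearP.
move=> k; rewrite -[LHS]/(shom_comp (gone (Ga_super 0) _) (triv_pt _) k).
by rewrite (triv_uniq (shom_comp _ _) (shom_id _)).
Qed.

Definition Ga_proj : shom (Ga K) (Ga_super (0 : K)) :=
  a_pt (R := Ga_super 0) (erefl : homog (sa_gr (Ga_super 0)) false (ext_in coT)).

Lemma Ga_projE : Ga_proj coT = ext_in coT. Proof. exact: a_ptE. Qed.

Lemma Ga_proj_mul (R : superalg K) (g h : shom (Ga_super 0) R) :
  shom_comp (gmul g h) Ga_proj =
  gmul (s := Ga K) (shom_comp g Ga_proj) (shom_comp h Ga_proj).
Proof.
apply: a_pt_ext; rewrite [RHS]Ga_mulE !shom_compE Ga_projE [LHS](Gas_mulE _ _ _).1.
by rewrite scale0r addr0.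
Qed.

(** At c = 0 the map (a, z) to a is a morphism onto G_a, and setting z = 0 retracts its
    comorphism. *)
Lemma Ga_unipotent : unipotent (Ga K).
Proof.
have := @Ga_super_unipotent K 0.
apply: (@unipotent_quotient K _ _
  (@SGHom K (Ga_super 0) (Ga K) Ga_proj Ga_proj_mul) (ext_proj K nat)).
  exact: linearP.
move=> a; rewrite -[LHS]/(shom_comp (ext_proj K nat) Ga_proj a).
rewrite -[RHS]/(shom_id (Ga K) a); congr (shom_fun _ a); apply: a_pt_ext.
by rewrite shom_compE Ga_projE.
Qed.

End OtherUnipotent.

(* The odd additive group: 'I_1 is the one-element monoid, so K['I_1] = K. *)
Section OddLine.
Variable K : fieldType.
Implicit Types R S : superalg K.
Local Notation E1 := (ext_superalg (monoid_alg K 'I_1)).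

Definition one_char R : char_pt 'I_1 R :=
  CharPt (cp_fun := fun _ => 1) erefl (fun _ _ => esym (mulr1 1))
    (fun _ => sa_one R).

Definition odd_pt R (z : R) (hz : homog (sa_gr R) true z) : shom E1 R :=
  ext_pt (one_char R) hz.

Lemma odd_ptE R (z : R) (hz : homog (sa_gr R) true z) : odd_pt hz (ext_z _) = z.
Proof. exact: ext_pt_z. Qed.

Lemma odd_pt_ext R (g h : shom E1 R) : g (ext_z _) = h (ext_z _) -> g = h.
Proof.
move=> gh; apply: ext_pt_ext => // m.
by rewrite [m]ord1 mon0 ext_in1 !rmorph1.
Qed.

Definition odd_mul R (g h : shom E1 R) : shom E1 R :=
  odd_pt (homogD (odd_ext_z g) (odd_ext_z h)).
Definition odd_inv R (g : shom E1 R) : shom E1 R := odd_pt (homogN (odd_ext_z g)).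

Lemma odd_mulA R : associative (@odd_mul R).
Proof. by move=> g h k; apply: odd_pt_ext; rewrite !odd_ptE addrA. Qed.
Lemma odd_mul1 R : left_id (odd_pt (od0 R)) (@odd_mul R).
Proof. by move=> g; apply: odd_pt_ext; rewrite !odd_ptE add0r. Qed.
Lemma odd_mulV R : left_inverse (odd_pt (od0 R)) (@odd_inv R) (@odd_mul R).
Proof. by move=> g; apply: odd_pt_ext; rewrite !odd_ptE addNr. Qed.
Lemma odd_nat R S (f : shom R S) (g h : shom E1 R) :
  shom_comp f (odd_mul g h) = odd_mul (shom_comp f g) (shom_comp f h).
Proof. by apply: odd_pt_ext; rewrite !(shom_compE, odd_ptE) rmorphD. Qed.

Lemma ord1_gen (P : monoid_alg K 'I_1 -> Prop) : P 1 ->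
  (forall a b, P a -> P b -> P (a * b)) -> (forall a, a \in [::] -> P a) ->
  forall m, P (mon K m).
Proof. by move=> P1 _ _ m; rewrite [m]ord1 mon0. Qed.

Definition odd_Ga : supergroup K :=
  @Supergroup K E1 (fin_gen_ext ord1_gen) odd_mul (fun R => odd_pt (od0 R)) odd_inv
    odd_mulA odd_mul1 odd_mulV odd_nat.

Definition odd_proj : shom odd_Ga (Ga_super (0 : K)) :=
  odd_pt (R := Ga_super 0) (odd_ext_z (shom_id (Ga_super 0))).

Lemma odd_projE : odd_proj (ext_z _) = ext_z _. Proof. exact: odd_ptE. Qed.

Lemma odd_proj_mul (R : superalg K) (g h : shom (Ga_super 0) R) :
  shom_comp (gmul g h) odd_proj =
  gmul (s := odd_Ga) (shom_comp g odd_proj) (shom_comp h odd_proj).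
Proof.
apply: odd_pt_ext; rewrite [RHS]odd_ptE !shom_compE odd_projE.
exact: (Gas_mulE _ _ _).2.
Qed.

Definition odd_retraction : shom (Ga_super (0 : K)) odd_Ga :=
  az_pt (R := odd_Ga) (ev0 odd_Ga) (odd_ext_z (shom_id odd_Ga)).

(** The other projection (a, z) to z, whose comorphism is retracted by setting T = 0. *)
Lemma odd_unipotent : unipotent odd_Ga.
Proof.
have := @Ga_super_unipotent K 0.
apply: (@unipotent_quotient K _ _ (@SGHom K (Ga_super 0) odd_Ga odd_proj odd_proj_mul)
  odd_retraction).
  exact: linearP.
move=> a; rewrite -[LHS]/(shom_comp odd_retraction odd_proj a).
rewrite -[RHS]/(shom_id odd_Ga a); congr (shom_fun _ a); apply: odd_pt_ext.
rewrite shom_compE odd_projE; exact: (az_ptE _ _).2.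
Qed.

End OddLine.

(** * Unipotent radicals *)

Section Clifford.
Variables (K : fieldType) (d : K).
Local Notation HH := (Gm_super d).
Local Notation V := (K^o * K^o)%type.
Local Notation t := (ext_in cot : HH).
Local Notation z := (ext_z (monoid_alg K int) : HH).

Definition cl_odd (v : V) : V := (0, v.2).

Lemma cl_odd_linear : linear cl_odd.
Proof. by move=> k u v; congr (_, _); rewrite /= scaler0 addr0. Qed.

Definition cl_grading : grading V := Grading cl_odd_linear (fun _ => erefl).

Definition cl_space : superspace K := Superspace cl_grading.

(* The action of v in Lie(G)_1, with v v = d y: the coaction is
   w |-> w (x) t + (v w) (x) t z. *)
Definition cl_act (v : V) : V := (v.2, d * v.1).

Lemma cl_act_linear : linear cl_act.
Proof.
move=> k u v; congr (_, _); rewrite /= mulrDr; congr (_ + _).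
exact: mulrCA.
Qed.

Definition tz : HH := t * z.

Lemma shom_tz (R : superalg K) (g : shom HH R) : g tz = g t * g z.
Proof. exact: rmorphM. Qed.

Definition cl_coact (v : V) : seq (V * HH) := [:: (v, t); (cl_act v, tz)].

Lemma cl_coact_linear k u v : tensor_eq (cl_coact (k *: u + v))
  ([seq (k *: p.1, p.2) | p <- cl_coact u] ++ cl_coact v).
Proof.
move=> X b br bl; rewrite !big_cons !big_nil /= !addr0 cl_act_linear.
have bZ a (w : V) : b (k *: w) a = k *: b w a.
  have := bl a k w 0; rewrite addr0 /= => ->.
  by have := bl a (-1) 0 0; rewrite scaleN1r oppr0 addr0 scaleN1r addNr => ->;
    rewrite addr0.
by rewrite [in LHS]bl [X in _ + X]bl !bZ addrACA -addrA.
Qed.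

Lemma cl_counit v : \sum_(p <- cl_coact v) counit p.2 *: p.1 = v.
Proof.
rewrite !big_cons big_nil /= addr0 /tz counitM.
have -> : @counit K HH z = 0 by rewrite /counit [gone _ _ _](Gms_oneE _).2.
have -> : @counit K HH t = 1 by rewrite /counit [gone _ _ _](Gms_oneE _).1.
by rewrite mulr0 scale0r addr0 scale1r.
Qed.

(** The factor 1 + d z z' drops out because z z' (z + z') = 0. *)
Lemma gmul_tz (R : superalg K) (g h : shom HH R) : gmul g h tz =
  g tz * h t + g t * h tz.
Proof.
rewrite !shom_tz !Gm_super_mulE.
have ht0 := even_ext_in h cot; have gz1 := odd_ext_z g; have hz1 := odd_ext_z h.
rewrite /ufactor -(mulrA (g t * h t)) mulrDl mul1r -scalerAl.
rewrite (_ : g z * h z * (g z + h z) = 0); last first.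
  by rewrite mulrDr odd_xyx // -mulrA (sa_sqr hz1) mulr0 addr0.
rewrite scaler0 addr0 mulrDr -!mulrA; congr (_ * _ + _).
exact: even_central.
Qed.

(** Coassociativity comes down to v v = d: the term d (t z (x) t z) of Delta t is matched by
    applying [cl_act] twice. *)
Lemma cl_mul (R : superalg K) (g h : shom HH R) v : @tensor_eq K V R
  [seq (p.1, gmul g h p.2) | p <- cl_coact v]
  [seq (q.1, g q.2 * h p.2) | p <- cl_coact v, q <- cl_coact p.1].
Proof.
have E1 := (Gm_super_mulE g h).1; have E2 := gmul_tz g h.
move: (gmul g h) E1 E2 => gh E1 E2 X b br bl.
rewrite big_allpairs_dep !big_map !big_cons !big_nil /= !addr0.
have bD w x y : b w (x + y) = b w x + b w y.
  by have := br w 1 x y; rewrite !scale1r.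
have bZ k w a : b (k *: w) a = b w (k *: a).
  have := bl a k w 0; rewrite addr0 /= => ->.
  have := br w k a 0; rewrite addr0 /= => ->.
  have := br w (-1) 0 0; rewrite scaleN1r oppr0 addr0 scaleN1r addNr => ->.
  by have := bl a (-1) 0 0; rewrite scaleN1r oppr0 addr0 scaleN1r addNr => ->.
have -> : cl_act (cl_act v) = d *: v by [].
rewrite E1 E2 bZ /ufactor mulrDr mulr1 !bD.
rewrite !shom_tz.
have -> : g t * h t * (d *: (g z * h z)) = d *: (g t * g z * (h t * h z)).
  rewrite -scalerAr -!mulrA (mulrA (g z)) -(even_central _ (even_ext_in h cot)).
  by rewrite -mulrA.
by rewrite -!addrA; congr (_ + _); rewrite [LHS]addrC -addrA.
Qed.

Lemma cl_even i v : homog (ss_gr cl_space) i v ->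
  exists2 s, tensor_eq (cl_coact v) s & forall p, p \in s -> exists j,
    homog (ss_gr cl_space) j p.1 /\ homog (sa_gr HH) (i (+) j) p.2.
Proof.
move=> hv; exists (cl_coact v) => // p; rewrite !inE => /orP[] /eqP -> /=.
  by exists i; rewrite addbb; split.
exists (~~ i); rewrite addbN addbb; split.
  case: v i hv => [v1 v2] [] /=; rewrite /homog /cl_act /= /cl_odd /= => -[].
    by move=> <-; rewrite mulr0.
  by move=> ->.
apply: (@sa_mul _ HH false true t z); last exact: (odd_ext_z (shom_id HH)).
exact: (even_ext_in (shom_id HH) cot).
Qed.

Definition clifford : supermodule HH := @Supermodule K HH cl_space cl_coact
  cl_coact_linear cl_counit cl_mul cl_even.

Section Embedded.
Variables (M : supergroup K) (j : sghom M HH).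
Local Notation tau := (comor j t).
Local Notation zeta := (comor j z).

(** A nonzero graded subspace contains (1, 0) or (0, 1), and the action exchanges the two lines,
    with factors d and 1. Only graded subspaces count, so d may or may not be a square in K. *)
Lemma clifford_simple : d != 0 -> zeta != 0 ->
  simple_supermodule (pullback j clifford).
Proof.
(* t is invertible, so t z restricts to 0 only if z does. *)
move=> d0 zeta0; have tz0 : comor j (tz) != 0.
  apply: contra_neq zeta0 => e.
  have -> : z = ext_in cotV * tz by rewrite /tz mulrA -ext_inM monM mul1r.
  rewrite [LHS](rmorphM (comor j)); exact: etrans (congr1 ( *%R _) e) (mulr0 _).
split; first by exists ((1, 0) : V) => -[/eqP]; rewrite oner_eq0.
move=> W [W0 Wl Wgr Wco].
have WZ k (v : V) : W v -> W (k *: v).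
  by move=> Wv; have := Wl k v 0 Wv W0; rewrite addr0.
have W2 (v : V) : W v -> v.2 != 0 -> W ((0, 1) : V).
  move=> /Wgr /(WZ v.2^-1) Wv v2; suff -> : (0, 1) = v.2^-1 *: (0, v.2) :> V by [].
  by congr (_, _); rewrite /= ?scaler0 //; exact/esym/mulVf.
have W1 (v : V) : W v -> v.1 != 0 -> W ((1, 0) : V).
  move=> Wv v1; have /(WZ v.1^-1) := Wl (-1) _ _ (Wgr _ Wv) Wv.
  suff -> : v.1^-1 *: (-1 *: (0, v.2) + v) = (1, 0) :> V by [].
  congr (_, _); rewrite /= ?scaler0 ?add0r ?scaleN1r ?addNr ?scaler0 //.
  exact: mulVf.
(* A functional vanishing on W kills the t-term of the coaction and leaves l(v u) (x) t z = 0, with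
   t z nonzero on M; this replaces stability of W under v. *)
have vanish (l : V -> K) u : linear (l : V -> K^o) -> (forall w, W w -> l w = 0) ->
    W u -> l u = 0 -> l (cl_act u) = 0.
  move=> ll lW Wu lu; have [s es Ws] := Wco u Wu.
  have := es M (fun v a => l v *: a).
  rewrite [\sum_(p <- s) _]big1_seq => [|p /andP[_ /Ws /lW ->]]; last exact: scale0r.
  rewrite !big_cons big_nil /= lu scale0r add0r addr0 => E.
  have /eqP : l (cl_act u) *: comor j tz = 0.
    apply: E => [v k a b|a k v w]; first by rewrite scalerDr !scalerA mulrC.
    by rewrite ll scalerDl scalerA.
  by rewrite scaler_eq0 (negbTE tz0) orbF => /eqP.
have W12 : W ((1, 0) : V) -> W ((0, 1) : V).
  move=> We; apply: contrapT => nW2.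
  have snd0 w : W w -> w.2 = 0 by move=> Ww; apply/eqP/negPn/negP => /(W2 w Ww).
  have := vanish snd _ (fun _ _ _ => erefl) snd0 We erefl.
  by rewrite /= mulr1; apply/eqP.
have W21 : W ((0, 1) : V) -> W ((1, 0) : V).
  move=> Wf; apply: contrapT => nW1.
  have fst0 w : W w -> w.1 = 0 by move=> Ww; apply/eqP/negPn/negP => /(W1 w Ww).
  have /eqP := vanish fst _ (fun _ _ _ => erefl) fst0 Wf erefl.
  by rewrite oner_eq0.
have full : W ((1, 0) : V) -> forall v, W v.
  move=> We v; have := Wl v.1 _ _ We (WZ v.2 _ (W12 We)).
  suff -> : v.1 *: ((1, 0) : V) + v.2 *: ((0, 1) : V) = v by [].
  case: v => v1 v2; congr (_, _); rewrite /= ?scaler0 ?addr0 ?add0r; exact: mulr1.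
have [We|nWe] := pselect (W ((1, 0) : V)); [by right; exact: full | left].
move=> v Wv; case: (eqVneq v.1 0) => [v1|/(W1 v Wv) //].
case: (eqVneq v.2 0) => [v2|/(W2 v Wv) /W21 //].
by rewrite [v]surjective_pairing v1 v2.
Qed.

Lemma unipotent_odd0 : d != 0 -> unipotent M -> zeta = 0.
Proof.
move=> d0 unM; apply/eqP/negPn/negP => zeta0.
have [[v v0 line] _] := unM _ (clifford_simple d0 zeta0).
have [k1 e1] := line ((1, 0) : V); have [k2 e2] := line ((0, 1) : V).
have [a1 b1] : 1 = k1 * v.1 /\ 0 = k1 * v.2.
  by split; [move/(congr1 fst): e1 | move/(congr1 snd): e1].
have [_ b2] : 0 = k2 * v.1 /\ 1 = k2 * v.2.
  by split; [move/(congr1 fst): e2 | move/(congr1 snd): e2].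
have /eqP : (1 : K) = 0.
  (* Determinant of two multiples of one vector: 1 = (k1 v_1)(k2 v_2) = (k1 v_2)(k2 v_1) = 0. *)
  by rewrite -[1]mulr1 {1}a1 b2 mulrACA [v.1 * _]mulrC mulrACA -b1 mul0r.
by rewrite oner_eq0.
Qed.

End Embedded.
End Clifford.

Section GrouplikeLine.
Variables (K : fieldType) (G : supergroup K) (c : G).
Hypotheses (c_even : homog (sa_gr G) false c) (c_grp : grouplike c).

Definition line_space : superspace K := Superspace (zero_grading K^o).

Definition line_coact (v : line_space) : seq (line_space * G) := [:: (v, c)].

Lemma line_coact_linear k u v : tensor_eq (line_coact (k *: u + v))
  ([seq (k *: p.1, p.2) | p <- line_coact u] ++ line_coact v).
Proof.
move=> X b br bl; rewrite !big_cons !big_nil /= !addr0.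
by have := bl c 1 (k *: u) v; rewrite !scale1r.
Qed.

Lemma line_counit v : \sum_(p <- line_coact v) counit p.2 *: p.1 = v.
Proof. by rewrite big_seq1 /= c_grp.1 scale1r. Qed.

Lemma line_mul (R : superalg K) (g h : shom G R) v : @tensor_eq K line_space R
  [seq (p.1, gmul g h p.2) | p <- line_coact v]
  [seq (q.1, g q.2 * h p.2) | p <- line_coact v, q <- line_coact p.1].
Proof.
by move=> X b br bl; rewrite big_allpairs_dep !big_map !big_seq1 /= c_grp.2.
Qed.

Lemma line_even i (v : line_space) : homog (ss_gr line_space) i v ->
  exists2 s, tensor_eq (line_coact v) s & forall p, p \in s -> exists j,
    homog (ss_gr line_space) j p.1 /\ homog (sa_gr G) (i (+) j) p.2.
Proof.
move=> hv; exists (line_coact v) => // p; rewrite inE => /eqP -> /=.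
by exists i; rewrite addbb.
Qed.

Definition grouplike_line : supermodule G := @Supermodule K G line_space line_coact
  line_coact_linear line_counit line_mul line_even.

(** A grouplike c makes K a one-dimensional, hence simple, comodule; its triviality says 1 (x) c = 1
    (x) 1. *)
Lemma unipotent_grouplike : unipotent G -> c = 1.
Proof.
move=> unG; have [|_ fixed] := unG grouplike_line.
  split=> [|W [W0 Wl _ _]]; first by exists (1 : K^o); apply/eqP/oner_neq0.
  have [[w [Ww w0]]|nW] := pselect (exists w : K^o, W w /\ w != 0).
    right=> v; have := Wl (v / w) w 0 Ww W0; rewrite addr0.
    by rewrite -[_ *: w]/(v / w * w) divfK.
  by left=> v Wv; apply/eqP/negPn/negP => v0; apply: nW; exists v.
have := fixed (1 : K^o) G (fun (v : K^o) a => v *: a).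
rewrite !big_seq1 /= !scale1r; apply=> [v k a b|a k v w].
  by rewrite scalerDr !scalerA mulrC.
by rewrite scalerDl scalerA.
Qed.

End GrouplikeLine.

Lemma shom_compA (K : fieldType) (A B C D : superalg K) (f : shom C D)
  (g : shom B C) (h : shom A B) :
  shom_comp f (shom_comp g h) = shom_comp (shom_comp f g) h.
Proof. exact: shom_ext. Qed.

Section Composition.
Variables (K : fieldType) (F G H : supergroup K) (f : sghom G H) (g : sghom F G).

Lemma sg_comp_mul (R : superalg K) (u v : shom F R) :
  shom_comp (gmul u v) (shom_comp (comor g) (comor f)) =
  gmul (shom_comp u (shom_comp (comor g) (comor f)))
    (shom_comp v (shom_comp (comor g) (comor f))).
Proof. by rewrite !shom_compA !comor_mul. Qed.

Definition sg_comp : sghom F H := SGHom sg_comp_mul.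

End Composition.

(** * Unipotent radicals when d is nonzero *)

Section Radicals.
Variables (K : fieldType) (c d : K).
Local Notation GG := (GaGm_super c d).
Local Notation HH := (Gm_super d).

Lemma unipotent_to_Gm_super (M : supergroup K) (j : sghom M HH) : d != 0 ->
  unipotent M -> comor j (ext_in cot) = 1 /\ comor j (ext_z _) = 0.
Proof.
move=> d0 unM; have z0 := unipotent_odd0 j d0 unM; split=> //.
apply: unipotent_grouplike => //; first exact: (even_ext_in (comor j)).
split; first by rewrite counit_comor /counit [gone _ _ _](Gms_oneE _).1.
move=> R g h; have := congr1 (fun f => shom_fun f (ext_in cot)) (comor_mul j g h).
by rewrite Gm_super_mulE !shom_compE z0 !rmorph0 ufactor0 mulr1.
Qed.

Lemma triv_closed (G : supergroup K) : closed_embedding (triv_incl G).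
Proof.
move=> b; exists (b%:A : G); rewrite linearZ rmorph1; exact: mulr1.
Qed.

Lemma triv_normal (G : supergroup K) : normal_image (triv_incl G).
Proof.
move=> R g n; exists n.
have -> : on_points (triv_incl G) n = gone G R by exact: gone_nat.
by rewrite gmulg1 gmulgV.
Qed.

Lemma central_normal (N G : supergroup K) (i : sghom N G) :
  central_image i -> normal_image i.
Proof.
by move=> ci R g n; exists n; rewrite ci -gmulA gmulgV gmulg1.
Qed.

Lemma Gm_super_radical : d != 0 -> is_unipotent_radical (triv_incl HH).
Proof.
move=> d0; split; [exact: triv_closed|exact: triv_normal|exact: triv_unipotent|].
move=> M j _ _ unM; exists (to_triv M) => R m.
have [jt jz] := unipotent_to_Gm_super j d0 unM.
apply: mz_pt_ext; rewrite /on_points !shom_compE ?jt ?jz.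
  rewrite [comor (triv_incl HH) _](Gms_oneE _).1.
  by rewrite !rmorph1.
by rewrite [comor (triv_incl HH) _](Gms_oneE _).2 !rmorph0.
Qed.

Lemma GaGm_super_radical : d != 0 -> is_unipotent_radical (Ga_GaGm_super c d).
Proof.
move=> d0; split.
- exact: Ga_closed_embedding.
- exact/central_normal/Ga_central.
- exact: Ga_unipotent.
move=> M j _ _ unM.
have [] := unipotent_to_Gm_super (sg_comp (GaGm_Gm_super c d) j) d0 unM.
rewrite !shom_compE !quot_comorE => jt jz.
(* Composing with the quotient shows t = 1 and z = 0 on M. What remains of [j] is its T-coordinate,
   which is additive because the twist c z z' vanishes. *)
pose k := shom_comp (comor j) (Ga_section c d).
have kM (R : superalg K) (g h : shom M R) :
    shom_comp (gmul g h) k = gmul (s := Ga K) (shom_comp g k) (shom_comp h k).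
  apply: a_pt_ext; rewrite [RHS]Ga_mulE !shom_compE Ga_sectionE.
  have := congr1 (fun f => shom_fun f (ext_in coT2)) (comor_mul j g h).
  by rewrite GaGm_super_mulE !shom_compE jz !rmorph0 mulr0 scaler0 addr0.
exists (SGHom kM) => R m; apply: amz_pt_ext; rewrite Ga_ptE /on_points !shom_compE.
- by congr (m (comor j _)); exact: Ga_sectionE.
- by rewrite jt rmorph1.
by rewrite jz rmorph0.
Qed.

End Radicals.

(** * Larger unipotent normal subgroups when d = 0 *)

Section ZeroBeta.
Variables (K : fieldType) (c : K).
Local Notation GG := (GaGm_super c 0).
Local Notation HH := (Gm_super (0 : K)).
Local Notation N := (Ga_super c).
Local Notation L := (odd_Ga K).

Lemma ufactor_zero (R : superalg K) (x y : R) : ufactor 0 x y = 1.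
Proof. by rewrite /ufactor scale0r addr0. Qed.

Definition N_comor : shom GG N :=
  amz_pt (R := N) (even_ext_in (shom_id N) coT) (ev1 N) (ev1 N)
    (odd_ext_z (shom_id N)) (mulr1 1).

Lemma N_comorE : (N_comor (ext_in coT2) = ext_in coT) *
  (N_comor (ext_in cot2) = 1) * (N_comor (ext_in cotV2) = 1) *
  (N_comor (ext_z _) = ext_z _).
Proof. exact: (amz_ptE (R := N)). Qed.

Lemma N_comor_mul (R : superalg K) (g h : shom N R) :
  shom_comp (gmul g h) N_comor =
  gmul (s := GG) (shom_comp g N_comor) (shom_comp h N_comor).
Proof.
apply: amz_pt_ext; rewrite GaGm_super_mulE !shom_compE !N_comorE.
- exact: (Gas_mulE c g h).1.
- by rewrite ufactor_zero !rmorph1 !mulr1.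
exact: (Gas_mulE c g h).2.
Qed.

Definition N_incl : sghom N GG := SGHom N_comor_mul.

Lemma N_ptE (R : superalg K) (n : shom N R) :
  (on_points N_incl n (ext_in coT2) = n (ext_in coT)) *
  (on_points N_incl n (ext_in cot2) = 1) *
  (on_points N_incl n (ext_z _) = n (ext_z _)).
Proof. by rewrite /on_points !shom_compE !N_comorE rmorph1. Qed.

Lemma N_closed : closed_embedding N_incl.
Proof.
move=> b; exists (az_pt (R := GG) (even_ext_in (shom_id GG) coT2)
  (odd_ext_z (shom_id GG)) b).
rewrite -[LHS]/(shom_comp N_comor (az_pt (R := GG) _ _) b) -[RHS]/(shom_id N b).
by congr (shom_fun _ b); apply: az_pt_ext; rewrite shom_compE az_ptE N_comorE.
Qed.

(** With d = 0 the coordinate t is a character, so conjugation preserves t = 1; it also fixes z. The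
    T-coordinate can change, by 2 c z z', and is therefore taken from the conjugate itself. *)
Lemma N_normal : normal_image N_incl.
Proof.
move=> R g n; set e := gmul _ _.
exists (az_pt (even_ext_in e coT2) (odd_ext_z n)).
apply: amz_pt_ext; rewrite N_ptE ?az_ptE // /e !GaGm_super_mulE !N_ptE
  !GaGm_super_invE; last by rewrite addrC addKr.
by rewrite !ufactor_zero !mulr1 amz_ptV.
Qed.

(** If the subgroup t = 1 factored through G_a, its coordinate z would be 0. *)
Lemma Ga_not_radical : ~ is_unipotent_radical (Ga_GaGm_super c 0).
Proof.
move=> [_ _ _ /(_ _ _ N_closed N_normal (@Ga_super_unipotent K c))] [k hk].
have /(congr1 (fun f => shom_fun f (ext_z _))) := hk _ (shom_id N).
by rewrite Ga_ptE N_ptE => /(congr1 snd) /esym /eqP; rewrite oner_eq0.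
Qed.

Definition L_comor : shom HH L :=
  mz_pt (R := L) (ev1 L) (ev1 L) (odd_ext_z (shom_id L)) (mulr1 1).

Lemma L_comorE : (L_comor (ext_in cot) = 1) * (L_comor (ext_in cotV) = 1) *
  (L_comor (ext_z _) = ext_z _).
Proof. exact: (mz_ptE (R := L)). Qed.

Lemma L_comor_mul (R : superalg K) (g h : shom L R) :
  shom_comp (gmul g h) L_comor =
  gmul (s := HH) (shom_comp g L_comor) (shom_comp h L_comor).
Proof.
apply: mz_pt_ext; rewrite Gm_super_mulE !shom_compE !L_comorE.
- by rewrite ufactor_zero !rmorph1 !mulr1.
exact: odd_ptE.
Qed.

Definition L_incl : sghom L HH := SGHom L_comor_mul.

Lemma L_ptE (R : superalg K) (n : shom L R) :
  (on_points L_incl n (ext_in cot) = 1) *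
  (on_points L_incl n (ext_z _) = n (ext_z _)).
Proof. by rewrite /on_points !shom_compE !L_comorE rmorph1. Qed.

Lemma L_closed : closed_embedding L_incl.
Proof.
move=> b; exists (odd_pt (R := HH) (odd_ext_z (shom_id HH)) b).
rewrite -[LHS]/(shom_comp L_comor (odd_pt (R := HH) _) b) -[RHS]/(shom_id L b).
by congr (shom_fun _ b); apply: odd_pt_ext; rewrite shom_compE odd_ptE L_comorE.
Qed.

Lemma L_normal : normal_image L_incl.
Proof.
move=> R g n; exists n.
apply: mz_pt_ext; rewrite L_ptE !Gm_super_mulE !L_ptE !Gm_super_invE;
  last by rewrite addrC addKr.
by rewrite !ufactor_zero !mulr1 mz_ptV.
Qed.

Lemma triv_not_radical : ~ is_unipotent_radical (triv_incl HH).
Proof.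
move=> [_ _ _ /(_ _ _ L_closed L_normal (@odd_unipotent K))] [k hk].
have /(congr1 (fun f => shom_fun f (ext_z _))) := hk _ (shom_id L).
rewrite L_ptE /on_points !shom_compE [comor (triv_incl HH) _](Gms_oneE _).2 !rmorph0.
by move=> /(congr1 snd) /esym /eqP; rewrite oner_eq0.
Qed.

End ZeroBeta.

(** * Nonvanishing of x(T) and y(t), and diagonalizability of G_m *)

Lemma evalg_gen_ind (K : fieldType) (M : nmodType) (s : seq (monoid_alg K M)) :
  (forall Q : monoid_alg K M -> Prop, Q 1 -> (forall a b, Q a -> Q b -> Q (a * b)) ->
     (forall a, a \in s -> Q a) -> forall m, Q (mon K m)) ->
  forall P : monoid_alg K M -> Prop,
  P 1 -> (forall k a b, P a -> P b -> P (k *: a + b)) ->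
  (forall a b, P a -> P b -> P (a * b)) -> (forall a, a \in s -> P a) ->
  forall a, P a.
Proof.
move=> H P P1 Pl PM Ps; apply: (@span_mon K M (monoid_alg K M) id P) => //.
exact: H.
Qed.

Lemma Ga_lie_nonzero (K : fieldType) (x : Ga K -> K) :
  lie_spanned_by x -> x coT != 0.
Proof.
move=> [hx [a xa] _]; apply/eqP => xT; apply: xa; apply: (lie_zero hx).
exists [:: coT]; first by move=> p; rewrite inE => /eqP ->.
exact: (evalg_gen_ind (@nat_gen K)).
Qed.

Lemma Gm_lie_nonzero (K : fieldType) (y : Gm K -> K) :
  lie_spanned_by y -> y cot != 0.
Proof.
move=> [hy [a ya] _]; apply/eqP => yt; apply: ya; apply: (lie_zero hy).
exists [:: cot; cotV]; last exact: (evalg_gen_ind (@int_gen K)).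
move=> p; rewrite !inE => /orP[] /eqP -> //.
have ct : counit (cot : Gm K) = 1 by rewrite /counit [gone _ _ _]Gm_oneE.
(* The Leibniz rule on t (1/t) = 1, with y(t) = 0 and eps(t) = 1, gives y(1/t) = 0. *)
have := hy.2 cot cotV; rewrite yt ct mul0r add0r mul1r => <-.
by rewrite -[_ * _]/(mon K (1 : int) * mon K (-1 : int)) monM; exact: (lie1 hy).
Qed.

Lemma Gm_mon_grouplike (K : fieldType) (m : int) :
  grouplike (mon K m : Gm K).
Proof.
move: m; apply: (int_gen (P := fun a => grouplike (a : Gm K))).
- by split=> [|R g h]; [exact: (@counit1 K (Gm K)) | rewrite !rmorph1 mulr1].
- move=> a b [a1 aM] [b1 bM]; split.
    by apply: etrans (@counitM K (Gm K) a b) _; rewrite a1 b1 mulr1.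
  move=> R g h.
  have M (f : shom (Gm K) R) : f (a * b) = f a * f b by exact: rmorphM.
  rewrite !M aM bM -!mulrA; congr (_ * _); rewrite !mulrA; congr (_ * _).
  exact/even_central/even_evenalg.
move=> a; rewrite !inE => /orP[] /eqP ->.
  by split=> [|R g h]; [rewrite /counit [gone _ _ _]Gm_oneE | exact: Gm_mulE].
split=> [|R g h].
  by rewrite /counit [gone _ _ _](m_ptE (R := base_superalg K) _ _ _).2.
exact: (m_ptE _ _ _).2.
Qed.

Lemma Gm_diagonalizable (K : fieldType) : Defs.diagonalizable (Gm K).
Proof.
split=> // a; exists [seq (coef m a, mon K m) | m <- enum_fset (msupp a)].
  by move=> _ /mapP[m _ ->]; exact: Gm_mon_grouplike.
by rewrite big_map /=; exact: monalg_sum.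
Qed.

Lemma Gm_super_diagonalizable (K : fieldType) (d : K) :
  super_diagonalizable (Gm_super d) <-> d != 0.
Proof.
split=> [[_ rad]|d0].
  by apply/eqP => d0; rewrite d0 in rad; exact: triv_not_radical rad.
split; last exact: Gm_super_radical.
by exists (Gm K), (Gm_Gm_super d); split; [exact: Gm_is_ev|exact: Gm_diagonalizable].
Qed.

Lemma Ga_radical (K : fieldType) (c d : K) :
  is_unipotent_radical (Ga_GaGm_super c d) <-> d != 0.
Proof.
split=> [rad|]; last exact: GaGm_super_radical.
by apply/eqP => d0; rewrite d0 in rad; exact: Ga_not_radical rad.
Qed.

Theorem lemma8p2 (K : fieldType) (charK : 2%N \notin [pchar K])
  (x : Ga K -> K) (y : Gm K -> K)
  (hx : lie_spanned_by x) (hy : lie_spanned_by y) (alpha beta : K) :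
  [/\ hc_pair_trivial_line (ev_incl x y alpha beta)
        (fun a => 2%:R * lie_w x y alpha beta a),
      hc_pair_trivial_line (Gm_ev_incl y beta) (fun b => 2%:R * (beta * y b)),
      closed_embedding (Ga_incl x y alpha beta) /\
        central_image (Ga_incl x y alpha beta) &
      is_quotient (Ga_incl x y alpha beta) (quot_map x y alpha beta)]
  /\ (splits (quot_map x y alpha beta) <-> alpha = 0)
  /\ ((is_unipotent_radical (Ga_incl x y alpha beta) <->
         super_diagonalizable (Gm_1 y beta)) /\
      (super_diagonalizable (Gm_1 y beta) <-> beta != 0)).
Proof.
have [lx _ _] := hx; have [ly _ _] := hy.
have x0 := Ga_lie_nonzero hx; have y0 := Gm_lie_nonzero hy.
(* Since x(T) and y(t) are nonzero, the conditions on c and d become conditions on alpha and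
   beta. *)
have cE : alpha * x coT = 0 <-> alpha = 0.
  by split=> [/eqP|->]; rewrite ?mul0r // mulf_eq0 (negbTE x0) orbF => /eqP.
have dE : (beta * y cot != 0) = (beta != 0) by rewrite mulf_eq0 (negbTE y0) orbF.
split; [split|split; [|split]].
- exact: GaGm_hc.
- exact: Gm_hc.
- by split; [exact: Ga_closed_embedding | exact: Ga_central].
- exact: Ga_quotient.
- by apply: iff_trans cE; split; [exact: split_eq0 | exact: split_of_eq0].
- exact: iff_trans (Ga_radical _ _) (iff_sym (Gm_super_diagonalizable _)).
by rewrite -dE; exact: Gm_super_diagonalizable.
Qed.
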